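(* Let $\Omega\subset\mathbb{R}^{N+1}$ be a smoothly bounded domain, or let $\Omega=\mathbb{R}^{N+1}_+$. Let $q\in\{0,1,\dots,N\}$ and let $d^*$ be the Hilbert space adjoint, with respect to the $W^1$ inner product, of the exterior derivative $d$ from $q$-forms to $(q+1)$-forms. Then $$\operatorname{dom} d^*\cap \textstyle\bigwedge^{q+1}_0(\overline{\Omega})=\bigl\{\phi\in\textstyle\bigwedge^{q+1}_0(\overline\Omega):\ (\nabla_{\vec n}\phi)\lfloor\vec n\,\big|_{b\Omega}=0\bigr\}.$$
   Context: $\mathbb{R}^{N+1}_+=\{x=(x_0,x')\in\mathbb{R}\times\mathbb{R}^N: x_0>0\}$; $b\Omega$ is the boundary of $\Omega$ and $\vec n=(n_0,\dots,n_N)$ is the unit normal vector field on $b\Omega$. $\bigwedge^q_0(\overline\Omega)$ is the space of $q$-forms whose coefficients are $C^\infty$ on $\overline\Omega$ with compact support in $\overline\Omega$ (the support may meet the boundary). Forms are written $\phi=\sum_{|I|=q}\phi_I\,dx^I$ with $I$ strictly increasing multi-indices with entries in $\{0,\dots,N\}$. With $D_j=\partial/\partial x_j$, the $W^1$ inner product is $$\langle\phi,\psi\rangle_1=\sum_I\Bigl(\int_\Omega\phi_I\overline{\psi_I}\,dV+\sum_{j=0}^N\int_\Omega D_j\phi_I\,\overline{D_j\psi_I}\,dV\Bigr),$$ $\|\cdot\|_1$ is its norm, and $W^1_q(\Omega)$ is the space of $q$-forms with coefficients in $W^1(\Omega)$. The operator $d$ is regarded as a densely defined operator from $W^1_q(\Omega)$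 to $W^1_{q+1}(\Omega)$, with $d$ acting on $\bigwedge^q_0(\overline\Omega)$; $\psi\in\operatorname{dom}d^*$ means that there is a constant $C_\psi$ with $|\langle d\phi,\psi\rangle_1|\le C_\psi\|\phi\|_1$ for all $\phi\in\bigwedge^q_0(\overline\Omega)$. $\nabla_{\vec n}$ is covariant differentiation of forms in the normal direction and $\lfloor$ is contraction of a form with a vector field. In standard coordinates $$\bigl((\nabla_{\vec n}\phi)\lfloor\vec n\bigr)_I=\sum_{|J|=q+1,\ j=0,\dots,N}\varepsilon^J_{jI}\,n_j\,\frac{\partial\phi_J}{\partial n},$$ where $\partial/\partial n=\sum_j n_jD_j$ and $\varepsilon^J_{jI}$ is $0$ if $J\ne\{j\}\cup I$ as sets (or if $j\in I$) and otherwise is the sign of the permutation putting $jI$ in increasing order. *)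

(* Defs.v *)
From HB Require Import structures.
From mathcomp Require Import all_boot all_order all_algebra.
From mathcomp Require Import complex.
From mathcomp Require Import all_classical all_reals all_analysis.

Set Implicit Arguments.
Unset Strict Implicit.
Unset Printing Implicit Defensive.
Import Order.TTheory GRing.Theory Num.Theory.
Import numFieldNormedType.Exports.
Local Open Scope classical_set_scope.
Local Open Scope ring_scope.

Section lebesgue_Rn.
Variable R : realType.
Local Notation M := (measurableTypeR R).

Definition tcons n (p : M * n.-tuple M) : n.+1.-tuple M :=
  [tuple of p.1 :: p.2].

Lemma measurable_tcons n : measurable_fun setT (@tcons n).
Proof. exact: (measurable_cons measurable_fst measurable_snd). Qed.

Section step.
Variables (n : nat) (m : {sigma_finite_measure set (n.-tuple M) -> \bar R}).

Definition lebesgue_step : set (n.+1.-tuple M) -> \bar R :=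
  pushforward (lebesgue_measure \x m)%E (@tcons n).

Let lebesgue_step0 : lebesgue_step set0 = 0%E.
Proof. by rewrite /lebesgue_step /pushforward preimage_set0 measure0. Qed.

Let lebesgue_step_ge0 A : (0 <= lebesgue_step A)%E.
Proof. exact: (measure_ge0 (lebesgue_measure \x m)%E). Qed.

Let lebesgue_step_sigma_additive : semi_sigma_additive lebesgue_step.
Proof.
pose mu := measure_function_pushforward__canonical__measure_function_Measure
  (lebesgue_measure \x m)%E (@measurable_tcons n).
exact: (@measure_semi_sigma_additive _ _ _ mu).
Qed.

HB.instance Definition _ := isMeasure.Build _ _ _ lebesgue_step
  lebesgue_step0 lebesgue_step_ge0 lebesgue_step_sigma_additive.

Let lebesgue_step_sigma_finite : sigma_finite setT lebesgue_step.
Proof.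
have /sigma_finiteP[F [FT ndF Foo]] := sigma_finiteT (@lebesgue_measure R).
have /sigma_finiteP[G [GT ndG Goo]] := sigma_finiteT m.
pose tuncons (t : n.+1.-tuple M) : M * n.-tuple M :=
  (thead t, [tuple of behead t]).
have tconsK p : tuncons (tcons p) = p.
  by case: p => x t; congr (_, _); exact: val_inj.
have mtuncons : measurable_fun setT tuncons.
  apply: measurable_fun_pair; first exact: measurable_tnth.
  exact: measurable_behead.
exists (fun k => tuncons @^-1` (F k `*` G k)).
  apply/esym; rewrite -subTset => t _.
  have [i _ Fit] : (\bigcup_i F i) (tuncons t).1 by rewrite -FT.
  have [j _ Gjt] : (\bigcup_j G j) (tuncons t).2 by rewrite -GT.
  exists (maxn i j) => //; split.
    by move: Fit; exact/subsetPset/ndF/leq_maxl.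
  by move: Gjt; exact/subsetPset/ndG/leq_maxr.
move=> k; have [mF Fk] := Foo k; have [mG Gk] := Goo k; split.
  rewrite -[X in measurable X]setTI; apply: mtuncons => //.
  exact: measurableX.
rewrite /lebesgue_step /pushforward -comp_preimage (_ : tuncons \o _ = id).
  by rewrite preimage_id product_measure1E// lte_mul_pinfty// ge0_fin_numE.
exact/funext.
Qed.

HB.instance Definition _ := @Measure_isSigmaFinite.Build _ _ _ lebesgue_step
  lebesgue_step_sigma_finite.
End step.
End lebesgue_Rn.

Section lebesgue_row.
Variable R : realType.
Local Notation M := (measurableTypeR R).

Fixpoint lebesgue_tuple n : {sigma_finite_measure set (n.-tuple M) -> \bar R} :=
  match n return {sigma_finite_measure set (n.-tuple M) -> \bar R} with
  | 0 => \d_ [tuple]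
  | n'.+1 => lebesgue_step (lebesgue_tuple n')
  end.

(* The topology lives on row vectors and the product sigma-algebra on tuples;
   integrals over subsets of 'rV[R]_n are transported along this bijection. *)
Definition row_of_tuple n (t : n.-tuple M) : 'rV[R]_n := \row_i tnth t i.

Variable n : nat.
Implicit Types (D : set 'rV[R]_n) (f : 'rV[R]_n -> R).

Definition integral_rV D f : R :=
  \int[lebesgue_tuple n]_(t in @row_of_tuple n @^-1` D) f (row_of_tuple t).

Definition cintegral_rV D (f : 'rV[R]_n -> R[i]) : R[i] :=
  Complex (integral_rV D (@complex.Re R \o f))
          (integral_rV D (@complex.Im R \o f)).

Definition L2 D f : Prop :=
  measurable_fun (@row_of_tuple n @^-1` D) (f \o @row_of_tuple n) /\
  (\int[lebesgue_tuple n]_(t in @row_of_tuple n @^-1` D)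
     ((f (row_of_tuple t)) ^+ 2)%:E < +oo)%E.

Definition cL2 D (f : 'rV[R]_n -> R[i]) : Prop :=
  L2 D (@complex.Re R \o f) /\ L2 D (@complex.Im R \o f).

End lebesgue_row.

Section smooth_functions.
Variables (R : realType) (n : nat).
Implicit Types (Omega : set 'rV[R]_n) (f g : 'rV[R]_n -> R).

Definition partial (j : 'I_n) f : 'rV[R]_n -> R :=
  fun x => 'D_(delta_mx 0 j) f x.

Definition iter_partial (s : seq 'I_n) f : 'rV[R]_n -> R := foldr partial f s.

Definition smooth f : Prop := forall s : seq 'I_n,
  continuous (iter_partial s f) /\
  forall x j, derivable (iter_partial s f) x (delta_mx 0 j).

(* C^oo on the closure of the open set Omega: all the iterated partial
   derivatives exist in Omega and extend continuously to the closure; the values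
   of f off the closure are irrelevant. At a point of Omega, [cvg] is continuity,
   since [within Omega (nbhs p)] then contains only sets containing p. *)
Definition smooth_closure Omega f : Prop :=
  [/\ forall s x j, Omega x -> derivable (iter_partial s f) x (delta_mx 0 j),
      forall s p, closure Omega p ->
        cvg (iter_partial s f y @[y --> within Omega (nbhs p)]) &
      forall p, closure Omega p ->
        f y @[y --> within Omega (nbhs p)] --> f p].

Definition cpartial (j : 'I_n) (f : 'rV[R]_n -> R[i]) : 'rV[R]_n -> R[i] :=
  fun x => Complex (partial j (@complex.Re R \o f) x)
                   (partial j (@complex.Im R \o f) x).

Definition csmooth_closure Omega (f : 'rV[R]_n -> R[i]) : Prop :=
  smooth_closure Omega (@complex.Re R \o f) /\
  smooth_closure Omega (@complex.Im R \o f).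

(* The value at p of the continuous extension of f from Omega to its closure. *)
Definition trace Omega f (p : 'rV[R]_n) : R :=
  lim (f y @[y --> within Omega (nbhs p)]).

Definition ctrace Omega (f : 'rV[R]_n -> R[i]) (p : 'rV[R]_n) : R[i] :=
  Complex (trace Omega (@complex.Re R \o f) p)
          (trace Omega (@complex.Im R \o f) p).

Definition test_function Omega (eta : 'rV[R]_n -> R) : Prop :=
  smooth eta /\
  exists K, [/\ compact K, K `<=` Omega & forall x, ~ K x -> eta x = 0].

Definition weak_partial Omega (j : 'I_n) f g : Prop :=
  forall eta, test_function Omega eta ->
    integral_rV Omega (fun x => f x * partial j eta x) =
    - integral_rV Omega (fun x => g x * eta x).

Definition cweak_partial Omega (j : 'I_n) (f g : 'rV[R]_n -> R[i]) : Prop :=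
  weak_partial Omega j (@complex.Re R \o f) (@complex.Re R \o g) /\
  weak_partial Omega j (@complex.Im R \o f) (@complex.Im R \o g).

End smooth_functions.

Section domains.
Variables (R : realType) (n : nat).
Implicit Types (Omega : set 'rV[R]_n) (rho : 'rV[R]_n -> R).

Definition bdry Omega : set 'rV[R]_n := closure Omega `\` interior Omega.

Definition grad rho (x : 'rV[R]_n) : 'rV[R]_n := \row_j partial j rho x.

(* The library norm on 'rV[R]_n is the sup norm. *)
Definition enorm (v : 'rV[R]_n) : R := Num.sqrt (\sum_j v 0 j ^+ 2).

(* Smoothness of the boundary is expressed by a global defining function. *)
Definition defining_function Omega rho : Prop :=
  [/\ smooth rho, Omega = [set x | rho x < 0] &
      forall p, bdry Omega p -> grad rho p != 0].

Definition smoothly_bounded_domain Omega : Prop :=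
  [/\ open Omega, connected Omega, Omega !=set0, bounded_set Omega &
      exists rho, defining_function Omega rho].

(* Outward unit normal along the boundary; it does not depend on rho. *)
Definition unit_normal_field Omega (nu : 'rV[R]_n -> 'rV[R]_n) : Prop :=
  exists2 rho, defining_function Omega rho &
    forall p, bdry Omega p -> nu p = (enorm (grad rho p))^-1 *: grad rho p.

End domains.

Definition half_space (R : realType) (N : nat) : set 'rV[R]_N.+1 :=
  [set x | 0 < x 0 ord0].

Section forms.
Variables (R : realType) (n : nat).

(* Strictly increasing multi-indices of length q, as q-element subsets. *)
Definition multi_index q := {I : {set 'I_n} | #|I| == q}.

Definition diff_form q := multi_index q -> 'rV[R]_n -> R[i].

(* The word j i_1 ... i_q with i_1 < ... < i_q has one inversion for each
   entry of I below j. *)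
Definition epsilon q (j : 'I_n) (I : multi_index q) (J : multi_index q.+1)
    : R[i] :=
  if (j \notin val I) && (val J == j |: val I)%SET
  then (-1) ^+ #|[set i in val I | (i < j)%N]| else 0.

Definition ext_d q (phi : diff_form q) : diff_form q.+1 := fun J x =>
  \sum_(I : multi_index q) \sum_(j < n) epsilon j I J * cpartial j (phi I) x.

Definition contract_form q (omega : multi_index q.+1 -> R[i]) (v : 'rV[R]_n)
    : multi_index q -> R[i] := fun I =>
  \sum_(J : multi_index q.+1) \sum_(j < n)
    epsilon j I J * (v 0 j)%:C%C * omega J.

(* Covariant derivative along nu at a point of the closure of Omega: in the
   flat metric it acts on the coefficients. *)
Definition nabla Omega (nu : 'rV[R]_n -> 'rV[R]_n) q (phi : diff_form q)
    (p : 'rV[R]_n) : multi_index q -> R[i] := fun J =>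
  \sum_(j < n) (nu p 0 j)%:C%C * ctrace Omega (cpartial j (phi J)) p.

Definition smooth_forms Omega q : set (diff_form q) := [set phi |
  (forall I, csmooth_closure Omega (phi I)) /\
  exists2 K, compact K &
    forall I x, closure Omega x -> ~ K x -> phi I x = 0].

Definition form_grad q (phi : diff_form q) : 'I_n -> diff_form q :=
  fun j I => cpartial j (phi I).

(* phi has coefficients in W^1(Omega) and Phi j is its weak derivative D_j phi
   (unique up to a null set). *)
Definition W1_gradient Omega q (phi : diff_form q) (Phi : 'I_n -> diff_form q)
    : Prop :=
  forall I : multi_index q, cL2 Omega (phi I) /\
    forall j, cL2 Omega (Phi j I) /\
              cweak_partial Omega j (phi I) (Phi j I).

(* The W^1 inner product of forms phi, psi with gradients Phi, Psi. *)
Definition W1_inner Omega q (phi : diff_form q) (Phi : 'I_n -> diff_form q)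
    (psi : diff_form q) (Psi : 'I_n -> diff_form q) : R[i] :=
  \sum_(I : multi_index q)
    (cintegral_rV Omega (fun x => phi I x * (psi I x)^*%C) +
     \sum_(j < n) cintegral_rV Omega (fun x => Phi j I x * (Psi j I x)^*%C)).

Definition W1_norm Omega q (phi : diff_form q) (Phi : 'I_n -> diff_form q)
    : R :=
  Num.sqrt (complex.Re (W1_inner Omega phi Phi phi Phi)).

(* On smooth forms the classical gradient is the weak one; for psi, a general
   element of W^1_{q+1}(Omega), the gradient is the weak one. *)
Definition dom_dstar Omega q : set (diff_form q.+1) := [set psi |
  exists2 Psi, W1_gradient Omega psi Psi &
  exists C : R, forall phi : diff_form q, smooth_forms Omega phi ->
    `|W1_inner Omega (ext_d phi) (form_grad (ext_d phi)) psi Psi| <=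
      (C * W1_norm Omega phi (form_grad phi))%:C%C].

End forms.

Arguments half_space : clear implicits.
Arguments smooth_forms {R n} Omega q _.
Arguments dom_dstar {R n} Omega q _.

(* Main.v *)
Require Import Defs.
From HB Require Import structures.
From mathcomp Require Import all_boot all_order all_algebra.
From mathcomp Require Import complex.
From mathcomp Require Import all_classical all_reals all_analysis measurable_realfun.
From mathcomp Require Import ring lra.

Set Implicit Arguments.
Unset Strict Implicit.
Unset Printing Implicit Defensive.
Import Order.TTheory GRing.Theory Num.Theory.
Import numFieldNormedType.Exports.
Local Open Scope classical_set_scope.
Local Open Scope ring_scope.

(** Let [N] be the gradient of a defining function [rho] and work on the open
   set [Omega = {rho < 0}].

   Reduction to scalars. Taking real and imaginary parts, and moving the symbol
   of [d] to the other side, [<d phi, psi>_1] becomes a sum over multi-indices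
   [I] of pairings [sum_k <D_k f, b_k>_1], where [f] is a coefficient of [phi]
   and [b] is the vector field with components [b_k = sum_J eps^J_(kI) psi_J]
   ([W1_inner_ext_d]). The [I]-th coefficient of the contraction in the statement
   is the boundary value of [c = sum_k N_k sum_j N_j D_j b_k], up to the factor
   [|N|^-2] ([contract_nabla_parts]). So the claim is about one function and one
   field: the pairing is bounded by [C |f|_1] if and only if [c] vanishes on the
   boundary.

   The pairing up to bounded terms. Its only second derivatives of [f] are in
   [sum_(j,k) D_j D_k f D_j b_k], which is, up to first order terms, the
   divergence of [F_j = sum_k D_k f D_j b_k]. On the boundary the normal
   component of [F] is [w . grad f] with [w_k = sum_j N_j D_j b_k]. Split [w] into
   its tangential part and its normal part, which is proportional to [c]. The
   tangential part is the normal component of a field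
   [G_l = sum_k A_(kl) D_k f] with [A] antisymmetric, and by the symmetry of
   second derivatives [div G] contains only first derivatives of [f]
   ([divergence_antisym]); no integration by parts on the boundary is needed. The
   normal part is that of [H = c s grad f], where [s] extends [|N|^-2]. As
   [F - G - H] is tangent to the boundary, its divergence integrates to [0]
   ([divergence_tangential]). Hence the pairing differs from the integral of
   [div (c s grad f)] by at most [C |f|_1] ([le_W1_pairing]).

   Conclusion. If [c = 0] on the boundary, then [c s grad f] is tangential too,
   and the pairing is bounded ([W1_pairing_bounded]). Conversely, for
   [f = rho / (1 - m rho) beta] the normal derivative of [f] on the boundary does
   not depend on [m], hence neither does the integral of [div (c s grad f)], while
   [|f|_1] tends to [0] as [m] grows ([W1_test_cvg]). So the integral of
   [div (c s beta N)] is [0] for every [beta] ([flux_independent]). If [c] did not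
   vanish at a boundary point [p], then for [beta = c zeta] with a bump [zeta]
   concentrated near [p] this divergence would be nonnegative and not identically
   zero ([normal_component_eq0]).

   Surface measure never enters. The divergence theorem for tangential fields
   follows from the vanishing of integrals of derivatives of compactly supported
   functions, applied to fields cut off near the boundary; the cutoffs are
   controlled by testing them on a multiple of [N] itself. The same cutoffs show
   that weak gradients may be replaced by classical ones
   ([weak_partial_unique]). *)

(** * The flat function exp(-1/t) *)

Section flat.
Variable R : realType.
Implicit Types (m : nat) (t x : R).

(** The family is closed under differentiation ([is_derive_flat]), so that
   cutoffs and bumps are smooth as soon as each member is continuous. *)
Definition flat m t : R := if 0 < t then t^-1 ^+ m * expR (- t^-1) else 0.

Lemma exprn_le_expR m x : 0 <= x -> x ^+ m <= m`!%:R * expR x.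
Proof.
case: m => [|m] x0; first by rewrite fact0 mul1r expr0 -expR0 ler_expR.
rewrite mulrC -ler_pdivrMr ?ltr0n ?fact_gt0//.
by apply: le_trans (expR_ge1Dxn m x0); rewrite lerDr.
Qed.

Lemma flat_ge0 m t : 0 <= flat m t.
Proof.
rewrite /flat; case: ifPn => // t0.
by rewrite mulr_ge0 ?expR_ge0// exprn_ge0// invr_ge0 ltW.
Qed.

Lemma flat_gt0 m t : 0 < t -> 0 < flat m t.
Proof. by move=> t0; rewrite /flat t0 mulr_gt0 ?expR_gt0// exprn_gt0 ?invr_gt0. Qed.

Lemma flat_le0 m t : t <= 0 -> flat m t = 0.
Proof. by move=> t0; rewrite /flat ltNge t0. Qed.

Lemma flat0_le1 t : flat 0 t <= 1.
Proof.
rewrite /flat; case: ifPn => // t0.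
by rewrite expr0 mul1r expR_le1 oppr_le0 invr_ge0 ltW.
Qed.

Lemma flatS m t : flat m t = t * flat m.+1 t.
Proof.
rewrite /flat; case: ifPn => [t0|]; last by rewrite mulr0.
by rewrite exprS !mulrA divff ?mul1r// gt_eqF.
Qed.

(** Exponential decay beats every power of [t^-1]. *)
Lemma flat_le_fact m t : flat m t <= m`!%:R.
Proof.
rewrite /flat; case: ifPn => // t0.
by rewrite expRN ler_pdivrMr ?expR_gt0// exprn_le_expR// invr_ge0 ltW.
Qed.

Lemma flat_le_sqr m t : `|flat m t| <= (m.+2)`!%:R * t ^+ 2.
Proof.
rewrite ger0_norm ?flat_ge0// flatS flatS mulrA -expr2 mulrC.
by rewrite ler_wpM2r ?sqr_ge0// flat_le_fact.
Qed.

Lemma is_derive_flat m t :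
  is_derive t 1 (flat m) (- m%:R * flat m.+1 t + flat m.+2 t).
Proof.
have [t0|t0|t0] := ltgtP t 0.
- rewrite !flat_le0 ?(ltW t0)// mulr0 addr0.
  apply: (@near_eq_is_derive _ _ _ (cst 0)).
  by near=> x; rewrite flat_le0//=; apply/ltW; near: x; exact: lt_nbhsl.
- apply: (@near_eq_is_derive _ _ _ (fun x => x^-1 ^+ m * expR (- x^-1))).
    near=> x; rewrite /flat ifT//; near: x; exact: lt_nbhsr.
  have tn0 : t != 0 by rewrite gt_eqF.
  have di : is_derive t 1 (fun x : R => x^-1) (- t ^- 2).
    have := is_derive_id t (1 : R) => -[d e].
    by apply: DeriveDef; [exact: derivableV|rewrite deriveV// e /GRing.scale/= mulr1].
  have de : is_derive t 1 (fun x : R => expR (- x^-1)) (expR (- t^-1) * (t ^- 2)).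
    have := @is_derive1_comp _ expR (fun x => - x^-1) t _ _
      (is_derive_expR _) (is_deriveN di).
    by rewrite opprK.
  have dx : is_derive t 1 (fun x : R => x^-1 ^+ m) ((m%:R * t^-1 ^+ m.-1) *: (- t ^- 2)).
    by have := is_deriveX m di; rewrite exprfctE.
  have H := is_deriveM dx de.
  apply: (is_derive_eq H) => {H}.
  rewrite /flat t0 /GRing.scale/= -exprVn.
  case: m {dx} => [|m]; first by rewrite expr0; ring.
  by rewrite /= !exprS; ring.
- rewrite t0 !flat_le0// mulr0 addr0.
  have lim : (fun h : R => h^-1 *: (flat m (h *: (1 : R) + 0) - flat m 0)) @ 0^' --> (0:R).
    apply/cvgr0Pnorm_le => e e0; near=> h.
    have h0 : h != 0 by near: h; exact: nbhs_dnbhs_neq.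
    rewrite addr0 [flat m 0]flat_le0// subr0 [h *: _]mulr1.
    rewrite normrM normfV ler_pdivrMl ?normr_gt0//.
    apply: le_trans (flat_le_sqr m h) _.
    rewrite -normr_id -real_normK ?num_real// expr2 mulrA.
    rewrite mulrC normr_id ler_wpM2l//.
    rewrite mulrC -ler_pdivlMr ?ltr0n ?fact_gt0//.
    near: h; apply: dnbhs0_le; by rewrite divr_gt0// ltr0n fact_gt0.
  apply: DeriveDef; first by apply/cvg_ex; exists 0.
  exact: cvg_lim lim.
Unshelve. all: by end_near. Qed.

Lemma flat_continuous m : continuous (flat m).
Proof.
move=> t; apply/differentiable_continuous/derivable1_diffP.
by have [] := is_derive_flat m t.
Qed.

End flat.

Section chain.
Variables (R : realType) (V : normedModType R).
Implicit Types (g : V -> R) (F : R -> R).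

Lemma is_derive_lineP g x v (dg : R) :
  is_derive x v g dg <-> is_derive (0 : R) (1 : R) (fun h : R => g (h *: v + x)) dg.
Proof.
have E : 'D_1 (fun h : R => g (h *: v + x)) 0 = 'D_v g x.
  rewrite /derive; set g1 := fun h => h^-1 *: _; set g2 := fun h => h^-1 *: _.
  suff -> : g1 = g2 by [].
  apply/funext => h; rewrite /g1 /g2 /=.
  by rewrite addr0 scale0r add0r [_%:A]mulr1.
split=> -[d e].
  apply: (@DeriveDef _ _ _ _ _ (fun h : R => g (h *: v + x))); last by rewrite E.
  exact: (derivable1P _ _ _).1 d.
apply: (@DeriveDef _ _ _ _ _ g); last by rewrite -E.
exact: (derivable1P _ _ _).2 d.
Qed.

Lemma is_derive_comp g F x v (dg dF : R) :
  is_derive x v g dg -> is_derive (g x) (1:R) F dF ->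
  is_derive x v (F \o g) (dF * dg).
Proof.
move=> /is_derive_lineP dg' dF'; apply/is_derive_lineP.
have H := @is_derive1_comp _ F (fun h => g (h *: v + x)) 0 dF dg.
by apply: H => //; rewrite scale0r add0r.
Qed.

End chain.

(** * Functions of class C^k up to the boundary *)

Lemma cvg_sumr (R : realType) (T : Type) (F : set_system T) (FF : Filter F)
    (I : Type) (r : seq I) (u : I -> T -> R) (l : I -> R) :
  (forall i, u i x @[x --> F] --> l i) ->
  \sum_(i <- r) u i x @[x --> F] --> \sum_(i <- r) l i.
Proof.
move=> ul; elim: r => [|i r IH].
  have -> : (fun x => \sum_(i <- [::]) u i x) = (fun=> 0 : R).
    by apply/funext => x; rewrite big_nil.
  by rewrite big_nil; exact: cvg_cst.
have -> : (fun x => \sum_(i <- i :: r) u i x) = (fun x => u i x + \sum_(i <- r) u i x).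
  by apply/funext => x; rewrite big_cons.
by rewrite big_cons; apply: cvgD; [exact: ul|exact: IH].
Qed.

Lemma partial_near0 (R : realType) (n : nat) (f : 'rV[R]_n -> R) j x :
  (\near x, f x = 0) -> partial j f x = 0.
Proof.
move=> f0; rewrite /partial -[RHS](derive_cst (0 : R) x (delta_mx 0 j)).
exact: near_eq_derive.
Qed.

Lemma closed_near_notin (T : topologicalType) (C : set T) x :
  closed C -> ~ C x -> \near x, ~ C x.
Proof. by move=> cC nC; apply: open_nbhs_nbhs; split => //; exact: closed_openC. Qed.

Lemma compact_near_notin (R : realType) (n : nat) (K : set 'rV[R]_n) x :
  compact K -> ~ K x -> \near x, ~ K x.
Proof.
move=> cK; apply: closed_near_notin; apply: compact_closed cK.
exact: norm_hausdorff.
Qed.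

Section ck.
Variables (R : realType) (n : nat).
Implicit Types (Omega K : set 'rV[R]_n) (f g : 'rV[R]_n -> R).
Implicit Types (x p : 'rV[R]_n) (j : 'I_n).

Local Notation e_ j := (delta_mx 0 j : 'rV[R]_n).

(** Only values in [Omega] count: the derivatives of a function that is smooth
   up to the boundary carry arbitrary values on the boundary itself. *)
Definition has_trace Omega f := forall p, closure Omega p ->
  cvg (f y @[y --> within Omega (nbhs p)]).

Definition cderivable Omega f := forall j x, Omega x -> derivable f x (e_ j).

(** Class [C^k] up to the boundary. The recursion on [k] lets closure under
   products, inverses and compositions go by induction, each derivative being
   an expression in functions of the same kind. *)
Fixpoint Ck Omega k f : Prop := has_trace Omega f /\
  if k is k'.+1 then
    cderivable Omega f /\ forall j, Ck Omega k' (partial j f)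
  else True.

Variable Omega : set 'rV[R]_n.
Hypothesis oO : open Omega.

Lemma within_closure_proper p : closure Omega p ->
  ProperFilter (within Omega (nbhs p)).
Proof. exact: within_nbhs_proper. Qed.

Lemma near_open x : Omega x -> \near x, Omega x.
Proof. by move=> Ox; apply: open_nbhs_nbhs; split. Qed.

Lemma within_near_eq p f g : (forall x, Omega x -> f x = g x) ->
  f y @[y --> within Omega (nbhs p)] = g y @[y --> within Omega (nbhs p)].
Proof.
move=> fg; rewrite eqEsubset; split; apply: near_eq_cvg;
  rewrite near_withinE; near=> y => Oy; by rewrite fg.
Unshelve. all: by end_near. Qed.

Lemma has_trace_eq f g : (forall x, Omega x -> f x = g x) ->
  has_trace Omega f -> has_trace Omega g.
Proof. by move=> fg tf p cp; rewrite -(within_near_eq p fg); exact: tf. Qed.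

Lemma within_open x : Omega x -> within Omega (nbhs x) = nbhs x.
Proof.
move=> Ox; rewrite eqEsubset; split; last first.
  by move=> A; apply: filterS.
move=> A; rewrite /within/= => nA; near=> y; apply: (near nA y) => //.
by near: y; exact: near_open.
Unshelve. all: by end_near. Qed.

Lemma has_trace_continuous f x :
  has_trace Omega f -> Omega x -> {for x, continuous f}.
Proof.
move=> tf Ox; have := tf x (subset_closure Ox).
rewrite within_open// => /cvg_ex[/= l fl].
suff lE : l = f x by rewrite /prop_for /continuous_at -lE.
apply/eqP; apply/negPn/negP => lfx.
have /cvgrPdist_lt /(_ `|l - f x|) := fl.
rewrite normr_gt0 subr_eq0 => /(_ lfx) /nbhs_singleton.
by rewrite ltxx.
Qed.

Lemma has_trace_cst (c : R) : has_trace Omega (fun=> c).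
Proof. by move=> p _; apply/cvg_ex; exists c; exact: cvg_cst. Qed.

Lemma has_traceD f g : has_trace Omega f -> has_trace Omega g ->
  has_trace Omega (fun x => f x + g x).
Proof. by move=> tf tg p cp; apply: is_cvgD; [exact: tf|exact: tg]. Qed.

Lemma has_traceM f g : has_trace Omega f -> has_trace Omega g ->
  has_trace Omega (fun x => f x * g x).
Proof. by move=> tf tg p cp; apply: is_cvgM; [exact: tf|exact: tg]. Qed.

Lemma has_trace_comp (F : R -> R) f : continuous F -> has_trace Omega f ->
  has_trace Omega (fun x => F (f x)).
Proof.
move=> cF tf p cp; have /cvg_ex[/= l fl] := tf p cp.
apply/cvg_ex; exists (F l); exact: cvg_comp fl (cF l).
Qed.

Lemma has_trace_within f p : has_trace Omega f -> closure Omega p ->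
  f y @[y --> within Omega (nbhs p)] --> trace Omega f p.
Proof. by move=> tf cp; exact: tf. Qed.

Lemma trace_lim f p l : closure Omega p ->
  f y @[y --> within Omega (nbhs p)] --> l -> trace Omega f p = l.
Proof.
move=> cp fl; have := within_closure_proper cp => ?.
exact: cvg_lim fl.
Qed.

Lemma trace_in f x : has_trace Omega f -> Omega x -> trace Omega f x = f x.
Proof.
move=> tf Ox; apply: trace_lim; first exact: subset_closure.
by rewrite within_open//; exact: has_trace_continuous.
Qed.

Lemma has_traceV f : has_trace Omega f ->
  (forall p, closure Omega p -> trace Omega f p != 0) ->
  has_trace Omega (fun x => (f x)^-1).
Proof.
move=> tf f0 p cp; apply/cvg_ex; exists (trace Omega f p)^-1.
by apply: cvgV; [exact: f0|exact: has_trace_within].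
Qed.

Lemma partial_eq f g j x : (forall y, Omega y -> f y = g y) -> Omega x ->
  partial j f x = partial j g x.
Proof.
move=> fg Ox; apply: near_eq_derive; near=> y; apply: fg; near: y.
exact: near_open.
Unshelve. all: by end_near. Qed.

Lemma cderivable_eq f g : (forall y, Omega y -> f y = g y) ->
  cderivable Omega f -> cderivable Omega g.
Proof.
move=> fg df j x Ox; apply: near_eq_derivable (df j x Ox).
by near=> y; apply: fg; near: y; exact: near_open.
Unshelve. all: by end_near. Qed.

Lemma CkS k f : Ck Omega k.+1 f -> Ck Omega k f.
Proof.
elim: k f => [|k IH] f; first by move=> [].
by move=> [tf [df Df]]; split => //; split => // j; exact/IH/Df.
Qed.

Lemma Ck_trace k f : Ck Omega k f -> has_trace Omega f.
Proof. by case: k => [[]|k []]. Qed.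

Lemma Ck_partial k f j : Ck Omega k.+1 f -> Ck Omega k (partial j f).
Proof. by move=> [_ [_ H]]; exact: H. Qed.

Lemma Ck_derivable k f : Ck Omega k.+1 f -> cderivable Omega f.
Proof. by move=> [_ []]. Qed.

Lemma Ck_is_derive k f j x : Ck Omega k.+1 f -> Omega x ->
  is_derive x (e_ j) f (partial j f x).
Proof. by move=> /Ck_derivable df Ox; apply: derivableP; exact: df. Qed.

Lemma Ck_continuous k f x : Ck Omega k f -> Omega x -> {for x, continuous f}.
Proof. by move=> /Ck_trace; exact: has_trace_continuous. Qed.

Lemma Ck_eq k f g : (forall x, Omega x -> f x = g x) ->
  Ck Omega k f -> Ck Omega k g.
Proof.
elim: k f g => [|k IH] f g fg; first by move=> [tf _]; split => //; exact: has_trace_eq tf.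
move=> [tf [df Df]]; split; first exact: has_trace_eq tf.
split; first exact: cderivable_eq df.
by move=> j; apply: (IH (partial j f)); [move=> x; exact: partial_eq|exact: Df].
Qed.

Lemma Ck_intro k f (Df : 'I_n -> 'rV[R]_n -> R) : has_trace Omega f ->
  (forall j x, Omega x -> is_derive x (e_ j) f (Df j x)) ->
  (forall j, Ck Omega k (Df j)) -> Ck Omega k.+1 f.
Proof.
move=> tf df cD; split => //; split; first by move=> j x /(df j) [].
by move=> j; apply: Ck_eq (cD j) => x /(df j)[_ <-].
Qed.

Lemma Ck_cst k (c : R) : Ck Omega k (fun=> c).
Proof.
elim: k c => [|k IH] c; first by split => //; exact: has_trace_cst.
apply: (Ck_intro (Df := fun=> fun=> 0)) => //; exact: has_trace_cst.
Qed.

Lemma CkD k f g : Ck Omega k f -> Ck Omega k g ->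
  Ck Omega k (fun x => f x + g x).
Proof.
elim: k f g => [|k IH] f g cf cg.
  by split => //; exact: has_traceD (Ck_trace cf) (Ck_trace cg).
apply: (Ck_intro (Df := fun j x => partial j f x + partial j g x)).
- exact: has_traceD (Ck_trace cf) (Ck_trace cg).
- by move=> j x Ox; exact: is_deriveD (Ck_is_derive j cf Ox) (Ck_is_derive j cg Ox).
- by move=> j; apply: IH; exact: Ck_partial.
Qed.

Lemma CkM k f g : Ck Omega k f -> Ck Omega k g ->
  Ck Omega k (fun x => f x * g x).
Proof.
elim: k f g => [|k IH] f g cf cg.
  by split => //; exact: has_traceM (Ck_trace cf) (Ck_trace cg).
apply: (Ck_intro (Df := fun j x => f x * partial j g x + g x * partial j f x)).
- exact: has_traceM (Ck_trace cf) (Ck_trace cg).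
- by move=> j x Ox; exact: is_deriveM (Ck_is_derive j cf Ox) (Ck_is_derive j cg Ox).
- by move=> j; apply: CkD; apply: IH; by [exact: Ck_partial|exact: CkS].
Qed.

Lemma CkN k f : Ck Omega k f -> Ck Omega k (fun x => - f x).
Proof.
move=> cf; apply: Ck_eq (CkM (Ck_cst k (-1)) cf) => x _ /=.
by rewrite mulN1r.
Qed.

Lemma CkB k f g : Ck Omega k f -> Ck Omega k g ->
  Ck Omega k (fun x => f x - g x).
Proof. by move=> cf cg; apply: CkD => //; exact: CkN. Qed.

Lemma Ck_sum (I : Type) (r : seq I) (P : pred I) k (F : I -> 'rV[R]_n -> R) :
  (forall i, P i -> Ck Omega k (F i)) ->
  Ck Omega k (fun x => \sum_(i <- r | P i) F i x).
Proof.
move=> cF; elim: r => [|i r IH].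
  by apply: Ck_eq (Ck_cst k 0) => x _; rewrite big_nil.
have [Pi|Pi] := boolP (P i).
  by apply: Ck_eq (CkD (cF i Pi) IH) => x _; rewrite big_cons Pi.
by apply: Ck_eq IH => x _; rewrite big_cons (negbTE Pi).
Qed.

Lemma CkX k f m : Ck Omega k f -> Ck Omega k (fun x => f x ^+ m).
Proof.
move=> cf; elim: m => [|m IH]; first exact: (Ck_cst k 1).
by apply: Ck_eq (CkM cf IH) => x _; rewrite exprS.
Qed.

Lemma CkV k f : Ck Omega k f ->
  (forall p, closure Omega p -> trace Omega f p != 0) ->
  Ck Omega k (fun x => (f x)^-1).
Proof.
move=> + f0; elim: k => [|k IH] cf.
  by split => //; exact: has_traceV (Ck_trace cf) f0.
apply: (Ck_intro (Df := fun j x => - ((f x)^-1 ^+ 2 * partial j f x))).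
- exact: has_traceV (Ck_trace cf) f0.
- move=> j x Ox; have fx0 : f x != 0.
    by rewrite -(trace_in (Ck_trace cf) Ox); apply: f0; exact: subset_closure.
  have df := Ck_derivable cf Ox.
  apply: DeriveDef; first exact: derivableV.
  by rewrite deriveV// exprVn /GRing.scale/= mulNr.
- move=> j; apply/CkN/CkM; last exact: Ck_partial.
  by apply/CkX/IH/CkS.
Qed.

Lemma Ck_flat k m f : Ck Omega k f -> Ck Omega k (fun x => flat m (f x)).
Proof.
elim: k m => [|k IH] m cf.
  by split => //; exact: has_trace_comp (@flat_continuous R m) (Ck_trace cf).
apply: (Ck_intro (Df := fun j x =>
   (- m%:R * flat m.+1 (f x) + flat m.+2 (f x)) * partial j f x)).
- exact: has_trace_comp (@flat_continuous R m) (Ck_trace cf).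
- move=> j x Ox; apply: (@is_derive_comp _ _ f (flat m)).
    exact: (Ck_is_derive j cf Ox).
  exact: is_derive_flat.
- move=> j; apply: CkM; last exact: Ck_partial.
  by apply: CkD; [apply: CkM; first exact: Ck_cst|]; apply/IH/CkS.
Qed.

Lemma partialD k f g j x : Ck Omega k.+1 f -> Ck Omega k.+1 g -> Omega x ->
  partial j (fun y => f y + g y) x = partial j f x + partial j g x.
Proof.
by move=> cf cg Ox; apply: deriveD; [exact: Ck_derivable cf _ _ Ox|exact: Ck_derivable cg _ _ Ox].
Qed.

Lemma partialM k f g j x : Ck Omega k.+1 f -> Ck Omega k.+1 g -> Omega x ->
  partial j (fun y => f y * g y) x = f x * partial j g x + g x * partial j f x.
Proof.
by move=> cf cg Ox; apply: deriveM; [exact: Ck_derivable cf _ _ Ox|exact: Ck_derivable cg _ _ Ox].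
Qed.

Lemma partial_sum (I : Type) (r : seq I) (P : pred I) k (F : I -> 'rV[R]_n -> R) j x :
  (forall i, P i -> Ck Omega k.+1 (F i)) -> Omega x ->
  partial j (fun y => \sum_(i <- r | P i) F i y) x =
  \sum_(i <- r | P i) partial j (F i) x.
Proof.
move=> cF Ox; elim: r => [|i r IH].
  rewrite big_nil (_ : (fun y => _) = cst 0); first exact: derive_cst.
  by apply/funext => y; rewrite big_nil.
have [Pi|Pi] := boolP (P i).
  rewrite big_cons Pi -IH -(partialD j (cF i Pi) (Ck_sum _ cF) Ox).
  by apply: partial_eq => // y _; rewrite big_cons Pi.
rewrite big_cons (negbTE Pi) -IH.
by apply: partial_eq => // y _; rewrite big_cons (negbTE Pi).
Qed.

Lemma partialZ k (c : R) f j x : Ck Omega k.+1 f -> Omega x ->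
  partial j (fun y => c * f y) x = c * partial j f x.
Proof.
move=> cf Ox; rewrite (partialM _ (Ck_cst k.+1 c) cf Ox).
by rewrite /partial derive_cst mulr0 addr0.
Qed.

Lemma partialB k f g j x : Ck Omega k.+1 f -> Ck Omega k.+1 g -> Omega x ->
  partial j (fun y => f y - g y) x = partial j f x - partial j g x.
Proof.
by move=> cf cg Ox; apply: deriveB; [exact: Ck_derivable cf _ _ Ox|exact: Ck_derivable cg _ _ Ox].
Qed.

Lemma partial_flat k m f j x : Ck Omega k.+1 f -> Omega x ->
  partial j (fun y => flat m (f y)) x =
  (- m%:R * flat m.+1 (f x) + flat m.+2 (f x)) * partial j f x.
Proof.
move=> cf Ox; have [_] // : is_derive x (e_ j) (fun y => flat m (f y))
  ((- m%:R * flat m.+1 (f x) + flat m.+2 (f x)) * partial j f x).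
apply: (@is_derive_comp _ _ f (flat m)); first exact: (Ck_is_derive j cf Ox).
exact: is_derive_flat.
Qed.

Lemma smooth_closure_Ck f k : smooth_closure Omega f -> Ck Omega k f.
Proof.
move=> [df tf _].
suff H s : Ck Omega k (iter_partial s f) by exact: (H [::]).
elim: k s => [|k IH] s; first by split => // p; exact: tf.
split; first by move=> p; exact: tf.
split; first by move=> j x; exact: df.
by move=> j; exact: (IH (j :: s)).
Qed.

Lemma Ck_iter_partial f s : (forall k, Ck Omega k f) ->
  forall k, Ck Omega k (iter_partial s f).
Proof.
by move=> cf; elim: s => [//|j s IH] k; exact: Ck_partial (IH k.+1).
Qed.

(** Smoothness on the closure also constrains the values on the boundary,
   where a function computed from derivatives is meaningless; its limits are
   the right values. *)
Lemma trace_smooth_closure f : (forall k, Ck Omega k f) ->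
  smooth_closure Omega (trace Omega f).
Proof.
move=> cf; have cT k : Ck Omega k (trace Omega f).
  by apply: Ck_eq (cf k) => x Ox; rewrite trace_in//; exact: Ck_trace (cf 0%N).
split.
- move=> s x j Ox; have H := Ck_derivable (Ck_iter_partial s cT 1%N).
  exact: (H j x Ox).
- by move=> s; exact: Ck_trace (Ck_iter_partial s cT 0%N).
- move=> p cp; rewrite -(@within_near_eq p f).
    by apply: has_trace_within cp; exact: Ck_trace (cf 0%N).
  by move=> x Ox; rewrite trace_in//; exact: Ck_trace (cf 0%N).
Qed.

End ck.

Section zero_extension.
Variables (R : realType) (n : nat).
Implicit Types (Omega C : set 'rV[R]_n) (f g : 'rV[R]_n -> R).

Lemma smooth_Ck f k : smooth f -> Ck setT k f.
Proof.
move=> sf.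
suff H s : Ck setT k (iter_partial s f) by exact: (H [::]).
have tr (s' : seq 'I_n) p : closure [set: 'rV[R]_n] p ->
    cvg (iter_partial s' f y @[y --> within setT (nbhs p)]).
  move=> _; rewrite within_open//; last exact: openT.
  by apply/cvg_ex; eexists; exact: (sf s').1.
elim: k s => [|k IH] s; first by split => // p; exact: tr.
split; first by move=> p; exact: tr.
split; first by move=> j x _; exact: (sf s).2.
by move=> j; exact: (IH (j :: s)).
Qed.

Lemma Ck_smooth f : (forall k, Ck setT k f) -> smooth f.
Proof.
move=> cf s; have H k := Ck_iter_partial s cf k; split.
  by move=> x; apply: Ck_continuous (H 0%N) _ => //; exact: openT.
by move=> x j; have D := Ck_derivable (H 1%N); exact: (D j x I).
Qed.

Lemma Ck_subset Omega k f : Ck setT k f -> Ck Omega k f.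
Proof.
elim: k f => [|k IH] f.
  move=> cf; split => // p _; apply/cvg_ex; exists (f p).
  apply: cvg_within_filter; exact: (Ck_continuous openT cf I).
move=> [tf [df Df]]; split.
  move=> p _; apply/cvg_ex; exists (f p).
  apply: cvg_within_filter; exact: (has_trace_continuous openT tf I).
by split=> [j x _|j]; [exact: df|exact/IH/Df].
Qed.

(** Off [C] the function is locally zero, so the complement of [Omega] costs
   no regularity. *)
Lemma Ck_zero_ext Omega C k f : open Omega -> closed C -> C `<=` Omega ->
  (forall x, ~ C x -> f x = 0) -> Ck Omega k f -> Ck setT k f.
Proof.
move=> oO cC CO; have nearC x : ~ Omega x -> \near x, ~ C x.
  by move=> Ox; apply: closed_near_notin => // /CO.
elim: k f => [|k IH] f f0 cf.
  split => // p _; rewrite within_open//; last exact: openT.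
  apply/cvg_ex; have [Op|Op] := pselect (Omega p).
    by exists (f p); exact: Ck_continuous cf Op.
  exists 0; apply: (@cvg_trans _ ((fun=> (0 : R)) @ nbhs p)); last exact: cvg_cst.
  by apply: near_eq_cvg; near=> x; rewrite f0//; near: x; exact: nearC.
have der j x : is_derive x (delta_mx 0 j) f (partial j f x).
  have [Ox|Ox] := pselect (Omega x).
    exact: (Ck_is_derive j cf Ox).
  apply: derivableP; apply: (@near_eq_derivable _ _ _ (cst 0)) => //.
  by near=> y; rewrite f0//; near: y; exact: nearC.
split.
  by apply: Ck_trace (IH f f0 (CkS cf)).
split; first by move=> j x _; have [] := der j x.
move=> j; apply: IH; last exact: Ck_partial.
move=> x Cx; apply: partial_near0.
by apply: filterS (closed_near_notin cC Cx) => y; exact: f0.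
Unshelve. all: by end_near. Qed.

End zero_extension.

(** * Symmetry of second derivatives *)

Section lines.
Variables (R : realType) (V : normedModType R).
Implicit Types (g dg : V -> R) (x v : V).

Lemma is_derive_along g x v (s d : R) : is_derive (s *: v + x) v g d ->
  is_derive s (1 : R) (fun t : R => g (t *: v + x)) d.
Proof.
move=> /is_derive_lineP D.
have ds : is_derive s (1 : R) (fun t : R => t - s) 1.
  have H := is_deriveB (is_derive_id s (1:R)) (is_derive_cst s s (1:R)).
  by apply: (is_derive_eq H); rewrite subr0.
have H := @is_derive1_comp _ (fun h => g (h *: v + (s *: v + x))) (fun t => t - s) s d 1.
have E : (fun h => g (h *: v + (s *: v + x))) \o (fun t => t - s) =
  (fun t : R => g (t *: v + x)).
  by apply/funext => t /=; rewrite addrA -scalerDl subrK.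
rewrite E mulr1 in H; apply: H => //.
by rewrite subrr.
Qed.

Lemma MVT_line g dg x v (h : R) : 0 < h ->
  (forall s : R, 0 <= s <= h -> is_derive (s *: v + x) v g (dg (s *: v + x))) ->
  exists2 s : R, 0 <= s <= h & g (h *: v + x) - g x = h * dg (s *: v + x).
Proof.
move=> h0 D.
have D' s : 0 <= s <= h -> is_derive s (1 : R) (fun t : R => g (t *: v + x)) (dg (s *: v + x)).
  by move=> sh; apply: is_derive_along; exact: D.
have [||c] := @MVT _ (fun t : R => g (t *: v + x)) (fun s => dg (s *: v + x)) 0 h h0.
- by move=> s; rewrite in_itv/= => /andP[s0 sh]; apply: D'; rewrite !ltW.
- apply: derivable_within_continuous => s; rewrite in_itv/= => sh.
  by have [] := D' s sh.
rewrite in_itv/= subr0 scale0r add0r => /andP[c0 ch] ->.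
by exists c; rewrite ?ltW// mulrC.
Qed.

End lines.

Section schwarz.
Variables (R : realType) (n : nat) (Omega : set 'rV[R]_n).
Hypothesis oO : open Omega.
Implicit Types (f : 'rV[R]_n -> R) (j k : 'I_n).

Local Notation e_ j := (delta_mx 0 j : 'rV[R]_n).

(** Two applications of the mean value theorem; the left-hand side is
   symmetric in [j] and [k], the right-hand side is a mixed derivative at a
   point close to [x]. *)
Lemma second_difference f j k x (h : R) : Ck Omega 2 f -> 0 < h ->
  (forall s t : R, 0 <= s <= h -> 0 <= t <= h -> Omega (t *: e_ k + (s *: e_ j + x))) ->
  exists s t : R, [/\ 0 <= s <= h, 0 <= t <= h &
  f (h *: e_ k + (h *: e_ j + x)) - f (h *: e_ j + x) - (f (h *: e_ k + x) - f x)
  = h * (h * partial k (partial j f) (t *: e_ k + (s *: e_ j + x)))].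
Proof.
move=> cf h0 HO.
have D s t : 0 <= s <= h -> 0 <= t <= h ->
    is_derive (t *: e_ k + (s *: e_ j + x)) (e_ j) f
      (partial j f (t *: e_ k + (s *: e_ j + x))).
  by move=> sh th; apply: (Ck_is_derive j cf); exact: HO.
have M1 s : 0 <= s <= h -> is_derive (s *: e_ j + x) (e_ j)
    (fun y => f (h *: e_ k + y) - f y)
    (partial j f (h *: e_ k + (s *: e_ j + x)) - partial j f (s *: e_ j + x)).
  move=> sh.
  have hh : 0 <= h <= h by rewrite lexx ltW.
  have h00 : (0 : R) <= 0 <= h by rewrite lexx ltW.
  have := D s 0 sh h00; rewrite scale0r add0r => H0.
  have /is_derive_lineP H := D s h sh hh.
  have E : (fun t : R => f (h *: e_ k + (t *: e_ j + (s *: e_ j + x)))) =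
    (fun t : R => f (t *: e_ j + (h *: e_ k + (s *: e_ j + x)))).
    by apply/funext => t; congr f; rewrite addrCA.
  rewrite -E in H.
  have {}H := (is_derive_lineP (fun y => f (h *: e_ k + y)) _ _ _).2 H.
  exact: (is_deriveB H H0).
have [s sh sE] := MVT_line (g := fun y => f (h *: e_ k + y) - f y)
  (dg := fun y => partial j f (h *: e_ k + y) - partial j f y) h0 M1.
have M2 t : 0 <= t <= h -> is_derive (t *: e_ k + (s *: e_ j + x)) (e_ k)
    (partial j f) (partial k (partial j f) (t *: e_ k + (s *: e_ j + x))).
  by move=> th; apply: (Ck_is_derive k (Ck_partial j cf)); exact: HO.
have [t th tE] := MVT_line (g := partial j f) (dg := partial k (partial j f)) h0 M2.
exists s, t; split => //.
by rewrite sE tE.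
Qed.

Let aux (a b c d h A B : R) : h != 0 -> a - b - (c - d) = h * (h * A) ->
  a - c - (b - d) = h * (h * B) -> A = B.
Proof.
move=> h0 EA EB; apply: (mulfI h0); apply: (mulfI h0).
by rewrite -EA -EB; ring.
Qed.

Let aux2 (a b c e : R) : `|a - c| <= e / 2 -> `|b - c| <= e / 2 -> `|a - b| <= e.
Proof. by rewrite !ler_norml => /andP[? ?] /andP[? ?]; apply/andP; split; lra. Qed.

(** Divide the second difference by [h ^ 2] for a small [h]: both mixed
   derivatives are its limit. *)
Lemma partialC f j k x : Ck Omega 2 f -> Omega x ->
  partial k (partial j f) x = partial j (partial k f) x.
Proof.
move=> cf Ox.
have c1 := Ck_continuous oO (Ck_partial k (Ck_partial j cf)) Ox.
have c2 := Ck_continuous oO (Ck_partial j (Ck_partial k cf)) Ox.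
apply/eqP; rewrite -subr_eq0 -normr_le0; apply/ler_addgt0Pl => e e0.
rewrite addr0.
have e20 : 0 < e / 2 by rewrite divr_gt0.
have [r /= r0 rb] : exists2 r : R, 0 < r & forall y, ball x r y -> [/\ Omega y,
   `|partial k (partial j f) x - partial k (partial j f) y| <= e / 2 &
   `|partial j (partial k f) x - partial j (partial k f) y| <= e / 2].
  move/cvgrPdist_le : (c1) => /(_ _ e20) n1.
  move/cvgrPdist_le : (c2) => /(_ _ e20) n2.
  have n3 := near_open oO Ox.
  have /nbhs_ballP[r /= r0 rb] : nbhs x [set y | Omega y /\ (
   `|partial k (partial j f) x - partial k (partial j f) y| <= e / 2 /\
   `|partial j (partial k f) x - partial j (partial k f) y| <= e / 2)].
    exact: filterI n3 (filterI n1 n2).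
  by exists r => // y /rb[? []].
pose h := r / 4.
have h0 : 0 < h by rewrite divr_gt0.
have near_x s t a b : 0 <= s <= h -> 0 <= t <= h ->
    ball x r (t *: e_ a + (s *: e_ b + x)).
  move=> /andP[s0 sh] /andP[t0 th]; split => // i l.
  rewrite -ball_normE/= !mxE !mulr_natr.
  have -> (u v w : R) : u - (v + (w + u)) = - (v + w) by lra.
  rewrite normrN ger0_norm ?addr_ge0 ?mulrn_wge0//.
  have A (u : R) (c : bool) : 0 <= u <= h -> u *+ c <= h.
    by case: c => /andP[u0 uh]; rewrite ?mulr1n ?mulr0n// ltW.
  have := A t ((i == 0) && (l == a)); have := A s ((i == 0) && (l == b)).
  rewrite s0 sh t0 th /h => /(_ isT) H1 /(_ isT) H2.
  lra.
have HO a b s t : 0 <= s <= h -> 0 <= t <= h -> Omega (t *: e_ a + (s *: e_ b + x)).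
  by move=> sh th; have [] := rb _ (near_x s t a b sh th).
have [s [t [sh th E1]]] := second_difference cf h0 (HO k j).
have [s' [t' [sh' th' E2]]] := second_difference cf h0 (HO j k).
have E : partial k (partial j f) (t *: e_ k + (s *: e_ j + x)) =
         partial j (partial k f) (t' *: e_ j + (s' *: e_ k + x)).
  have hn0 : h != 0 by rewrite gt_eqF.
  have Exy : h *: e_ j + (h *: e_ k + x) = h *: e_ k + (h *: e_ j + x).
    by rewrite addrCA.
  rewrite Exy in E2.
  exact: (aux hn0 E1 E2).
have [_ B1 _] := rb _ (near_x s t k j sh th).
have [_ _ B2] := rb _ (near_x s' t' j k sh' th').
rewrite E in B1.
exact: aux2 B1 B2.
Qed.

End schwarz.

(** * Lebesgue measure of boxes and of open sets *)

Section lebesgue_rV.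
Variable R : realType.
Local Notation M := (measurableTypeR R).
Local Notation mu n := (lebesgue_tuple R n).
Local Notation row := (@row_of_tuple R _).

(** The balls of row vectors, for the sup norm, seen on tuples, where the
   product measure lives. *)
Definition tuple_box n (c : 'I_n -> R) (r : R) : set (n.-tuple M) :=
  [set t | forall i, (tnth t i : R) \in `](c i - r), (c i + r)[ ].

Lemma measurable_tuple_box n (c : 'I_n -> R) r : measurable (tuple_box c r).
Proof.
have -> : tuple_box c r = \bigcap_(i in [set: 'I_n])
    (fun t => tnth t i) @^-1` [set` `](c i - r), (c i + r)[ ].
  by apply/seteqP; split=> [t H i _|t H i]; [exact: H|exact: (H i I)].
apply: fin_bigcap_measurable => // i _.
rewrite -[X in measurable X]setTI; apply: measurable_tnth => //.
Qed.

Lemma lebesgue_tuple_box n (c : 'I_n -> R) (r : R) : 0 < r ->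
  mu n (tuple_box c r) = ((2 * r) ^+ n)%:E.
Proof.
move=> r0; elim: n c => [|n IH] c.
  rewrite expr0 /= diracE mem_set//= => i; by case: i.
rewrite /= /lebesgue_step /pushforward.
have -> : @tcons R n @^-1` (tuple_box c r) =
    [set` `](c ord0 - r), (c ord0 + r)[ ] `*` tuple_box (fun i => c (lift ord0 i)) r.
  apply/seteqP; split=> [[x t] /= H|[x t] /= [Hx Ht] i].
    split; first by have := H ord0; rewrite (tnth_nth 0).
    by move=> i; have := H (lift ord0 i); rewrite tnthS.
  have [j ->|->] := unliftP ord0 i; last by rewrite (tnth_nth 0).
  by rewrite tnthS; exact: Ht.
rewrite product_measure1E//; last exact: measurable_tuple_box.
rewrite [X in (_ * X)%E]IH [X in (X * _)%E](_ : _ = (2 * r)%:E).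
  by rewrite -EFinM exprS.
apply: (etrans (lebesgue_measure_itv `](c ord0 - r), (c ord0 + r)[)).
rewrite /= lte_fin ifT; last by lra.
by rewrite -EFinB; congr (_%:E); ring.
Qed.

Lemma preimage_ball n (c : 'rV[R]_n) r : 0 < r ->
  row @^-1` (ball c r) = tuple_box (fun i => c 0 i) r.
Proof.
move=> r0; apply/seteqP; split=> [t|t].
  move=> [_ H] i; have := H 0 i; rewrite -ball_normE/= mxE ltr_distlC.
  by rewrite in_itv/= => /andP[? ?]; apply/andP; split; lra.
move=> H; split => // i j; rewrite !ord1 mxE -ball_normE/=; have := H j.
by rewrite in_itv/= ltr_distlC => /andP[? ?]; apply/andP; split; lra.
Qed.

Lemma measurable_ball n (c : 'rV[R]_n) r : measurable (row @^-1` (ball c r)).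
Proof.
have [r0|r0] := ltP 0 r.
  by rewrite preimage_ball//; exact: measurable_tuple_box.
rewrite (_ : ball c r = set0) ?preimage_set0//.
by rewrite -subset0 => x [] /lt_le_trans /(_ r0); rewrite ltxx.
Qed.

(** The topology of row vectors has a countable base of balls with rational
   centers. *)
Lemma measurable_open n (U : set 'rV[R]_n) : open U -> measurable (row @^-1` U).
Proof.
move=> oU.
pose B (qk : 'rV[rat]_n * nat) : set 'rV[R]_n :=
  ball (map_mx (@ratr R) qk.1 : 'rV[R]_n) (qk.2.+1%:R^-1).
have -> : U = \bigcup_(qk in [set qk | B qk `<=` U]) B qk.
  apply/seteqP; split=> [x Ux|x [qk /= H] /H//].
  have /nbhs_ballP[e /= e0 eU] : nbhs x U by exact: open_nbhs_nbhs.
  have [k ke] : exists k : nat, (k.+1%:R^-1 : R) < e / 2.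
    have e20 : 0 < e / 2 by rewrite divr_gt0.
    have [k _ /(_ _ (leqnn _)) kE] := near_infty_natSinv_lt (PosNum e20).
    by exists k; exact: kE.
  have q_ i : {q : rat | ratr q \in `](x 0 i - k.+1%:R^-1), (x 0 i + k.+1%:R^-1)[ }.
    apply/cid/rat_in_itvoo; rewrite ltrBlDr -addrA ltrDl.
    by rewrite addr_gt0 ?invr_gt0.
  exists (\row_i sval (q_ i), k).
    move=> y [_ By]; apply: eU; split=> // i j.
    have := By i j; have := svalP (q_ j); rewrite !ord1 -!ball_normE/= !mxE.
    move: ke; rewrite in_itv/= !ltr_distlC; move: (k.+1%:R^-1) (ratr _) => d q ?.
    by move=> /andP[? ?] /andP[? ?]; apply/andP; split; lra.
  split; first by rewrite invr_gt0.
  move=> i j; have := svalP (q_ j); rewrite !ord1 -!ball_normE/= !mxE.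
  rewrite in_itv/= !ltr_distlC; move: (k.+1%:R^-1) (ratr _) => d q.
  by move=> /andP[? ?]; apply/andP; split; lra.
rewrite preimage_bigcup bigcup_mkcond.
apply: countable_bigcupT_measurable; first exact: countableP.
by move=> qk; case: ifPn => // _; exact: measurable_ball.
Qed.

End lebesgue_rV.

(** * Integrals of compactly supported functions *)

Section integration.
Variables (R : realType) (n : nat).
Local Notation M := (measurableTypeR R).
Local Notation mu := (lebesgue_tuple R n).
Local Notation row := (@row_of_tuple R n).
Implicit Types (Omega K : set 'rV[R]_n) (f g h : 'rV[R]_n -> R).

Definition measurable_rV Omega f : Prop :=
  measurable_fun (row @^-1` Omega) (f \o row).

Definition integrable_rV Omega f : Prop :=
  mu.-integrable (row @^-1` Omega) (EFin \o (f \o row)).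

Definition supported Omega K f : Prop :=
  forall x, Omega x -> ~ K x -> f x = 0.

(** The integrands: of class [C^k] up to the boundary and compactly supported
   in the closure. *)
Definition Ckc Omega k f : Prop :=
  Ck Omega k f /\ exists2 K, compact K & supported Omega K f.

(** A bound that holds near each point of a compact set, and stays valid when
   it is enlarged, holds uniformly. *)
Lemma compact_threshold K (P : R -> 'rV[R]_n -> Prop) : compact K ->
  (forall p, K p -> exists B0 : R, \forall x \near p, forall B, B0 <= B -> P B x) ->
  exists B : R, forall x, K x -> P B x.
Proof.
move=> /compact_near_coveringP cK HP.
have H : \forall B \near +oo, K `<=` P B.
  apply: (cK R (pinfty_nbhs R) P) => p /HP[B0 HB].
  exists ([set x | forall B, B0 <= B -> P B x], [set B | B0 <= B]).
    by split => //; exact: nbhs_pinfty_ge (num_real B0).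
  by move=> [x B] /= [Hx HB0]; exact: Hx.
by have [B HB] := filter_ex H; exists B => x; exact: HB.
Qed.

Lemma compact_ball K : compact K -> exists2 r : R, 0 < r & K `<=` ball 0 r.
Proof.
move=> /compact_bounded[A [Ar HA]].
exists (`|A| + 2); first by rewrite ltr_pwDr.
move=> x Kx; rewrite -ball_normE/= sub0r normrN.
apply: (@le_lt_trans _ _ (`|A| + 1)); last by rewrite ltrD2l ltr1n.
by apply: HA => //; apply: le_lt_trans (ler_norm _) _; rewrite ltrDl.
Qed.

Variable Omega : set 'rV[R]_n.
Hypothesis oO : open Omega.

Let mO : measurable (row @^-1` Omega).
Proof. exact: measurable_open. Qed.

Lemma integral_rV_eq f g : (forall x, Omega x -> f x = g x) ->
  integral_rV Omega f = integral_rV Omega g.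
Proof. by move=> fg; apply: eq_Rintegral => t; rewrite inE => /fg. Qed.

Lemma integrable_rV_eq f g : (forall x, Omega x -> f x = g x) ->
  integrable_rV Omega f -> integrable_rV Omega g.
Proof.
by move=> fg; apply: eq_integrable => // t; rewrite inE /= => /fg ->.
Qed.

Lemma integral_rVD f g : integrable_rV Omega f -> integrable_rV Omega g ->
  integral_rV Omega (fun x => f x + g x) = integral_rV Omega f + integral_rV Omega g.
Proof. by move=> If Ig; exact: (RintegralD mO If Ig). Qed.

Lemma integral_rVB f g : integrable_rV Omega f -> integrable_rV Omega g ->
  integral_rV Omega (fun x => f x - g x) = integral_rV Omega f - integral_rV Omega g.
Proof. by move=> If Ig; exact: (RintegralB mO If Ig). Qed.

Lemma integral_rVZ (c : R) f : integrable_rV Omega f ->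
  integral_rV Omega (fun x => c * f x) = c * integral_rV Omega f.
Proof. by move=> If; exact: (RintegralZl c mO If). Qed.

Lemma integral_rV0 : integral_rV Omega (fun=> 0) = 0.
Proof. by rewrite /integral_rV Rintegral_cst// mul0r. Qed.

Lemma integrable_rVD f g : integrable_rV Omega f -> integrable_rV Omega g ->
  integrable_rV Omega (fun x => f x + g x).
Proof.
move=> If Ig; apply: eq_integrable (integrableD mO If Ig) => //.
Qed.

Lemma integrable_rV_sum (I : Type) (r : seq I) (F : I -> 'rV[R]_n -> R) :
  (forall i, integrable_rV Omega (F i)) ->
  integrable_rV Omega (fun x => \sum_(i <- r) F i x).
Proof.
move=> IF; elim: r => [|i r IH].
  apply: (@integrable_rV_eq (fun=> 0)); first by move=> x _; rewrite big_nil.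
  exact: integrable0.
by apply: integrable_rV_eq (integrable_rVD (IF i) IH) => x _; rewrite big_cons.
Qed.

Lemma integral_rV_sum (I : Type) (r : seq I) (F : I -> 'rV[R]_n -> R) :
  (forall i, integrable_rV Omega (F i)) ->
  integral_rV Omega (fun x => \sum_(i <- r) F i x) =
  \sum_(i <- r) integral_rV Omega (F i).
Proof.
move=> IF; elim: r => [|i r IH].
  by rewrite big_nil -[RHS]integral_rV0; apply: integral_rV_eq => x _; rewrite big_nil.
rewrite big_cons -IH -integral_rVD//; last exact: integrable_rV_sum.
by apply: integral_rV_eq => x _; rewrite big_cons.
Qed.

Lemma integral_rV_ge0 f : (forall x, Omega x -> 0 <= f x) -> 0 <= integral_rV Omega f.
Proof. by move=> f0; apply: Rintegral_ge0 => t; exact: f0. Qed.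

Lemma le_integral_rV f g : integrable_rV Omega f -> integrable_rV Omega g ->
  (forall x, Omega x -> f x <= g x) -> integral_rV Omega f <= integral_rV Omega g.
Proof. by move=> If Ig fg; apply: (le_Rintegral mO If Ig) => t; exact: fg. Qed.

Lemma le_norm_integral_rV f g : integrable_rV Omega f -> integrable_rV Omega g ->
  (forall x, Omega x -> `|f x| <= g x) -> `|integral_rV Omega f| <= integral_rV Omega g.
Proof.
move=> If Ig fg; apply: le_trans (le_normr_Rintegral mO If) _.
apply: (le_Rintegral mO) => //; last by move=> t; exact: fg.
by have := integrable_abse If; apply: eq_integrable.
Qed.

Lemma le_integrable_rV f g : measurable_rV Omega f -> integrable_rV Omega g ->
  (forall x, Omega x -> `|f x| <= g x) -> integrable_rV Omega f.
Proof.
move=> mf Ig fg; apply: (le_integrable mO _ _ Ig).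
  exact/measurable_EFinP.
move=> t Ot /=; rewrite lee_fin; apply: le_trans (fg _ Ot) _; exact: ler_norm.
Qed.

Lemma dominated_cvg_rV (f_ : nat -> 'rV[R]_n -> R) f g :
  (forall m, measurable_rV Omega (f_ m)) -> measurable_rV Omega f ->
  integrable_rV Omega g ->
  (forall m x, Omega x -> `|f_ m x| <= g x) ->
  (forall x, Omega x -> f_ m x @[m --> \oo] --> f x) ->
  integral_rV Omega (f_ m) @[m --> \oo] --> integral_rV Omega f.
Proof.
move=> mf_ mf Ig fg cf.
pose e_ m t := (f_ m (row t))%:E; pose e t := (f (row t))%:E.
have me_ m : measurable_fun (row @^-1` Omega) (e_ m).
  exact: (measurable_EFinP _ _).2 (mf_ m).
have me : measurable_fun (row @^-1` Omega) e by exact: (measurable_EFinP _ _).2 mf.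
have ce : {ae mu, forall t, (row @^-1` Omega) t -> e_ m t @[m --> \oo] --> e t}.
  by apply: aeW => t Ot; apply: cvg_EFin; [exact: nearW|exact: cf].
have le : {ae mu, forall t m, (row @^-1` Omega) t -> (`|e_ m t| <= (EFin \o (g \o row)) t)%E}.
  by apply: aeW => t m Ot /=; rewrite lee_fin; exact: fg.
have [If _ C] := dominated_convergence mO me_ me ce Ig le.
by apply: fine_cvg; rewrite fineK//; exact: integrable_fin_num If.
Qed.

Lemma continuous_measurable f : (forall x, Omega x -> {for x, continuous f}) ->
  measurable_rV Omega f.
Proof.
move=> cf _; apply: (measurability _ (RGenOpens.measurableE R)) => //.
move=> _ [_ [a [b ->] <-]].
rewrite [X in measurable X](_ : _ = row @^-1` (Omega `&` f @^-1` `]a, b[)); last first.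
  by rewrite preimage_setI.
apply: measurable_open; rewrite openE => x [Ox fx].
apply: filterI; first exact: near_open.
by apply: (cf _ Ox); apply: open_nbhs_nbhs; split => //; exact: interval_open.
Qed.

Lemma Ck_measurable k f : Ck Omega k f -> measurable_rV Omega f.
Proof. by move=> cf; apply: continuous_measurable => x; exact: Ck_continuous cf. Qed.

Lemma trace_bounded f K : has_trace Omega f -> compact K ->
  exists B : R, forall x, Omega x -> K x -> `|f x| <= B.
Proof.
move=> tf cK.
have [|B HB] := @compact_threshold K (fun B x => Omega x -> `|f x| <= B) cK.
  move=> p Kp; have [cp|ncp] := pselect (closure Omega p).
    exists (`|trace Omega f p| + 1).
    have /cvgrPdist_le/(_ 1 ltr01) := has_trace_within tf cp.
    rewrite near_withinE; apply: filterS => x fx B B0 Ox.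
    apply: le_trans B0; rewrite -lerBlDl; apply: le_trans (fx Ox).
    by rewrite distrC; exact: lerB_dist.
  exists 0; have := closed_near_notin (@closed_closure _ Omega) ncp.
  by apply: filterS => x nx B _ Ox; exfalso; apply: nx; exact: subset_closure.
by exists B => x Ox Kx; exact: HB.
Qed.

Lemma Ckc_bounded k f : Ckc Omega k f ->
  exists2 B : R, 0 <= B & forall x, Omega x -> `|f x| <= B.
Proof.
move=> [cf [K cK Kf]]; have [B HB] := trace_bounded (Ck_trace cf) cK.
exists (Num.max B 0); first by rewrite le_max lexx orbT.
move=> x Ox; have [Kx|Kx] := pselect (K x); first by rewrite le_max HB.
by rewrite Kf// normr0 le_max lexx orbT.
Qed.

(** The function is bounded and lives in a ball, which has finite measure. *)
Lemma Ckc_integrable k f : Ckc Omega k f -> integrable_rV Omega f.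
Proof.
move=> af; have [B B0 fB] := Ckc_bounded af.
have [cf [K cK Kf]] := af.
have [r r0 Kr] := compact_ball cK.
have mB : measurable (row @^-1` (ball 0 r)) by exact: measurable_ball.
have If : mu.-integrable (row @^-1` Omega `&` row @^-1` (ball 0 r)) (EFin \o (f \o row)).
  apply: measurable_bounded_integrable.
  - exact: measurableI.
  - apply: (@le_lt_trans _ _ (mu (row @^-1` (ball 0 r)))).
      apply: le_measure; rewrite ?inE//; exact: measurableI.
    by rewrite preimage_ball// lebesgue_tuple_box// ltry.
  - apply: (@measurable_funS _ _ _ _ (row @^-1` Omega)) => //.
    exact: Ck_measurable cf.
  - exists B; split; first exact: num_real.
    by move=> C BC t /= [Ot _]; apply: le_trans (ltW BC); exact: fB.
have := (@integrable_restrict _ _ _ mu _ mB _ mO _).1 If.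
apply: eq_integrable => // t; rewrite inE => Ot /=.
rewrite patchE; case: ifPn => // /negP; rewrite inE => nb.
by rewrite Kf// => /Kr.
Qed.

Lemma Ckc_eq k f g : (forall x, Omega x -> f x = g x) -> Ckc Omega k f -> Ckc Omega k g.
Proof.
move=> fg [cf [K cK Kf]]; split; first exact: Ck_eq cf.
by exists K => // x Ox nK; rewrite -fg//; exact: Kf.
Qed.

Lemma CkcMr k f g : Ckc Omega k f -> Ck Omega k g -> Ckc Omega k (fun x => f x * g x).
Proof.
move=> [cf [K cK Kf]] cg; split; first exact: CkM.
by exists K => // x Ox nK; rewrite Kf// mul0r.
Qed.

Lemma CkcMl k f g : Ck Omega k g -> Ckc Omega k f -> Ckc Omega k (fun x => g x * f x).
Proof. by move=> cg af; apply: Ckc_eq (CkcMr af cg) => x _; rewrite mulrC. Qed.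

Lemma CkcZ k (c : R) f : Ckc Omega k f -> Ckc Omega k (fun x => c * f x).
Proof. exact/CkcMl/Ck_cst. Qed.

Lemma Ckc0 k : Ckc Omega k (fun=> 0).
Proof. by split; [exact: Ck_cst|exists set0 => //; exact: compact0]. Qed.

Lemma CkcD k f g : Ckc Omega k f -> Ckc Omega k g -> Ckc Omega k (fun x => f x + g x).
Proof.
move=> [cf [K cK Kf]] [cg [L cL Lg]]; split; first exact: CkD.
exists (K `|` L); first exact: compactU.
by move=> x Ox /not_orP[nK nL]; rewrite Kf// Lg// addr0.
Qed.

Lemma CkcN k f : Ckc Omega k f -> Ckc Omega k (fun x => - f x).
Proof. by move=> /(CkcZ (-1)); apply: Ckc_eq => x _; rewrite mulN1r. Qed.

Lemma CkcB k f g : Ckc Omega k f -> Ckc Omega k g -> Ckc Omega k (fun x => f x - g x).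
Proof. by move=> af ag; apply: CkcD => //; exact: CkcN. Qed.

Lemma Ckc_sum (I : Type) (r : seq I) k (F : I -> 'rV[R]_n -> R) :
  (forall i, Ckc Omega k (F i)) -> Ckc Omega k (fun x => \sum_(i <- r) F i x).
Proof.
move=> aF; elim: r => [|i r IH].
  by apply: Ckc_eq (Ckc0 k) => x _; rewrite big_nil.
by apply: Ckc_eq (CkcD (aF i) IH) => x _; rewrite big_cons.
Qed.

Lemma CkcS k f : Ckc Omega k.+1 f -> Ckc Omega k f.
Proof. by move=> [cf Kf]; split => //; exact: CkS. Qed.

Lemma Ckc_Ck k f : Ckc Omega k f -> Ck Omega k f. Proof. by case. Qed.

Lemma Ckc_partial k f j : Ckc Omega k.+1 f -> Ckc Omega k (partial j f).
Proof.
move=> [cf [K cK Kf]]; split; first exact: Ck_partial.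
exists K => // x Ox nK; apply: partial_near0.
by apply: filterS2 (near_open oO Ox) (compact_near_notin cK nK) => y; exact: Kf.
Qed.

End integration.

(** * The integral of a derivative over the whole space *)

Section integral_derivative.
Variable R : realType.
Local Notation M := (measurableTypeR R).
Local Notation mu n := (lebesgue_tuple R n).
Local Notation row := (@row_of_tuple R _).

(** The fundamental theorem of calculus on an interval that contains the
   support. *)
Lemma integral_derive1_eq0 (F f : R -> R) (r : R) : 0 < r ->
  (forall s, is_derive s (1 : R) F (f s)) -> continuous f ->
  (forall s, r <= `|s| -> F s = 0 /\ f s = 0) ->
  (\int[@lebesgue_measure R]_s (f s)%:E = 0)%E.
Proof.
move=> r0 dF cf F0.
have r'r : - r < r by lra.
have cF : continuous F.
  by move=> s; apply/differentiable_continuous/derivable1_diffP; have [] := dF s.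
have -> : (\int[@lebesgue_measure R]_s (f s)%:E =
    \int[@lebesgue_measure R]_(s in `[(- r)%R, r]) (f s)%:E)%E.
  rewrite [RHS]integral_mkcond; apply: eq_integral => s _.
  rewrite patchE; case: ifPn => // /negP; rewrite inE/= in_itv/= -ler_norml => /negP.
  by rewrite -ltNge => /ltW /F0[_ ->].
rewrite (continuous_FTC2 (F := F))//.
- have [-> _] := F0 r (ler_norm r).
  have [-> _] : F (- r) = 0 /\ f (- r) = 0 by apply: F0; rewrite normrN ler_norm.
  by rewrite subee.
- exact: continuous_subspaceT.
- split.
  + by move=> s _; have [] := dF s.
  + exact/cvg_at_right_filter/cF.
  + exact/cvg_at_left_filter/cF.
- by move=> s _; rewrite derive1E; have [_ ->] := dF s.
Qed.

(** The counterpart on row vectors of [tcons], along which the measure is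
   built by induction. *)
Definition cons_row n (x : R) (v : 'rV[R]_n) : 'rV[R]_n.+1 :=
  \row_i (if unlift ord0 i is Some k then v 0 k else x).

Lemma row_tcons n (p : M * n.-tuple M) : row (tcons p) = cons_row p.1 (row p.2).
Proof.
case: p => x t; apply/rowP => i; rewrite !mxE.
case: unliftP => [k ->|->]; first by rewrite tnthS mxE.
by rewrite (tnth_nth 0).
Qed.

Lemma cons_row_ball n x y (v w : 'rV[R]_n) (r : R) : 0 < r ->
  ball x r y -> ball v r w -> ball (cons_row x v) r (cons_row y w).
Proof.
move=> r0 xy [_ vw]; split => // i j; rewrite !ord1 !mxE.
by case: unliftP => [k _|_] //; exact: vw.
Qed.

Lemma cons_row_continuousl n (v : 'rV[R]_n) : continuous (fun x => cons_row x v).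
Proof.
move=> x A /nbhs_ballP[e /= e0 eA]; apply/nbhs_ballP; exists e => //= y xy.
by apply/eA/cons_row_ball => //; exact: ballxx.
Qed.

Lemma cons_row_continuousr n (x : R) : continuous (@cons_row n x).
Proof.
move=> v A /nbhs_ballP[e /= e0 eA]; apply/nbhs_ballP; exists e => //= w vw.
by apply/eA/cons_row_ball => //; exact: ballxx.
Qed.

Lemma cons_rowEl n (x : R) (v : 'rV[R]_n) :
  cons_row x v = x *: delta_mx 0 ord0 + cons_row 0 v.
Proof.
apply/rowP => i; rewrite !mxE eqxx/=.
case: unliftP => [k ->|->]; last by rewrite eqxx mulr1 addr0.
by rewrite eq_sym (negbTE (neq_lift _ _)) mulr0 add0r.
Qed.

Lemma cons_rowDr n (h x : R) (v : 'rV[R]_n) k :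
  cons_row x (h *: delta_mx 0 k + v) = h *: delta_mx 0 (lift ord0 k) + cons_row x v.
Proof.
apply/rowP => i; rewrite !mxE eqxx/=.
case: unliftP => [k' ->|->]; first by rewrite !mxE eqxx/= (inj_eq lift_inj).
by rewrite (negbTE (neq_lift _ _)) mulr0 add0r.
Qed.

Lemma integrable_tcons n (g : 'rV[R]_n.+1 -> R) : integrable_rV setT g ->
  (@lebesgue_measure R \x mu n)%E.-integrable setT
    (fun p => (g (cons_row p.1 (row p.2)))%:E).
Proof.
move=> Ig; have := Ig => /integrableP[mg gfin].
have E : (fun p => (g (cons_row p.1 (row p.2)))%:E) =
  (EFin \o (g \o row)) \o (@tcons R n).
  by apply/funext => p /=; rewrite row_tcons.
have mT := @measurable_tcons R n.
rewrite preimage_setT in mg gfin.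
apply/integrableP; rewrite E; split; first exact: measurableT_comp mg mT.
have E2 := @ge0_integral_pushforward _ _ _ _ R _ mT (@lebesgue_measure R \x mu n)%E
  setT (fun t => `|(EFin \o (g \o row)) t|)%E measurableT.
rewrite preimage_setT in E2; apply: (le_lt_trans _ gfin).
rewrite le_eqVlt; apply/orP; left; apply/eqP/esym.
have MU : (mu n.+1 : set _ -> \bar R) = pushforward (@lebesgue_measure R \x mu n)%E (@tcons R n) by [].
have {}E2 := E2 (measurableT_comp (@abse_measurable _ _) mg) (fun=> fun=> abse_ge0 _).
rewrite MU; apply: (etrans E2).
by apply: eq_integral => p _ /=; rewrite row_tcons.
Qed.

Lemma integral_tcons n (g : 'rV[R]_n.+1 -> R) : integrable_rV setT g ->
  (\int[mu n.+1]_t (g (row t))%:E =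
   \int[(@lebesgue_measure R \x mu n)%E]_p (g (cons_row p.1 (row p.2)))%:E)%E.
Proof.
move=> Ig; have /integrableP[mg _] := Ig; rewrite preimage_setT in mg.
have mT := @measurable_tcons R n.
have E : (fun p => (g (cons_row p.1 (row p.2)))%:E) =
  (EFin \o (g \o row)) \o (@tcons R n).
  by apply/funext => p /=; rewrite row_tcons.
have MU : (mu n.+1 : set _ -> \bar R) =
  pushforward (@lebesgue_measure R \x mu n)%E (@tcons R n) by [].
have Igt := integrable_tcons Ig; rewrite E in Igt.
have E2 := @integral_pushforward _ _ _ _ R _ mT (@lebesgue_measure R \x mu n)%E
  setT (EFin \o (g \o row)) mg.
rewrite preimage_setT in E2; rewrite MU; apply: (etrans (E2 Igt measurableT)).
by apply: eq_integral => p _ /=; rewrite row_tcons.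
Qed.

(** By induction on the dimension with Fubini's theorem: the first coordinate
   is integrated innermost when the derivative is along it, outermost
   otherwise. *)
Lemma integral_derive_eq0 n (j : 'I_n) (f g : 'rV[R]_n -> R) (r : R) : 0 < r ->
  (forall x : 'rV[R]_n, is_derive x (delta_mx 0 j) f (g x)) -> continuous g ->
  (forall (x : 'rV[R]_n) i, r <= `|x 0 i| -> f x = 0 /\ g x = 0) ->
  (\int[mu n]_t (g (row t))%:E = 0)%E.
Proof.
move=> r0; elim: n j f g => [[]//|n IH] j f g df cg f0.
have Ig : integrable_rV setT g.
  apply: (@Ckc_integrable _ _ _ openT 0); split.
    split => // p _; apply/cvg_ex; exists (g p); apply: cvg_within_filter; exact: cg.
  exists [set v : 'rV[R]_n.+1 | forall i, v ord0 i \in `[(- r), r]].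
    by apply: (@rV_compact _ _ (fun=> `[(- r), r]%classic)) => _; exact: segment_compact.
  move=> x _ nx; have /existsNP[i /negP] : ~ (forall i, x ord0 i \in `[(- r), r]) := nx.
  rewrite in_itv/= -ler_norml -ltNge => /ltW /f0[] //.
rewrite integral_tcons//.
case: (unliftP ord0 j) df => [k|] -> df.
  rewrite -(integral12_prod_meas1 (integrable_tcons Ig)) /fubini_F/=.
  rewrite -[RHS](integral0 (@lebesgue_measure R) setT); apply: eq_integral => x _.
  apply: (IH k (f \o cons_row x) (g \o cons_row x)).
  - move=> v; apply/is_derive_lineP.
    have /is_derive_lineP := df (cons_row x v).
    suff -> : (fun h : R => f (h *: delta_mx 0 (lift ord0 k) + cons_row x v)) =
      (fun h : R => (f \o cons_row x) (h *: delta_mx 0 k + v)) by [].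
    by apply/funext => h /=; rewrite cons_rowDr.
  - by move=> v; apply: continuous_comp; [exact: cons_row_continuousr|exact: cg].
  - move=> v i vi; apply: (f0 _ (lift ord0 i)); by rewrite mxE liftK.
rewrite -(integral21_prod_meas1 (integrable_tcons Ig)) /fubini_G/=.
rewrite -[RHS](integral0 (mu n) setT); apply: eq_integral => t _.
apply: (@integral_derive1_eq0 (fun x => f (cons_row x (row t))) _ r r0).
- move=> s; have := df (cons_row s (row t)); rewrite [X in is_derive X]cons_rowEl.
  move=> /is_derive_along.
  suff -> : (fun s0 : R => f (s0 *: delta_mx 0 ord0 + cons_row 0 (row t))) =
     (fun x : R => f (cons_row x (row t))) by [].
  by apply/funext => u /=; rewrite [in RHS]cons_rowEl.
- by move=> s; apply: continuous_comp; [exact: cons_row_continuousl|exact: cg].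
- by move=> s rs; apply: (f0 _ ord0); rewrite mxE unlift_none.
Qed.

End integral_derivative.

(** * The divergence theorem for tangential fields *)

Section integral_partial.
Variables (R : realType) (n : nat).
Implicit Types (Omega C : set 'rV[R]_n) (f g : 'rV[R]_n -> R).

Lemma integral_rV_setT Omega f : (forall x, ~ Omega x -> f x = 0) ->
  integral_rV Omega f = integral_rV setT f.
Proof.
move=> f0; rewrite /integral_rV Rintegral_mkcond preimage_setT.
apply: eq_Rintegral => t _; rewrite patchE; case: ifPn => // /negP.
by rewrite inE => /f0.
Qed.

(** The function extends by zero to the whole space. *)
Lemma integral_partial_eq0 Omega C f j : open Omega -> compact C -> C `<=` Omega ->
  supported Omega C f -> Ck Omega 1 f -> integral_rV Omega (partial j f) = 0.
Proof.
move=> oO cC CO f0 cf.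
pose h : 'rV[R]_n -> R := fun x => if pselect (Omega x) then f x else 0.
have hE x : Omega x -> f x = h x by move=> Ox; rewrite /h; case: pselect.
have clC : closed C by apply: compact_closed cC; exact: norm_hausdorff.
have h0 x : ~ C x -> h x = 0.
  by move=> nC; rewrite /h; case: pselect => // Ox; exact: f0.
have ch : Ck setT 1 h by apply: (Ck_zero_ext oO clC CO h0); exact: Ck_eq cf.
have dh0 x : ~ C x -> partial j h x = 0.
  move=> nC; apply: partial_near0.
  by apply: filterS (closed_near_notin clC nC) => y; exact: h0.
rewrite (integral_rV_eq (g := partial j h)); last first.
  by move=> x Ox; apply: (partial_eq oO).
rewrite integral_rV_setT; last by move=> x nO; apply: dh0 => /CO.
have [r r0 Cr] := compact_ball cC.
have D x : is_derive x (delta_mx 0 j) h (partial j h x) by exact: (Ck_is_derive j ch).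
have c : continuous (partial j h).
  by move=> x; apply: (Ck_continuous openT (Ck_partial j ch)).
have z (x : 'rV[R]_n) i : r <= `|x 0 i| -> h x = 0 /\ partial j h x = 0.
  move=> rx; suff nC : ~ C x by split; [exact: h0|exact: dh0].
  move=> /Cr [_ /(_ 0 i)]; rewrite -ball_normE/= mxE sub0r normrN.
  by move=> /lt_le_trans/(_ rx); rewrite ltxx.
rewrite /integral_rV /Rintegral preimage_setT.
by have -> := integral_derive_eq0 r0 D c z.
Qed.

End integral_partial.

Section bump.
Variables (R : realType) (n : nat).
Implicit Types (Omega K : set 'rV[R]_n) (p x : 'rV[R]_n).

Lemma is_derive_coord (x : 'rV[R]_n) i j :
  is_derive x (delta_mx 0 j) (fun x : 'rV[R]_n => x 0 i) (i == j)%:R.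
Proof.
apply/is_derive_lineP.
have -> : (fun h : R => (h *: delta_mx 0 j + x) 0 i) =
  (fun h : R => (i == j)%:R * h + x 0 i).
  by apply/funext => h; rewrite !mxE mulrC.
set c := _%:R; set d := x 0 i; clearbody c d.
have H := is_deriveD (is_deriveZ c (is_derive_id (0 : R) (1 : R)))
  (is_derive_cst d (0 : R) (1 : R)).
by apply: (is_derive_eq H); rewrite addr0 /GRing.scale/= mulr1.
Qed.

Lemma Ck_coord Omega k (i : 'I_n) : Ck Omega k (fun x : 'rV[R]_n => x 0 i).
Proof.
have tr : has_trace setT (fun x : 'rV[R]_n => x 0 i).
  move=> p _; apply/cvg_ex; exists (p 0 i); apply: cvg_within_filter.
  exact: coord_continuous.
apply: Ck_subset; case: k => [|k]; first by split.
apply: (Ck_intro openT (Df := fun j _ => (i == j)%:R)) => //.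
- by move=> j x _; exact: is_derive_coord.
- by move=> j; exact: (Ck_cst openT).
Qed.

Definition sqr_dist (p x : 'rV[R]_n) : R := \sum_i (x 0 i - p 0 i) ^+ 2.

Lemma Ck_sqr_dist Omega k p : open Omega -> Ck Omega k (sqr_dist p).
Proof.
move=> oO; apply: (Ck_sum oO) => i _; apply: (CkX oO); apply: (CkB oO).
  exact: Ck_coord.
exact: Ck_cst.
Qed.

Lemma partial_sqr_dist p x j : partial j (sqr_dist p) x = 2 * (x 0 j - p 0 j).
Proof.
have cX i : Ck setT 1 (fun x : 'rV[R]_n => x 0 i - p 0 i).
  by apply: (CkB openT); [exact: Ck_coord|exact: (Ck_cst openT)].
have dX i : partial j (fun x : 'rV[R]_n => x 0 i - p 0 i) x = (i == j)%:R.
  rewrite (partialB j (Ck_coord setT 1 i) (Ck_cst openT 1 (p 0 i)))//.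
  have [_ e] := is_derive_coord x i j.
  by rewrite [X in X - _]e [X in _ - X]derive_cst subr0.
rewrite /sqr_dist (partial_sum openT _ (k := 0)) => // [|i _]; last exact: (CkX openT).
rewrite (eq_bigr (fun i => 2 * (x 0 i - p 0 i) * (i == j)%:R)) => [|i _]; last first.
  have E : (fun x : 'rV[R]_n => (x 0 i - p 0 i) ^+ 2) =
    (fun x : 'rV[R]_n => (x 0 i - p 0 i) * (x 0 i - p 0 i)) by apply/funext.
  by rewrite E (partialM j (cX i) (cX i))// dX; ring.
rewrite (bigD1 j)//= eqxx mulr1 big1 ?addr0// => i /negbTE ->.
by rewrite mulr0.
Qed.

Lemma coord_sqr_dist p x i : (x 0 i - p 0 i) ^+ 2 <= sqr_dist p x.
Proof. by rewrite /sqr_dist (bigD1 i)//= lerDl sumr_ge0// => j _; exact: sqr_ge0. Qed.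

Lemma exists_bump K : compact K -> exists eta : 'rV[R]_n -> R,
  [/\ forall k, Ck setT k eta, exists2 L, compact L & supported setT L eta,
     forall x, 0 <= eta x & forall x, K x -> 0 < eta x].
Proof.
move=> cK; have [r r0 Kr] := compact_ball cK.
pose A : R := n%:R * r ^+ 2 + 1.
have A0 : 0 < A by rewrite ltr_wpDl// mulr_ge0// sqr_ge0.
exists (fun x => flat 0 (A - sqr_dist 0 x)); split.
- move=> k; apply: (Ck_flat openT); apply: (CkB openT); first exact: (Ck_cst openT).
  exact: Ck_sqr_dist openT.
- exists [set v : 'rV[R]_n | forall i, v ord0 i \in `[(- (A + 1)), A + 1]].
    by apply: (@rV_compact _ _ (fun=> `[(- (A + 1)), A + 1]%classic)) => _; exact: segment_compact.
  move=> x _ nx; have /existsNP[i /negP] : ~ (forall i, x ord0 i \in `[(- (A + 1)), A + 1]) := nx.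
  rewrite in_itv/= -ler_norml -ltNge => Ax.
  apply: flat_le0; rewrite subr_le0; apply: le_trans (coord_sqr_dist 0 x i).
  rewrite mxE subr0 -real_normK ?num_real//; move: Ax; move: `|x _ _| => y Ay.
  by nra.
- by move=> x; exact: flat_ge0.
- move=> x /Kr[_ Kx]; apply: flat_gt0; rewrite subr_gt0 /A.
  apply: (@le_lt_trans _ _ (\sum_(i < n) r ^+ 2)); last first.
    by rewrite sumr_const card_ord mulr_natl ltrDl.
  apply: ler_sum => i _; rewrite mxE subr0 -real_normK ?num_real//.
  have := Kx 0 i; rewrite -ball_normE/= mxE sub0r normrN => xr.
  by rewrite lerXn2r// ?nnegrE ltW.
Qed.

End bump.

Section smooth_domain.
Variables (R : realType) (n : nat) (Omega : set 'rV[R]_n) (rho : 'rV[R]_n -> R).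
Hypothesis drho : defining_function Omega rho.
Implicit Types (K : set 'rV[R]_n) (p x : 'rV[R]_n) (f g h a eta : 'rV[R]_n -> R) (F : 'I_n -> 'rV[R]_n -> R).

Let srho : smooth rho. Proof. by case: drho. Qed.
Let OE : Omega = [set x | rho x < 0]. Proof. by case: drho. Qed.

Local Notation N j := (partial j rho).

Lemma Ck_rho k : Ck Omega k rho.
Proof. exact/Ck_subset/smooth_Ck. Qed.

Lemma rho_continuous : continuous rho.
Proof. by move=> x; apply: (Ck_continuous openT (smooth_Ck 0 srho)). Qed.

Lemma N_continuous j : continuous (N j).
Proof.
by move=> x; apply: (Ck_continuous openT (Ck_partial j (smooth_Ck 1 srho))).
Qed.

Lemma defining_open : open Omega.
Proof.
rewrite OE; apply: (open_comp (f := rho) (D := [set y | y < 0])); last exact: open_lt.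
by move=> x _; exact: rho_continuous.
Qed.
Let oO := defining_open.

Lemma rho_closure p : closure Omega p -> rho p <= 0.
Proof.
have cl : closed [set x | rho x <= 0].
  apply: (closed_comp (f := rho) (D := [set y | y <= 0])); last exact: closed_le.
  by move=> x _; exact: rho_continuous.
by move=> cp; apply: cl; apply: closure_subset cp => x; rewrite OE => /ltW.
Qed.

Lemma rho_bdry p : closure Omega p -> rho p = 0 -> bdry Omega p.
Proof.
move=> cp p0; split => //; have /interior_id -> := oO.
by rewrite OE/= p0 ltxx.
Qed.

Lemma bdry_rho p : bdry Omega p -> rho p = 0.
Proof.
move=> [cp]; have /interior_id -> := oO; rewrite OE/= => /negP; rewrite -leNgt => p0.
by apply/eqP; rewrite eq_le p0 rho_closure.
Qed.

(** The way in which fields are recognized as tangential: a normal component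
   that is divisible by [rho] vanishes on the boundary. *)
Lemma cvg_mul_rho g h p : bdry Omega p -> has_trace Omega g ->
  (forall x, Omega x -> g x * rho x = h x) ->
  h x @[x --> within Omega (nbhs p)] --> (0 : R).
Proof.
move=> bp tg E; have [cp _] := bp.
rewrite -(within_near_eq p E) -[X in _ --> X](mulr0 (trace Omega g p)).
apply: cvgM; first exact: has_trace_within tg cp.
by rewrite -(bdry_rho bp); apply: cvg_within_filter; exact: rho_continuous.
Qed.

(** The normal is used unnormalized throughout, as the gradient of [rho],
   which is smooth everywhere. *)
Definition normN2 x : R := \sum_j N j x ^+ 2.

Lemma normN2_gt0 p : bdry Omega p -> 0 < normN2 p.
Proof.
move=> bp; have [_ _ /(_ _ bp) gp] := drho.
rewrite lt_neqAle sumr_ge0 ?andbT => [|j _]; last exact: sqr_ge0.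
apply: contra gp; rewrite eq_sym psumr_eq0 => [/allP H|j _]; last exact: sqr_ge0.
apply/eqP/rowP => j; rewrite !mxE; apply/eqP.
by have := H j; rewrite sqrf_eq0; apply; rewrite mem_index_enum.
Qed.

Lemma Ck_N k j : Ck Omega k (N j).
Proof. exact: Ck_partial (Ck_rho k.+1). Qed.

Lemma Ck_normN2 k : Ck Omega k normN2.
Proof. by apply: Ck_sum => // j _; apply: CkX => //; exact: Ck_N. Qed.

Lemma normN2_continuous : continuous normN2.
Proof.
move=> x; apply: (Ck_continuous openT (k := 0)) => //.
apply: (Ck_sum openT) => j _; apply: (CkX openT).
exact: (Ck_partial j (smooth_Ck 1 srho)).
Qed.

Definition divergence F x : R := \sum_j partial j (F j) x.
Definition flux F x : R := \sum_j N j x * F j x.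

(** Nondecreasing in [m], with limit the indicator of [Omega]; zero where [rho
   >= - (m.+1)^-1], hence near the boundary. *)
Definition cutoff (m : nat) x : R := flat 0 (- (m.+1%:R * rho x) - 1).
(** The gradient of [cutoff m] is [- layer m] times the normal: as [m] grows
   the layers concentrate on the boundary and play the role of its surface
   measure. *)
Definition layer (m : nat) x : R := m.+1%:R * flat 2 (- (m.+1%:R * rho x) - 1).

Lemma Ck_layer_arg k m : Ck Omega k (fun x => - (m.+1%:R * rho x) - 1).
Proof.
apply: CkB => //; last exact: Ck_cst.
by apply: CkN => //; apply: CkM => //; [exact: Ck_cst|exact: Ck_rho].
Qed.

Lemma Ck_cutoff k m : Ck Omega k (cutoff m).
Proof. by apply: Ck_flat => //; exact: Ck_layer_arg. Qed.

Lemma Ck_layer k m : Ck Omega k (layer m).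
Proof.
apply: CkM => //; first exact: Ck_cst.
by apply: Ck_flat => //; exact: Ck_layer_arg.
Qed.

Lemma partial_cutoff m j x : Omega x -> partial j (cutoff m) x = - layer m x * N j x.
Proof.
move=> Ox; rewrite (partial_flat _ _ (Ck_layer_arg 1 m))//.
rewrite (partialB _ (_ : Ck Omega 1 (fun x => - (m.+1%:R * rho x))) (Ck_cst oO 1 1))//; last first.
  by apply: CkN => //; apply: CkM => //; [exact: Ck_cst|exact: Ck_rho].
rewrite [partial j (fun=> 1) x]derive_cst subr0.
have -> : (fun x => - (m.+1%:R * rho x)) = (fun x => (- m.+1%:R) * rho x).
  by apply/funext => y; rewrite mulNr.
rewrite (partialZ oO _ _ (Ck_rho 1))// /layer.
by rewrite oppr0 mul0r add0r; ring.
Qed.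

Lemma cutoff_ge0 m x : 0 <= cutoff m x. Proof. exact: flat_ge0. Qed.
Lemma cutoff_le1 m x : cutoff m x <= 1. Proof. exact: flat0_le1. Qed.
Lemma layer_ge0 m x : 0 <= layer m x. Proof. by rewrite mulr_ge0// flat_ge0. Qed.

Lemma cutoff_cvg x : Omega x -> cutoff m x @[m --> \oo] --> (1 : R).
Proof.
rewrite OE/= => rx; apply/cvgrPdist_le => e e0.
near=> m; set t := - (m.+1%:R * rho x) - 1.
have te : e^-1 <= t.
  have : (1 + e^-1) / - rho x <= m%:R by near: m; exact: nbhs_infty_ger.
  rewrite ler_pdivrMr ?oppr_gt0// mulrN => H.
  rewrite /t -natr1 mulrDl mul1r; move: H rx; move: (e^-1) (m%:R * rho x) => a b.
  lra.
have t0 : 0 < t by apply: lt_le_trans te; rewrite invr_gt0.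
have ti : t^-1 <= e by rewrite -[e]invrK lef_pV2// posrE invr_gt0.
have E : cutoff m x = expR (- t^-1) by rewrite /cutoff /flat -/t t0 expr0 mul1r.
rewrite ger0_norm ?subr_ge0 ?cutoff_le1// E.
by apply: le_trans ti; have := expR_ge1Dx (- t^-1); lra.
Unshelve. all: by end_near. Qed.

(** Away from the boundary the layers tend to zero: with [t + 1 = - m.+1 *
   rho], the product [(t + 1) ^ 2 * flat 2 t] expands into [flat 0 t + 2 *
   flat 1 t + flat 2 t], which is at most [5]. *)
Lemma layer_rho2 m x : layer m x * rho x ^+ 2 <= 5 / m.+1%:R.
Proof.
rewrite /layer; set t := - (m.+1%:R * rho x) - 1.
have m0 : m.+1%:R != 0 :> R by rewrite pnatr_eq0.
have -> : rho x = - (t + 1) / m.+1%:R by rewrite /t; field; rewrite addrC natr1.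
have -> : m.+1%:R * flat 2 t * (- (t + 1) / m.+1%:R) ^+ 2 =
  (t * (t * flat 2 t) + 2 * (t * flat 2 t) + flat 2 t) / m.+1%:R.
  by field; rewrite addrC natr1.
rewrite -!flatS ler_wpM2r ?invr_ge0//.
have := flat0_le1 t; have := flat_le_fact 1 t; have := flat_le_fact 2 t.
rewrite -/(2`!) -/(1`!) (_ : 2`! = 2)%N// (_ : 1`! = 1)%N//.
lra.
Qed.

(** The support is that of [f] intersected with [rho <= - (m.+1)^-1], a closed
   set inside [Omega]. *)
Lemma cutoff_support K m f : compact K -> supported Omega K f ->
  exists C, [/\ compact C, C `<=` Omega & supported Omega C (fun x => cutoff m x * f x)].
Proof.
move=> cK Kf; exists (K `&` [set x | rho x <= - m.+1%:R^-1]); split.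
- apply: compact_closedI => //.
  apply: (closed_comp (f := rho) (D := [set y | y <= - m.+1%:R^-1])); last exact: closed_le.
  by move=> x _; exact: rho_continuous.
- by move=> x [_ /= rx]; rewrite OE/=; apply: le_lt_trans rx _; rewrite oppr_lt0 invr_gt0.
- move=> x Ox /not_andP[nK|/= /negP]; first by rewrite Kf// mulr0.
  rewrite -ltNge => rx; rewrite /cutoff flat_le0 ?mul0r// subr_le0 lerNl.
  by rewrite mulrC -ler_pdivrMr// mulN1r ltW.
Qed.

(** The divergence of the field cut off by [cutoff m] integrates to zero. *)
Lemma cutoff_flux F m : (forall j, Ckc Omega 1 (F j)) ->
  integral_rV Omega (fun x => cutoff m x * divergence F x) =
  integral_rV Omega (fun x => layer m x * flux F x).
Proof.
move=> aF; apply/eqP; rewrite -subr_eq0.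
have a1 : Ckc Omega 0 (fun x => cutoff m x * divergence F x).
  apply: CkcMl => //; first exact: Ck_cutoff.
  by apply: Ckc_sum => // j; exact: Ckc_partial.
have a2 : Ckc Omega 0 (fun x => layer m x * flux F x).
  apply: CkcMl => //; first exact: Ck_layer.
  by apply: Ckc_sum => // j; apply: CkcMl => //; [exact: Ck_N|exact: CkcS].
rewrite -integral_rVB//; [|exact: Ckc_integrable a1|exact: Ckc_integrable a2].
have cF j : Ck Omega 1 (fun x => cutoff m x * F j x).
  by apply: CkM => //; [exact: Ck_cutoff|exact: Ckc_Ck].
rewrite (integral_rV_eq (g := fun x => \sum_j partial j (fun y => cutoff m y * F j y) x)).
  rewrite integral_rV_sum//.
    rewrite big1// => j _; have [_ [K cK KF]] := aF j.
    have [C [cC CO C0]] := cutoff_support m cK KF.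
    exact: integral_partial_eq0 oO cC CO C0 (cF j).
  move=> j; apply: (@Ckc_integrable _ _ _ oO 0); apply: Ckc_partial => //.
  by apply: CkcMl => //; exact: Ck_cutoff.
move=> x Ox; rewrite /divergence /flux !mulr_sumr -sumrB; apply: eq_bigr => j _.
rewrite (partialM _ (Ck_cutoff 1 m) (Ckc_Ck (aF j)))// partial_cutoff//.
by ring.
Qed.

(** By compactness. Near the boundary [a] is small against [|N|^2 eta];
   elsewhere it is bounded and [rho ^ 2 * eta] is bounded below. *)
Lemma flux_small a K eta (d : R) : 0 < d -> compact K -> has_trace Omega a ->
  (forall p, bdry Omega p -> a x @[x --> within Omega (nbhs p)] --> (0 : R)) ->
  continuous eta -> (forall x, K x -> 0 < eta x) -> (forall x, 0 <= eta x) ->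
  exists B : R, forall x, Omega x -> K x ->
    `|a x| <= d * (normN2 x * eta x) + B * (rho x ^+ 2 * eta x).
Proof.
move=> d0 cK ta a0 ceta eta0 eta_ge0.
pose Q x := rho x ^+ 2 * eta x.
have Q0 x : 0 <= Q x by rewrite mulr_ge0// sqr_ge0.
have P0 x : 0 <= d * (normN2 x * eta x).
  by rewrite mulr_ge0 ?(ltW d0)// mulr_ge0// sumr_ge0// => j _; exact: sqr_ge0.
have cQ : continuous Q.
  move=> x; have cr := @rho_continuous x.
  exact: (cvgM (cvgM cr cr) (ceta x)).
have cP : continuous (fun x => d * (normN2 x * eta x)).
  move=> x; have cn := @normN2_continuous x.
  exact: (cvgM (cvg_cst d) (cvgM cn (ceta x))).
have [|B HB] := @compact_threshold _ _ K (fun B x => Omega x ->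
    `|a x| <= d * (normN2 x * eta x) + B * Q x) cK; last first.
  by exists B => x Ox Kx; exact: HB.
move=> p Kp; have [cp|ncp] := pselect (closure Omega p); last first.
  exists 0; have := closed_near_notin (@closed_closure _ Omega) ncp.
  by apply: filterS => x nx B _ Ox; exfalso; apply: nx; exact: subset_closure.
have [p0|p0] := eqVneq (rho p) 0.
  have bp := rho_bdry cp p0; exists 0.
  pose c := d * (normN2 p * eta p) / 2.
  have c0 : 0 < c by rewrite divr_gt0// mulr_gt0// mulr_gt0 ?normN2_gt0// eta0.
  have n1 : \forall x \near p, Omega x -> `|a x| <= c.
    have /cvgrPdist_le/(_ _ c0) := a0 _ bp.
    by rewrite near_withinE; apply: filterS => x + Ox => /(_ Ox); rewrite sub0r normrN.
  have n2 : \forall x \near p, c <= d * (normN2 x * eta x).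
    have /cvgrPdist_le/(_ _ c0) := cP p; apply: filterS => x.
    by rewrite ler_norml /c => /andP[? ?]; lra.
  apply: filterS2 n1 n2 => x ax cx B B0 Ox; apply: le_trans (ax Ox) _.
  by rewrite ler_wpDr// mulr_ge0.
have Op : Omega p by rewrite OE/= lt_neqAle p0 rho_closure.
have Qp : 0 < Q p by rewrite mulr_gt0 ?eta0// exprn_even_gt0.
exists ((`|a p| + 1) / (Q p / 2)).
have n1 : \forall x \near p, `|a x| <= `|a p| + 1.
  have /cvgrPdist_le/(_ _ ltr01) := has_trace_continuous oO ta Op; apply: filterS => x ax.
  rewrite -lerBlDl; apply: le_trans ax; rewrite distrC; exact: lerB_dist.
have n2 : \forall x \near p, Q p / 2 <= Q x.
  have Q2 : 0 < Q p / 2 by rewrite divr_gt0.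
  have /cvgrPdist_le/(_ _ Q2) := cQ p; apply: filterS => x.
  by rewrite ler_norml => /andP[? ?]; lra.
apply: filterS2 n1 n2 => x ax Qx B; rewrite ler_pdivrMr ?divr_gt0// => HB Ox.
have B0 : 0 <= B.
  rewrite -(pmulr_lge0 _ (_ : 0 < Q p / 2)) ?divr_gt0//.
  by apply: le_trans HB; rewrite addr_ge0.
apply: le_trans ax _; apply: le_trans HB _; rewrite ler_wpDl//.
by rewrite ler_wpM2l.
Qed.

(** The integral of [cutoff m * divergence F] tends to that of [divergence F],
   and equals the flux of [F] through the layer. For the field [eta * N] the
   same identity bounds the integral of [layer m * |N|^2 * eta] uniformly in
   [m]; by [flux_small] and [layer_rho2] the flux of a tangential [F] then
   tends to zero. *)
Theorem divergence_tangential F : (forall j, Ckc Omega 1 (F j)) ->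
  (forall p, bdry Omega p -> flux F x @[x --> within Omega (nbhs p)] --> (0 : R)) ->
  integral_rV Omega (divergence F) = 0.
Proof.
move=> aF F0.
have adivF : Ckc Omega 0 (divergence F) by apply: Ckc_sum => // j; exact: Ckc_partial.
have afl : Ckc Omega 0 (flux F).
  by apply: Ckc_sum => // j; apply: CkcMl => //; [exact: Ck_N|exact: CkcS].
have lim1 : integral_rV Omega (fun x => cutoff m x * divergence F x) @[m --> \oo] -->
    integral_rV Omega (divergence F).
  apply: (@dominated_cvg_rV _ _ _ oO _ _ (fun x => `|divergence F x|)).
  - move=> m; apply: (Ck_measurable oO (k := 0)).
    by apply: CkM => //; [exact: Ck_cutoff|exact: Ckc_Ck adivF].
  - exact: Ck_measurable (Ckc_Ck adivF).
  - exact: integrable_abse (Ckc_integrable oO adivF).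
  - move=> m x Ox; rewrite normrM ler_piMl// ger0_norm ?cutoff_ge0//.
    exact: cutoff_le1.
  - move=> x Ox; rewrite -[X in _ --> X]mul1r; apply: cvgM; last exact: cvg_cst.
    exact: cutoff_cvg.
have [cfl [K cK Kfl]] := afl.
have [eta [ceta [L cL Leta] eta_ge0 eta0]] := exists_bump cK.
have aeta : Ckc Omega 1 eta.
  split; first exact/Ck_subset/ceta.
  by exists L => // x _; exact: Leta.
have eta_cont : continuous eta by move=> x; apply: (Ck_continuous openT (ceta 0%N)).
have aetaN j : Ckc Omega 1 (fun x => eta x * N j x).
  by apply: CkcMr => //; exact: Ck_N.
pose C0 := integral_rV Omega (fun x => `|divergence (fun j x => eta x * N j x) x|).
have adivN : Ckc Omega 0 (divergence (fun j x => eta x * N j x)).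
  by apply: Ckc_sum => // j; exact: Ckc_partial.
have C0ge0 : 0 <= C0 by apply: integral_rV_ge0.
have aP m : Ckc Omega 0 (fun x => layer m x * (normN2 x * eta x)).
  apply: CkcMl => //; first exact: Ck_layer.
  by apply: CkcMl => //; [exact: Ck_normN2|exact: CkcS].
have layerN m : integral_rV Omega (fun x => layer m x * (normN2 x * eta x)) <= C0.
  have -> : integral_rV Omega (fun x => layer m x * (normN2 x * eta x)) =
      integral_rV Omega (fun x => cutoff m x * divergence (fun j x => eta x * N j x) x).
    rewrite (cutoff_flux m aetaN); apply: integral_rV_eq => x _; congr (_ * _).
    rewrite /flux /normN2 mulr_suml; apply: eq_bigr => j _; ring.
  apply: le_integral_rV => //.
  - apply: (Ckc_integrable oO (k := 0)); apply: CkcMl => //; exact: Ck_cutoff.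
  - exact: integrable_abse (Ckc_integrable oO adivN).
  - move=> x Ox; apply: le_trans (ler_norm _) _.
    by rewrite normrM ler_piMl// ger0_norm ?cutoff_ge0// cutoff_le1.
have C1ge0 : 0 <= integral_rV Omega eta by apply: integral_rV_ge0.
set C1 := integral_rV Omega eta in C1ge0.
have lim2 : integral_rV Omega (fun x => cutoff m x * divergence F x) @[m --> \oo] --> (0 : R).
  apply/cvgr0Pnorm_le => e e0.
  have [d d0 H1] : exists2 d, 0 < d & d * C0 <= e / 2.
    exists (e / (2 * (C0 + 1))); first by rewrite divr_gt0// mulr_gt0// ltr_wpDl.
    have C0p : 0 < C0 + 1 by rewrite ltr_wpDl.
    rewrite (_ : _ * C0 = e / 2 * (C0 / (C0 + 1))); last by field; rewrite gt_eqF.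
    by rewrite ler_piMr ?ler_pdivrMr ?mul1r ?lerDl// divr_ge0// ltW.
  (* The part of the flux near the boundary is at most [d * C0], the rest is
     of order [1 / m]. *)
  have [B HB] := flux_small d0 cK (Ck_trace cfl) F0 eta_cont eta0 eta_ge0.
  have bound m : `|integral_rV Omega (fun x => layer m x * flux F x)| <=
      d * C0 + 5 * `|B| / m.+1%:R * C1.
    pose G x := d * (layer m x * (normN2 x * eta x)) + 5 * `|B| / m.+1%:R * eta x.
    have IP := Ckc_integrable oO (CkcZ oO d (aP m)).
    have Ieta := Ckc_integrable oO (CkcZ oO (5 * `|B| / m.+1%:R) aeta).
    have alf : Ckc Omega 0 (fun x => layer m x * flux F x).
      by apply: CkcMl => //; exact: Ck_layer.
    apply: (@le_trans _ _ (integral_rV Omega G)).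
      have IG : integrable_rV Omega G := integrable_rVD oO IP Ieta.
      apply: (le_norm_integral_rV oO (Ckc_integrable oO alf) IG).
      move=> x Ox; rewrite normrM (ger0_norm (layer_ge0 _ _)).
      have [Kx|nKx] := pselect (K x); last first.
        rewrite Kfl// normr0 mulr0 addr_ge0//.
          rewrite mulr_ge0 ?(ltW d0)// mulr_ge0 ?layer_ge0// mulr_ge0//.
          by rewrite sumr_ge0// => j _; exact: sqr_ge0.
        by rewrite mulr_ge0.
      apply: le_trans (ler_wpM2l (layer_ge0 m x) (HB _ Ox Kx)) _.
      rewrite mulrDr mulrCA /G lerD2l.
      rewrite [leLHS](_ : _ = B * (layer m x * rho x ^+ 2) * eta x); last by ring.
      rewrite ler_wpM2r//.
      have := layer_rho2 m x; have : 0 <= layer m x * rho x ^+ 2.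
        by rewrite mulr_ge0 ?layer_ge0// sqr_ge0.
      move: (layer m x * _) => y y0 y5; rewrite -mulrA mulrCA.
      apply: le_trans (ler_wpM2r y0 (ler_norm B)) _.
      exact: ler_wpM2l.
    rewrite /G integral_rVD// (integral_rVZ oO d (Ckc_integrable oO (aP m))).
    rewrite (integral_rVZ oO _ (Ckc_integrable oO aeta)).
    by rewrite lerD2r ler_wpM2l ?(ltW d0).
  near=> m; rewrite cutoff_flux//; apply: le_trans (bound m) _.
  have H2 : 5 * `|B| / m.+1%:R * C1 <= e / 2.
    have : (5 * `|B| * C1) / (e / 2) <= m%:R by near: m; exact: nbhs_infty_ger.
    rewrite ler_pdivrMr ?divr_gt0// => H.
    rewrite mulrAC ler_pdivrMr ?ltr0n// [leRHS]mulrC.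
    by apply: le_trans H _; rewrite ler_wpM2r ?ler_nat// ltW// divr_gt0.
  by rewrite [leRHS](_ : e = e / 2 + e / 2); [exact: lerD|field].
exact: (cvg_unique _ lim1 lim2).
Unshelve. all: by end_near. Qed.

End smooth_domain.

(** * The pairing of a gradient with a field *)

Section W1.
Variables (R : realType) (n : nat) (Omega : set 'rV[R]_n).
Hypothesis oO : open Omega.
Implicit Types (f g u v : 'rV[R]_n -> R).

Definition W1_dot f g : R :=
  integral_rV Omega (fun x => f x * g x) +
  \sum_j integral_rV Omega (fun x => partial j f x * partial j g x).

(** The quadratic polynomial [t |-> |u - t v|^2] is nonnegative. *)
Lemma cauchy_schwarz u v : Ckc Omega 0 u -> Ckc Omega 0 v ->
  `|integral_rV Omega (fun x => u x * v x)| <=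
  Num.sqrt (integral_rV Omega (fun x => u x * u x)) *
  Num.sqrt (integral_rV Omega (fun x => v x * v x)).
Proof.
move=> au av.
have auv := CkcMr oO au (Ckc_Ck av).
have auu := CkcMr oO au (Ckc_Ck au).
have avv := CkcMr oO av (Ckc_Ck av).
set A := integral_rV Omega (fun x => u x * u x).
set B := integral_rV Omega _; set D := integral_rV Omega (fun x => v x * v x).
have A0 : 0 <= A by apply: integral_rV_ge0 => x _; exact: sqr_ge0.
have D0 : 0 <= D by apply: integral_rV_ge0 => x _; exact: sqr_ge0.
have H t : 0 <= A + (- (2 * t) * B + t ^+ 2 * D).
  rewrite /A /B /D -(integral_rVZ oO _ (Ckc_integrable oO auv)).
  rewrite -(integral_rVZ oO _ (Ckc_integrable oO avv)).
  have I1 := Ckc_integrable oO (CkcZ oO (- (2 * t)) auv).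
  have I2 := Ckc_integrable oO (CkcZ oO (t ^+ 2) avv).
  rewrite -(integral_rVD oO I1 I2).
  rewrite -(integral_rVD oO (Ckc_integrable oO auu) (integrable_rVD oO I1 I2)).
  apply: integral_rV_ge0 => x _.
  rewrite (_ : _ + _ = (u x - t * v x) ^+ 2); first exact: sqr_ge0.
  by ring.
suff BAD : B ^+ 2 <= A * D.
  by rewrite -sqrtrM// -sqrtr_sqr ler_wsqrtr.
have [D00|Dn0] := eqVneq D 0.
  rewrite D00 mulr0; have [->|B0] := eqVneq B 0; first by rewrite expr0n.
  have := H ((A + 1) / (2 * B)); rewrite D00 mulr0 addr0.
  rewrite (_ : - _ * B = - (A + 1)); last by field.
  by lra.
have Dp : 0 < D by rewrite lt_neqAle eq_sym Dn0.
have := H (B / D); rewrite (_ : A + _ = (A * D - B ^+ 2) / D); last by field.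
by rewrite pmulr_lge0 ?invr_gt0// subr_ge0.
Qed.

Lemma le_partial_W1 f j : Ckc Omega 1 f ->
  integral_rV Omega (fun x => partial j f x * partial j f x) <= W1_dot f f.
Proof.
move=> af; rewrite /W1_dot (bigD1 j)//= addrCA lerDl addr_ge0//.
  by apply: integral_rV_ge0 => x _; exact: sqr_ge0.
by apply: sumr_ge0 => k _; apply: integral_rV_ge0 => x _; exact: sqr_ge0.
Qed.

Lemma divergenceB (F G : 'I_n -> 'rV[R]_n -> R) x : (forall j, Ck Omega 1 (F j)) ->
  (forall j, Ck Omega 1 (G j)) -> Omega x ->
  divergence (fun j y => F j y - G j y) x = divergence F x - divergence G x.
Proof.
move=> cF cG Ox; rewrite /divergence -sumrB; apply: eq_bigr => j _.
exact: (partialB j (cF j) (cG j) Ox).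
Qed.

(** The second derivatives of [f], being symmetric, cancel against the
   antisymmetric coefficients. *)
Lemma divergence_antisym (A : 'I_n -> 'I_n -> 'rV[R]_n -> R) f x :
  (forall k l, Ck Omega 1 (A k l)) -> (forall k l y, A k l y = - A l k y) ->
  Ck Omega 2 f -> Omega x ->
  divergence (fun l y => \sum_k A k l y * partial k f y) x =
  \sum_k partial k f x * \sum_l partial l (A k l) x.
Proof.
move=> cA antiA cf Ox.
have E l : partial l (fun y => \sum_k A k l y * partial k f y) x =
    \sum_k (A k l x * partial l (partial k f) x + partial k f x * partial l (A k l) x).
  rewrite (partial_sum oO _ (k := 0)) => // [|k _]; last first.
    by apply: (CkM oO) => //; exact: Ck_partial.
  apply: eq_bigr => k _; exact: (partialM l (cA k l) (Ck_partial k cf)).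
rewrite /divergence (eq_bigr _ (fun l _ => E l)).
under eq_bigr do rewrite big_split/=.
rewrite big_split/= [X in X + _](_ : _ = 0).
  rewrite add0r exchange_big/=; apply: eq_bigr => k _; by rewrite mulr_sumr.
set S := \sum_l _.
have : S = - S.
  rewrite {1}/S exchange_big/= -sumrN; apply: eq_bigr => k _.
  rewrite -sumrN; apply: eq_bigr => l _.
  by rewrite antiA mulNr (partialC oO _ _ cf Ox).
by move=> SE; lra.
Qed.

End W1.

Section normal_trace.
Variables (R : realType) (n : nat) (Omega : set 'rV[R]_n) (rho : 'rV[R]_n -> R).
Hypothesis drho : defining_function Omega rho.
Implicit Types (p x : 'rV[R]_n) (f g : 'rV[R]_n -> R) (b : 'I_n -> 'rV[R]_n -> R).

Let oO := defining_open drho.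
Let srho : smooth rho. Proof. by case: drho. Qed.
Let OE : Omega = [set x | rho x < 0]. Proof. by case: drho. Qed.
Local Notation N j := (partial j rho).
Let cN k j : Ck Omega k (N j) := Ck_N drho k j.

(** Equal to [|N|^-2] on the boundary. The term [rho ^ 2] keeps the
   denominator positive inside, where the gradient of [rho] may vanish. *)
Definition inv_normN2 x : R := (normN2 rho x + rho x ^+ 2)^-1.

Lemma normN2_rho2_gt0 p : closure Omega p -> 0 < normN2 rho p + rho p ^+ 2.
Proof.
move=> cp; have N0 : 0 <= normN2 rho p by apply: sumr_ge0 => j _; exact: sqr_ge0.
have [p0|p0] := eqVneq (rho p) 0.
  by rewrite ltr_wpDr ?sqr_ge0// (normN2_gt0 drho)//; exact: (rho_bdry drho).
by rewrite ltr_wpDl// exprn_even_gt0.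
Qed.

Lemma Ck_inv_normN2 k : Ck Omega k inv_normN2.
Proof.
have cD m : Ck Omega m (fun x => normN2 rho x + rho x ^+ 2).
  by apply: (CkD oO); [exact: Ck_normN2|apply: (CkX oO); exact: Ck_rho].
apply: (CkV oO (cD k)) => p cp.
rewrite (trace_lim cp (l := normN2 rho p + rho p ^+ 2)) ?gt_eqF ?normN2_rho2_gt0//.
apply: cvg_within_filter.
have cn := @normN2_continuous _ _ _ _ drho p; have cr := @rho_continuous _ _ _ _ drho p.
exact: cvgD cn (cvgM cr cr).
Qed.

Definition normal_derivative b k x : R := \sum_j N j x * partial j (b k) x.
(** The contraction of the normal derivative of [b] with the normal, for the
   unnormalized normal. *)
Definition normal_component b x : R := \sum_k N k x * normal_derivative b k x.

(** The [W^1] product of the gradient of [f] with [b]. *)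
Definition W1_pairing f b : R := \sum_k W1_dot Omega (partial k f) (b k).

Section pairing.
Variable b : 'I_n -> 'rV[R]_n -> R.
Hypothesis ab : forall k, Ckc Omega 2 (b k).
Local Notation w := (normal_derivative b).
Local Notation c := (normal_component b).
Local Notation s := inv_normN2.

Lemma Ckc_normal_derivative k : Ckc Omega 1 (w k).
Proof.
apply: (Ckc_sum oO) => j; apply: (CkcMl oO); first exact: cN.
exact: (Ckc_partial oO).
Qed.

Lemma Ckc_normal_component : Ckc Omega 1 c.
Proof.
by apply: (Ckc_sum oO) => j; apply: (CkcMl oO); [exact: cN|exact: Ckc_normal_derivative].
Qed.

(** On the boundary, [sum_l N_l * A k l] is the tangential part of [w]. *)
Definition antisym_coef k l x : R := (w k x * N l x - N k x * w l x) * s x.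
Local Notation A := antisym_coef.

Lemma Ckc_antisym_coef k l : Ckc Omega 1 (A k l).
Proof.
apply: (CkcMr oO); last exact: Ck_inv_normN2.
apply: (CkcB oO).
  by apply: (CkcMr oO); [exact: Ckc_normal_derivative|exact: cN].
by apply: (CkcMl oO); [exact: cN|exact: Ckc_normal_derivative].
Qed.

(** What multiplies [partial k f] in the pairing once the second derivatives
   of [f] have been collected into divergences. *)
Definition lower_order k x : R :=
  b k x - \sum_j partial j (partial j (b k)) x + \sum_l partial l (A k l) x.

Lemma Ckc_lower_order k : Ckc Omega 0 (lower_order k).
Proof.
apply: (CkcD oO); last first.
  by apply: (Ckc_sum oO) => l; apply: (Ckc_partial oO); exact: Ckc_antisym_coef.
apply: (CkcB oO); first exact/(CkcS (CkcS (ab k))).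
by apply: (Ckc_sum oO) => l; do 2 apply: (Ckc_partial oO).
Qed.

Variable f : 'rV[R]_n -> R.
Hypothesis af : Ckc Omega 2 f.

Let aDf k : Ckc Omega 1 (partial k f). Proof. exact: Ckc_partial. Qed.

Let F j x := \sum_k partial k f x * partial j (b k) x.
Let G l x := \sum_k A k l x * partial k f x.
Let H l x := c x * s x * partial l f x.

Let aF j : Ckc Omega 1 (F j).
Proof.
apply: (Ckc_sum oO) => k; apply: (CkcMr oO); first exact: aDf.
exact: Ckc_Ck (Ckc_partial oO _ _).
Qed.

Let aG j : Ckc Omega 1 (G j).
Proof.
apply: (Ckc_sum oO) => k; apply: (CkcMr oO); first exact: Ckc_antisym_coef.
exact: Ckc_Ck (aDf k).
Qed.

Let aH j : Ckc Omega 1 (H j).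
Proof.
apply: (CkcMl oO) => //; apply: (CkM oO); last exact: Ck_inv_normN2.
exact: Ckc_Ck Ckc_normal_component.
Qed.

(** The fields [F] and [G + H] have the normal components [w . grad f] and
   [|N|^2 * s * (w . grad f)], whose difference is a multiple of [1 - |N|^2 *
   s = rho ^ 2 * s]. *)
Lemma flux_tangential p : bdry Omega p ->
  flux rho (fun j x => F j x - G j x - H j x) x @[x --> within Omega (nbhs p)] --> (0 : R).
Proof.
move=> bp; pose g x := (\sum_k partial k f x * w k x) * s x * rho x.
have cg : Ck Omega 1 g.
  apply: (CkM oO); last exact: Ck_rho.
  apply: (CkM oO); last exact: Ck_inv_normN2.
  apply: (Ck_sum oO) => k _; apply: (CkM oO); first exact: Ckc_Ck (aDf k).
  exact: Ckc_Ck (Ckc_normal_derivative k).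
apply: (cvg_mul_rho drho bp (Ck_trace cg)) => x Ox.
have FE : \sum_j N j x * F j x = \sum_k partial k f x * w k x.
  rewrite /F; under eq_bigr do rewrite mulr_sumr.
  rewrite exchange_big/=; apply: eq_bigr => k _.
  by rewrite /normal_derivative mulr_sumr; apply: eq_bigr => j _; ring.
have GE : \sum_j N j x * G j x = (\sum_k partial k f x * w k x) * normN2 rho x * s x
    - c x * s x * \sum_k N k x * partial k f x.
  transitivity (\sum_j \sum_k (partial k f x * w k x * s x * N j x ^+ 2 -
      N j x * w j x * (s x * (N k x * partial k f x)))).
    apply: eq_bigr => j _; rewrite /G mulr_sumr; apply: eq_bigr => k _.
    by rewrite /A; ring.
  under eq_bigr do rewrite sumrB.
  rewrite sumrB; congr (_ - _).
    rewrite exchange_big/= -mulrA [normN2 rho x * _]mulrC mulrA mulr_suml mulr_suml.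
    apply: eq_bigr => k _; by rewrite /normN2 mulr_sumr.
  under eq_bigr do rewrite -mulr_sumr.
  by rewrite -mulr_suml -mulr_sumr mulrA.
have HE : \sum_j N j x * H j x = c x * s x * \sum_k N k x * partial k f x.
  by rewrite mulr_sumr; apply: eq_bigr => j _; rewrite /H; ring.
rewrite /flux; under eq_bigr do rewrite !mulrBr.
rewrite !sumrB FE GE HE /g.
have d0 := normN2_rho2_gt0 (subset_closure Ox).
have -> : s x = (normN2 rho x + rho x ^+ 2)^-1 by [].
move: d0; move: (\sum_k partial k f x * w k x) (\sum_k N k x * partial k f x).
move: (normN2 rho x) (c x) (rho x) => a1 a2 a3 a4 a5 d0.
by field; rewrite gt_eqF.
Qed.

Lemma W1_pairingE : W1_pairing f b =
  \sum_k integral_rV Omega (fun x => partial k f x * lower_order k x) +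
  integral_rV Omega (divergence (fun l x => c x * s x * partial l f x)).
Proof.
have aD1 k : Ckc Omega 0 (fun x => partial k f x * b k x).
  by apply: (CkcMr oO); [exact: CkcS (aDf k)|exact: Ckc_Ck (CkcS (CkcS (ab k)))].
have aD2 k j : Ckc Omega 0 (fun x => partial j (partial k f) x * partial j (b k) x).
  apply: (CkcMr oO); first exact: Ckc_partial (aDf k).
  exact: Ckc_Ck (CkcS (Ckc_partial oO j (ab k))).
have aE k : Ckc Omega 0 (fun x => partial k f x * lower_order k x).
  by apply: (CkcMr oO); [exact: CkcS (aDf k)|exact: Ckc_Ck (Ckc_lower_order k)].
have aFGH j : Ckc Omega 1 (fun x => F j x - G j x - H j x).
  by apply: (CkcB oO); [apply: (CkcB oO)|].
have adiv K : (forall j, Ckc Omega 1 (K j)) -> Ckc Omega 0 (divergence K).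
  by move=> aK; apply: (Ckc_sum oO) => j; exact: (Ckc_partial oO).
have L : W1_pairing f b = integral_rV Omega (fun x => \sum_k (partial k f x * b k x +
    \sum_j partial j (partial k f) x * partial j (b k) x)).
  rewrite integral_rV_sum//; last first.
    move=> k; apply: (Ckc_integrable oO (k := 0)); apply: (CkcD oO); first exact: aD1.
    by apply: (Ckc_sum oO) => j; exact: aD2.
  apply: eq_bigr => k _.
  have aD2s : Ckc Omega 0 (fun x => \sum_j partial j (partial k f) x * partial j (b k) x).
    by apply: (Ckc_sum oO) => j; exact: aD2.
  rewrite (integral_rVD oO (Ckc_integrable oO (aD1 k)) (Ckc_integrable oO aD2s)).
  by rewrite (integral_rV_sum oO _ (fun j => Ckc_integrable oO (aD2 k j))).
have P x : Omega x -> \sum_k (partial k f x * b k x +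
    \sum_j partial j (partial k f) x * partial j (b k) x) =
   \sum_k partial k f x * lower_order k x +
     (divergence (fun j x => F j x - G j x - H j x) x + divergence H x).
  move=> Ox.
  have cFG j := Ckc_Ck (CkcB oO (aF j) (aG j)).
  rewrite (divergenceB cFG (fun j => Ckc_Ck (aH j)) Ox) subrK.
  rewrite (divergenceB (fun j => Ckc_Ck (aF j)) (fun j => Ckc_Ck (aG j)) Ox).
  have cA k l := Ckc_Ck (Ckc_antisym_coef k l).
  have antiA k l y : A k l y = - A l k y by rewrite /A; ring.
  have GE : divergence G x = \sum_k partial k f x * \sum_l partial l (A k l) x.
    exact: (divergence_antisym oO cA antiA (Ckc_Ck af) Ox).
  rewrite GE.
  have -> : divergence F x = \sum_k \sum_j (partial k f x * partial j (partial j (b k)) x +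
      partial j (partial k f) x * partial j (b k) x).
    rewrite exchange_big/=; apply: eq_bigr => j _.
    rewrite (partial_sum oO _ (k := 0)) => // [|k _]; last first.
      apply: (CkM oO); first exact: Ckc_Ck (aDf k).
      exact: Ckc_Ck (Ckc_partial oO j (ab k)).
    apply: eq_bigr => k _.
    rewrite (partialM j (Ckc_Ck (aDf k)) (Ckc_Ck (Ckc_partial oO j (ab k))) Ox).
    by congr (_ + _); rewrite mulrC.
  rewrite -sumrB -big_split/=; apply: eq_bigr => k _.
  rewrite big_split/= -mulr_sumr /lower_order.
  by ring.
have aEs : Ckc Omega 0 (fun x => \sum_k partial k f x * lower_order k x).
  by apply: (Ckc_sum oO) => k; exact: aE.
have IFGH := Ckc_integrable oO (adiv _ aFGH).
have IH := Ckc_integrable oO (adiv _ aH).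
rewrite L (integral_rV_eq P).
rewrite (integral_rVD oO (Ckc_integrable oO aEs) (integrable_rVD oO IFGH IH)).
rewrite (integral_rVD oO IFGH IH).
rewrite (integral_rV_sum oO _ (fun k => Ckc_integrable oO (aE k))).
congr (_ + _).
rewrite (divergence_tangential drho aFGH) ?add0r// => p; exact: flux_tangential.
Qed.

Definition pairing_bound : R :=
  \sum_k Num.sqrt (integral_rV Omega (fun x => lower_order k x * lower_order k x)).

(** The constant depends on [b] only, by the Cauchy-Schwarz inequality. *)
Lemma le_W1_pairing :
  `|W1_pairing f b - integral_rV Omega (divergence (fun l x => c x * s x * partial l f x))| <=
  pairing_bound * Num.sqrt (W1_dot Omega f f).
Proof.
rewrite W1_pairingE addrK; apply: le_trans (ler_norm_sum _ _ _) _.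
rewrite mulr_suml; apply: ler_sum => k _.
apply: le_trans (cauchy_schwarz oO (CkcS (aDf k)) (Ckc_lower_order k)) _.
rewrite mulrC ler_wpM2l ?sqrtr_ge0// ler_wsqrtr//.
exact: le_partial_W1 (CkcS af).
Qed.

End pairing.
End normal_trace.

(** * Necessity and sufficiency of the boundary condition *)

Section positivity.
Variables (R : realType) (n : nat) (Omega : set 'rV[R]_n).
Hypothesis oO : open Omega.

Lemma integral_rV_gt0 (g : 'rV[R]_n -> R) x0 : Ckc Omega 0 g ->
  (forall x, Omega x -> 0 <= g x) -> Omega x0 -> 0 < g x0 ->
  0 < integral_rV Omega g.
Proof.
move=> ag g0 Ox0 gx0.
have c0 : 0 < g x0 / 2 by rewrite divr_gt0.
have [r r0 rb] : exists2 r : R, 0 < r & forall x, ball x0 r x -> Omega x /\ g x0 / 2 <= g x.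
  have n1 : nbhs x0 [set x | g x0 / 2 <= g x].
    have /cvgrPdist_le/(_ _ c0) := Ck_continuous oO (Ckc_Ck ag) Ox0.
    by apply: filterS => x /=; rewrite ler_norml => /andP[? ?]; lra.
  have /nbhs_ballP[r /= r0 rb] : nbhs x0 (Omega `&` [set x | g x0 / 2 <= g x]).
    by apply: filterI; [exact: near_open|].
  by exists r.
pose row := @row_of_tuple R n; pose mu := lebesgue_tuple R n.
have mO : measurable (row @^-1` Omega) by exact: measurable_open.
have mB : measurable (row @^-1` ball x0 r) by exact: measurable_ball.
have Ig := Ckc_integrable oO ag.
rewrite /integral_rV /Rintegral fine_gt0//; apply/andP; split; last exact: integrable_lty Ig.
have mg : measurable_fun (row @^-1` Omega) (EFin \o (g \o row)) by case/integrableP : Ig.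
apply: (@lt_le_trans _ _ (\int[mu]_(t in row @^-1` ball x0 r) (g x0 / 2)%:E)%E).
  rewrite integral_cst// [X in (_ * X)%E](_ : _ = ((2 * r) ^+ n)%:E).
    by rewrite lte_fin mulr_gt0// exprn_gt0// mulr_gt0.
  by rewrite preimage_ball//; exact: lebesgue_tuple_box.
apply: (@le_trans _ _ (\int[mu]_(t in row @^-1` ball x0 r) (g (row t))%:E)%E).
  apply: ge0_le_integral => //.
  - by move=> t _; rewrite lee_fin ltW.
  - by apply: measurable_funS mg => // t /rb[].
  - by move=> t /rb[_ ?]; rewrite lee_fin.
apply: ge0_subset_integral => //.
- by move=> t /g0; rewrite lee_fin.
- by move=> t /rb[].
Qed.

End positivity.

Section boundary_condition.
Variables (R : realType) (n : nat) (Omega : set 'rV[R]_n) (rho : 'rV[R]_n -> R).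
Hypothesis drho : defining_function Omega rho.
Implicit Types (p x : 'rV[R]_n) (f g : 'rV[R]_n -> R).

Let oO := defining_open drho.
Let srho : smooth rho. Proof. by case: drho. Qed.
Let OE : Omega = [set x | rho x < 0]. Proof. by case: drho. Qed.
Local Notation N j := (partial j rho).
Let cN k j : Ck Omega k (N j) := Ck_N drho k j.
Let crho k : Ck Omega k rho := Ck_rho drho k.
Local Notation s := (inv_normN2 rho).

Variable b : 'I_n -> 'rV[R]_n -> R.
Local Notation c := (normal_component rho b).

(** When [c] vanishes on the boundary the field [c * s * grad f] is itself
   tangential. *)
Lemma W1_pairing_bounded : (forall k, Ckc Omega 2 (b k)) ->
  (forall p, bdry Omega p -> c x @[x --> within Omega (nbhs p)] --> (0 : R)) ->
  forall f, Ckc Omega 2 f ->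
  `|W1_pairing Omega f b| <= pairing_bound Omega rho b * Num.sqrt (W1_dot Omega f f).
Proof.
move=> ab c0 f af; have := le_W1_pairing drho ab af.
rewrite (divergence_tangential drho) ?subr0// => [j|p bp].
  apply: (CkcMl oO); last exact: Ckc_partial.
  apply: (CkM oO); last exact: Ck_inv_normN2.
  exact: Ckc_Ck (Ckc_normal_component drho ab).
have [cp _] := bp.
pose g x := s x * \sum_j N j x * partial j f x.
have cg : Ck Omega 1 g.
  apply: (CkM oO); first exact: Ck_inv_normN2.
  apply: (Ck_sum oO) => j _; apply: (CkM oO); first exact: cN.
  exact: Ckc_Ck (Ckc_partial oO j af).
have E x : Omega x -> c x * g x = flux rho (fun l x => c x * s x * partial l f x) x.
  by move=> _; rewrite /g mulrA mulr_sumr; apply: eq_bigr => j _; ring.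
rewrite -(within_near_eq p E) -[X in _ --> X](mul0r (trace Omega g p)).
by apply: cvgM; [exact: c0|exact: has_trace_within (Ck_trace cg) cp].
Qed.

Section necessity.
Hypothesis ab : forall m k, Ckc Omega m (b k).
Variable C : R.
Hypothesis bounded_pairing : forall f, (forall m, Ckc Omega m f) ->
  `|W1_pairing Omega f b| <= C * Num.sqrt (W1_dot Omega f f).

Lemma Ckc_c m : Ckc Omega m c.
Proof.
apply: (Ckc_sum oO) => k; apply: (CkcMl oO); first exact: cN.
apply: (Ckc_sum oO) => j; apply: (CkcMl oO); first exact: cN.
exact: (Ckc_partial oO).
Qed.

(** The factor [damp m] is [1] on the boundary and tends to [0] inside. *)
Definition damp m x : R := (1 - m.+1%:R * rho x)^-1.

Lemma damp_den m x : closure Omega x -> 1 <= 1 - m.+1%:R * rho x.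
Proof.
move=> /(rho_closure drho) rx.
by rewrite lerDl oppr_ge0 mulr_ge0_le0.
Qed.

Lemma Ck_damp k m : Ck Omega k (damp m).
Proof.
have cd i : Ck Omega i (fun x => 1 - m.+1%:R * rho x).
  apply: (CkB oO); first exact: (Ck_cst oO).
  by apply: (CkM oO) => //; exact: (Ck_cst oO).
apply: (CkV oO (cd k)) => p cp.
rewrite (trace_lim cp (l := 1 - m.+1%:R * rho p)).
  by rewrite gt_eqF// (lt_le_trans ltr01)// damp_den.
apply: cvg_within_filter; have cr := rho_continuous drho (x := p).
exact: cvgB (cvg_cst _) (cvgM (cvg_cst _) cr).
Qed.

(** Zero on the boundary with gradient [N] there, whatever [m]; yet its [W^1]
   norm on compact sets tends to zero ([partial_profile], [profile_bound]). *)
Definition profile m x : R := rho x * damp m x.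

Lemma Ck_profile k m : Ck Omega k (profile m).
Proof. by apply: (CkM oO); [exact: crho|exact: Ck_damp]. Qed.

Lemma damp_gt0 m x : Omega x -> 0 < damp m x.
Proof.
move=> Ox; rewrite invr_gt0; apply: lt_le_trans ltr01 _.
by apply: damp_den; exact: subset_closure.
Qed.

Lemma damp_le1 m x : Omega x -> damp m x <= 1.
Proof.
move=> Ox; have := damp_den m (subset_closure Ox) => d1.
by rewrite invf_le1// (lt_le_trans ltr01).
Qed.

Lemma dampE m x : Omega x -> damp m x = 1 + m.+1%:R * rho x * damp m x.
Proof.
move=> Ox; have d1 := damp_den m (subset_closure Ox).
have : 1 - m.+1%:R * rho x != 0 by rewrite gt_eqF// (lt_le_trans ltr01).
by rewrite /damp; move: (_%:R * _) => a a0; field.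
Qed.

Lemma partial_profile m j x : Omega x -> partial j (profile m) x = damp m x ^+ 2 * N j x.
Proof.
move=> Ox.
have cd : Ck Omega 1 (fun x => m.+1%:R * rho x).
  by apply: (CkM oO) => //; exact: (Ck_cst oO).
have cd' : Ck Omega 1 (fun x => 1 - m.+1%:R * rho x).
  exact: (CkB oO (Ck_cst oO 1 1) cd).
have d0 : 1 - m.+1%:R * rho x != 0.
  by rewrite gt_eqF// (lt_le_trans ltr01)// damp_den//; exact: subset_closure.
have Ed : partial j (damp m) x = damp m x ^+ 2 * (m.+1%:R * N j x).
  rewrite /partial deriveV//; last exact: (Ck_derivable cd' Ox).
  rewrite -[X in _ *: X]/(partial j (fun x => 1 - m.+1%:R * rho x) x).
  rewrite (partialB j (Ck_cst oO 1 1) cd Ox) [partial j (fun=> 1) x]derive_cst sub0r.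
  rewrite (partialZ oO _ j (crho 1) Ox) /damp -exprVn /GRing.scale/=.
  by rewrite mulrNN.
rewrite (partialM j (crho 1) (Ck_damp 1 m) Ox) Ed.
have := dampE m Ox; move: (damp m x) (N j x) (rho x) (m.+1%:R) => d N' r k E.
have E2 : d * d = d + k * r * d * d by rewrite {1}E; ring.
by rewrite expr2 [in RHS]E2; ring.
Qed.

Lemma profile_bound m x : Omega x -> `|profile m x| <= m.+1%:R^-1.
Proof.
move=> Ox; have d0 := damp_gt0 m Ox; have rx : rho x < 0 by move: Ox; rewrite OE.
rewrite /profile normrM (gtr0_norm d0) (ltr0_norm rx) mulNr.
rewrite -(ler_pM2l (_ : 0 < m.+1%:R)) ?ltr0n// divff ?pnatr_eq0//.
have E := dampE m Ox; rewrite mulrN mulrA.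
by move: d0; rewrite {1}E; move: (m.+1%:R * rho x * damp m x) => a; lra.
Qed.

Lemma profile_cvg x : Omega x -> profile m x @[m --> \oo] --> (0 : R).
Proof.
move=> Ox; apply/cvgr0Pnorm_le => e e0; near=> m.
apply: le_trans (profile_bound m Ox) _.
have em : e^-1 <= m%:R by near: m; exact: nbhs_infty_ger.
rewrite -[e]invrK lef_pV2 ?posrE ?invr_gt0//.
by apply: le_trans em _; rewrite ler_nat.
Unshelve. all: by end_near. Qed.

Lemma damp_cvg x : Omega x -> damp m x @[m --> \oo] --> (0 : R).
Proof.
move=> Ox; have rx : rho x < 0 by move: Ox; rewrite OE.
have E : (fun m => damp m x) = (fun m => (rho x)^-1 * profile m x).
  by apply/funext => m; rewrite /profile mulKf// lt_eqF.
rewrite E -[X in _ --> X](mulr0 (rho x)^-1); apply: cvgM; first exact: cvg_cst.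
exact: profile_cvg.
Qed.

Section test_forms.
Variable beta : 'rV[R]_n -> R.
Hypothesis abeta : forall m, Ckc Omega m beta.

Let f m x : R := profile m x * beta x.

Let af k m : Ckc Omega k (f m).
Proof. by apply: (CkcMl oO) => //; exact: Ck_profile. Qed.

Let partial_f m j x : Omega x ->
  partial j (f m) x = profile m x * partial j beta x + beta x * (damp m x ^+ 2 * N j x).
Proof.
move=> Ox.
by rewrite (partialM j (Ck_profile 1 m) (Ckc_Ck (abeta 1)) Ox) partial_profile.
Qed.

Lemma W1_test_cvg : W1_dot Omega (f m) (f m) @[m --> \oo] --> (0 : R).
Proof.
have a0 g : Ckc Omega 0 g -> Ckc Omega 0 (fun x => g x * g x).
  by move=> ag; apply: (CkcMr oO) => //; exact: Ckc_Ck.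
have I0 : 0 = integral_rV Omega (fun=> 0 : R) by rewrite (integral_rV0 oO).
rewrite -[X in _ --> X](addr0 0); apply: cvgD.
  rewrite I0; apply: (dominated_cvg_rV oO (g := fun x => beta x * beta x)).
  - by move=> m; apply: (Ck_measurable oO (k := 0)); exact/Ckc_Ck/a0.
  - exact: (Ck_measurable oO (Ck_cst oO 0 0)).
  - exact: (Ckc_integrable oO (a0 _ (abeta 0%N))).
  - move=> m x Ox.
    rewrite ger0_norm ?sqr_ge0// /f mulrACA ler_piMl ?sqr_ge0//.
    rewrite -expr2 -real_normK ?num_real// exprn_ile1//.
    by apply: le_trans (profile_bound m Ox) _; rewrite invf_le1 ?ler1n ?ltr0n.
  - move=> x Ox; rewrite -[X in _ --> X](mulr0 0); apply: cvgM;
      by rewrite -[X in _ --> X](mul0r (beta x)); apply: cvgM;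
        [exact: profile_cvg|exact: cvg_cst].
have Z : \sum_(j < n) (0 : R) = 0 by rewrite big1.
rewrite -[X in _ --> X]Z; apply: cvg_sumr => j; rewrite I0.
pose G x := 2 * (partial j beta x * partial j beta x) +
            2 * ((beta x * N j x) * (beta x * N j x)).
have aDb : Ckc Omega 0 (partial j beta) by exact: (Ckc_partial oO).
have abN : Ckc Omega 0 (fun x => beta x * N j x).
  by apply: (CkcMr oO) => //; exact: cN.
apply: (dominated_cvg_rV oO (g := G)).
- move=> m; apply: (Ck_measurable oO (k := 0)); apply/Ckc_Ck/a0.
  exact: (Ckc_partial oO).
- exact: (Ck_measurable oO (Ck_cst oO 0 0)).
- apply: (Ckc_integrable oO (k := 0)); apply: (CkcD oO); apply: (CkcZ oO); exact: a0.
- move=> m x Ox; rewrite ger0_norm ?sqr_ge0// partial_f//.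
  have p1 : `|profile m x| <= 1.
    by apply: le_trans (profile_bound m Ox) _; rewrite invf_le1 ?ler1n ?ltr0n.
  have d1 : `|damp m x ^+ 2| <= 1.
    rewrite normrX exprn_ile1// ger0_norm ?damp_le1// ltW//; exact: damp_gt0.
  rewrite (_ : _ + _ = profile m x * partial j beta x + damp m x ^+ 2 * (beta x * N j x)); last by ring.
  rewrite /G; move: p1 d1; move: (profile m x) (damp m x ^+ 2) (partial j beta x) (beta x * N j x).
  move=> u v y z; rewrite !ler_norml => /andP[u1 u2] /andP[v1 v2].
  have hu : 0 <= (1 - u ^+ 2) * y ^+ 2 by rewrite mulr_ge0 ?sqr_ge0//; nra.
  have hv : 0 <= (1 - v ^+ 2) * z ^+ 2 by rewrite mulr_ge0 ?sqr_ge0//; nra.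
  have := sqr_ge0 (u * y - v * z); nra.
- move=> x Ox.
  have L : partial j (f m) x @[m --> \oo] --> (0 : R).
    have -> : (fun m => partial j (f m) x) = (fun m => profile m x * partial j beta x +
        beta x * (damp m x ^+ 2 * N j x)) by apply/funext => m; rewrite partial_f.
    rewrite -[X in _ --> X](addr0 0); apply: cvgD.
      rewrite -[X in _ --> X](mul0r (partial j beta x)).
      by apply: cvgM; [exact: profile_cvg|exact: cvg_cst].
    rewrite -[X in _ --> X](mulr0 (beta x)); apply: cvgM; first exact: cvg_cst.
    rewrite -[X in _ --> X](mul0r (N j x)); apply: cvgM; last exact: cvg_cst.
    by rewrite -[X in _ --> X](mulr0 0); have Dm := damp_cvg Ox; exact: (cvgM Dm Dm).
  by rewrite -[X in _ --> X](mulr0 0); apply: cvgM.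
Qed.

Let V l x := c x * s x * (beta x * N l x).

Let ccs k : Ck Omega k (fun x => c x * s x).
Proof.
by apply: (CkM oO); [exact: Ckc_Ck (Ckc_c k)|exact: Ck_inv_normN2].
Qed.

Let aV l : Ckc Omega 1 (V l).
Proof.
by apply: (CkcMl oO) => //; apply: (CkcMr oO) => //; exact: cN.
Qed.

Let divergence_test m : integral_rV Omega (divergence (fun l x => c x * s x * partial l (f m) x)) =
  integral_rV Omega (divergence V).
Proof.
have aW l : Ckc Omega 1 (fun x => c x * s x * partial l (f m) x).
  by apply: (CkcMl oO) => //; exact: (Ckc_partial oO).
have adiv K : (forall j, Ckc Omega 1 (K j)) -> Ckc Omega 0 (divergence K).
  by move=> aK; apply: (Ckc_sum oO) => j; exact: (Ckc_partial oO).
apply/eqP; rewrite -subr_eq0.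
rewrite -(integral_rVB oO (Ckc_integrable oO (adiv _ aW)) (Ckc_integrable oO (adiv _ aV))).
rewrite (integral_rV_eq (fun x Ox => esym (divergenceB (fun l => Ckc_Ck (aW l)) (fun l => Ckc_Ck (aV l)) Ox))).
apply/eqP/(divergence_tangential drho) => [l|p bp]; first exact: (CkcB oO).
pose g x := c x * s x * (m.+1%:R * (damp m x * (damp m x + 1)) * (beta x * normN2 rho x) +
  damp m x * \sum_j N j x * partial j beta x).
apply: (cvg_mul_rho drho bp (g := g)).
  apply: (@Ck_trace _ _ _ 0); apply: (CkM oO) => //; apply: (CkD oO).
    apply: (CkM oO); last by apply: (CkM oO); [exact/Ckc_Ck|exact: Ck_normN2].
    apply: (CkM oO); first exact: (Ck_cst oO).
    apply: (CkM oO); first exact: Ck_damp.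
    by apply: (CkD oO); [exact: Ck_damp|exact: (Ck_cst oO)].
  apply: (CkM oO); first exact: Ck_damp.
  apply: (Ck_sum oO) => j _; apply: (CkM oO); first exact: cN.
  exact: Ck_partial (Ckc_Ck (abeta 1)).
move=> x Ox; rewrite /flux.
rewrite (eq_bigr (fun j => c x * s x * (damp m x ^+ 2 - 1) * beta x * N j x ^+ 2 +
   c x * s x * profile m x * (N j x * partial j beta x))) => [|j _]; last first.
  by rewrite partial_f// /V; ring.
rewrite big_split/= -!mulr_sumr -/(normN2 rho x) /g /profile.
have E : damp m x ^+ 2 - 1 = m.+1%:R * rho x * damp m x * (damp m x + 1).
  by rewrite -[m.+1%:R * rho x * damp m x](addKr 1) -(dampE m Ox); ring.
rewrite E; ring.
Qed.

(** The test functions [profile m * beta] all give this integral, by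
   [divergence_tangential], while their [W^1] norms tend to zero. *)
Lemma flux_independent : integral_rV Omega (divergence V) = 0.
Proof.
have ab2 k : Ckc Omega 2 (b k) by exact: ab.
pose B := C + pairing_bound Omega rho b.
pose W m := W1_dot Omega (f m) (f m).
have W0 m : 0 <= W m.
  rewrite addr_ge0//; first by apply: integral_rV_ge0 => x _; exact: sqr_ge0.
  by apply: sumr_ge0 => k _; apply: integral_rV_ge0 => x _; exact: sqr_ge0.
have H m : integral_rV Omega (divergence V) ^+ 2 <= B ^+ 2 * W m.
  have H1 := bounded_pairing (fun k => af k m).
  have H2 := le_W1_pairing drho ab2 (af 2 m).
  have H0 : `|integral_rV Omega (divergence V)| <= B * Num.sqrt (W m).
    rewrite -(divergence_test m) /B mulrDl.
    set L := integral_rV _ _; set P := W1_pairing Omega (f m) b in H1 H2.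
    rewrite -[L](subKr P); apply: le_trans (ler_normB _ _) _.
    exact: lerD H1 H2.
  rewrite -real_normK ?num_real// -[W m]sqr_sqrtr// -exprMn.
  by rewrite lerXn2r ?nnegrE//; apply: le_trans H0.
have lim : B ^+ 2 * W m @[m --> \oo] --> (0 : R).
  by rewrite -[X in _ --> X](mulr0 (B ^+ 2)); apply: cvgM; [exact: cvg_cst|exact: W1_test_cvg].
have : integral_rV Omega (divergence V) ^+ 2 <= 0.
  rewrite -(cvg_lim _ lim)//; apply: limr_ge; first by apply/cvg_ex; exists 0.
  exact: nearW.
by rewrite real_exprn_even_le0 ?num_real//= => /eqP.
Qed.

End test_forms.

(** Otherwise [flux_independent] fails for [beta = c * zeta] with [zeta = flat
   0 (t + rho - |x - p|^2)] and [t] small: the support of [zeta] in the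
   closure shrinks to [p] with [t], and there the derivative of [zeta] along
   the normal dominates [zeta] itself, because [flat 0] vanishes to infinite
   order. *)
Theorem normal_component_eq0 p : bdry Omega p -> trace Omega c p = 0.
Proof.
move=> bp; have [cp _] := bp; apply/eqP; apply/negPn/negP => c0.
have ac := Ckc_c; have tc := Ck_trace (Ckc_Ck (ac 0%N)).
pose q x := c x * s x * c x.
pose V l x := q x * N l x.
have cq k : Ck Omega k q.
  apply: (CkM oO); last exact: Ckc_Ck.
  by apply: (CkM oO); [exact: Ckc_Ck|exact: Ck_inv_normN2].
have cV l : Ck Omega 1 (V l) by apply: (CkM oO); [exact: cq|exact: cN].
have cdV : Ck Omega 0 (divergence V) by apply: (Ck_sum oO) => l _; exact: Ck_partial.
have tq : 0 < trace Omega q p.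
  have ts := Ck_trace (Ck_inv_normN2 drho 0).
  rewrite (trace_lim cp (l := trace Omega c p * trace Omega s p * trace Omega c p)); last first.
    apply: cvgM; last exact: has_trace_within.
    by apply: cvgM; exact: has_trace_within.
  have -> : trace Omega s p = (normN2 rho p + rho p ^+ 2)^-1.
    apply: (trace_lim cp); apply: cvg_within_filter; apply: cvgV.
      by have := normN2_rho2_gt0 drho cp; rewrite lt0r => /andP[].
    have cn := normN2_continuous drho (x := p); have cr := rho_continuous drho (x := p).
    exact: cvgD cn (cvgM cr cr).
  rewrite mulrAC -expr2 mulr_gt0 ?invr_gt0 ?(normN2_rho2_gt0 drho cp)//.
  by rewrite exprn_even_gt0.
pose d := trace Omega q p / 2.
pose h x := \sum_l N l x * (N l x - 2 * (x 0 l - p 0 l)).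
have ch : Ck setT 0 h.
  apply: (Ck_sum openT) => l _; apply: (CkM openT).
    exact: (Ck_partial l (smooth_Ck 1 srho)).
  apply: (CkB openT); first exact: (Ck_partial l (smooth_Ck 1 srho)).
  apply: (CkM openT); first exact: (Ck_cst openT).
  by apply: (CkB openT); [exact: Ck_coord|exact: (Ck_cst openT)].
have hp : h p = normN2 rho p.
  by apply: eq_bigr => l _; rewrite subrr mulr0 subr0.
have Np := normN2_gt0 drho bp.
pose mu := normN2 rho p / 2.
have d0 : 0 < d by rewrite divr_gt0.
have mu0 : 0 < mu by rewrite divr_gt0.
pose M := `|trace Omega (divergence V) p| + 1.
have M0 : 0 < M by rewrite ltr_wpDl.
(* Three estimates on a ball around p: c ^ 2 * s and the normal derivative
   of the argument of zeta are bounded below, div (c ^ 2 * s * N) is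
   bounded. *)
have [r r0 rb] : exists2 r : R, 0 < r & forall x, ball p r x -> Omega x ->
    [/\ d <= q x, `|divergence V x| <= M & mu <= h x].
  have n1 : \forall x \near p, Omega x -> d <= q x.
    have /cvgrPdist_le/(_ _ d0) := has_trace_within (Ck_trace (cq 0%N)) cp.
    rewrite near_withinE; apply: filterS => x H /H.
    by rewrite ler_norml /d => /andP[? ?]; lra.
  have n2 : \forall x \near p, Omega x -> `|divergence V x| <= M.
    have /cvgrPdist_le/(_ _ ltr01) := has_trace_within (Ck_trace cdV) cp.
    rewrite near_withinE; apply: filterS => x H /H; rewrite distrC => H1.
    by rewrite /M -lerBlDl; apply: le_trans H1; exact: lerB_dist.
  have n3 : \forall x \near p, mu <= h x.
    have /cvgrPdist_le/(_ _ mu0) := Ck_continuous openT ch (x := p) I.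
    by apply: filterS => x; rewrite hp ler_norml /mu => /andP[? ?]; lra.
  have /nbhs_ballP[r /= r0 rb] : nbhs p [set x | (Omega x -> d <= q x) /\
      ((Omega x -> `|divergence V x| <= M) /\ mu <= h x)].
    exact: filterI n1 (filterI n2 n3).
  by exists r => // x /rb[H1 [H2 H3]] Ox; split => //; [exact: H1|exact: H2].
(* The support of zeta lies in the ball as soon as t <= r ^ 2; where the
   argument of zeta is positive it is at most t, so the last two conditions
   make its square times M smaller than d * mu. *)
have [t [t0 tr t1 tM]] : exists t : R, [/\ 0 < t, t <= r ^+ 2, t <= 1 & t * M < d * mu].
  exists (Num.min (r ^+ 2) (Num.min 1 (d * mu / (M + 1)))).
  have X0 : 0 < d * mu / (M + 1) by rewrite divr_gt0 ?mulr_gt0// addr_gt0.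
  split; rewrite ?ge_min ?lexx ?orbT//; first by rewrite !lt_min X0 ltr01 exprn_gt0.
  apply: (@le_lt_trans _ _ (d * mu / (M + 1) * M)).
    by rewrite ler_wpM2r ?(ltW M0)// !ge_min lexx !orbT.
  have aux (y z : R) : 0 < y -> 0 < z -> y / (z + 1) * z < y.
    move=> y0 z0; rewrite mulrAC ltr_pdivrMr ?addr_gt0//.
    by rewrite mulrDr mulr1 ltrDl.
  by apply: aux => //; rewrite mulr_gt0.
pose arg x := t + rho x - sqr_dist p x.
have carg D k : open D -> Ck D k arg.
  move=> oD; apply: (CkB oD); last exact: Ck_sqr_dist.
  apply: (CkD oD); first exact: (Ck_cst oD).
  exact/Ck_subset/smooth_Ck.
pose zeta x := flat 0 (arg x).
have czeta k : Ck Omega k zeta by apply: (Ck_flat oO); exact: carg.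
have abeta k : Ckc Omega k (fun x => c x * zeta x) by exact: (CkcMr oO (ac k) (czeta k)).
have := flux_independent abeta.
pose W l x := c x * s x * (c x * zeta x * N l x).
rewrite -/(divergence W) => L0.
have aW l : Ckc Omega 1 (W l).
  apply: (CkcMl oO); last by apply: (CkcMr oO) => //; exact: cN.
  by apply: (CkM oO); [exact: Ckc_Ck|exact: Ck_inv_normN2].
have adW : Ckc Omega 0 (divergence W).
  by apply: (Ckc_sum oO) => l; exact: (Ckc_partial oO).
(* flat 0 is the square of its argument times flat 2, the derivative of flat
   0. *)
have dW x : Omega x -> divergence W x =
    flat 2 (arg x) * (q x * h x + arg x ^+ 2 * divergence V x).
  move=> Ox.
  have E l : partial l (W l) x = V l x * (flat 2 (arg x) * (N l x - 2 * (x 0 l - p 0 l)))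
      + zeta x * partial l (V l) x.
    have -> : W l = (fun y => V l y * zeta y).
      by apply/funext => y; rewrite /W /V /q; ring.
    rewrite (partialM l (cV l) (czeta 1%N) Ox); congr (_ * _ + _).
    rewrite (partial_flat 0 l (carg Omega 1%N oO) Ox) oppr0 mul0r add0r; congr (_ * _).
    have c1 : Ck Omega 1 (fun x => t + rho x).
      by apply: (CkD oO); [exact: (Ck_cst oO)|exact: crho].
    rewrite (partialB l c1 (Ck_sqr_dist 1 p oO) Ox) partial_sqr_dist.
    by rewrite (partialD l (Ck_cst oO 1 t) (crho 1) Ox) [partial l (fun=> t) x]derive_cst add0r.
  rewrite /divergence (eq_bigr _ (fun l _ => E l)) big_split/= -mulr_sumr.
  rewrite /zeta [flat 0 _]flatS [flat 1 _]flatS mulrDr; congr (_ + _); last by ring.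
  rewrite /h !mulr_sumr; apply: eq_bigr => l _; rewrite /V; ring.
have small x : Omega x -> 0 < arg x -> ball p r x /\ arg x ^+ 2 <= t.
  move=> Ox ax; have rx : rho x < 0 by move: Ox; rewrite OE.
  have sx : sqr_dist p x < t by move: ax; rewrite /arg; move: rx; lra.
  have s0 : 0 <= sqr_dist p x by apply: sumr_ge0 => i _; exact: sqr_ge0.
  split.
    split => // i j; rewrite !ord1 -ball_normE/= distrC.
    have := le_lt_trans (coord_sqr_dist p x j) (lt_le_trans sx tr).
    by rewrite -[X in X < _]real_normK ?num_real// ltr_sqr ?nnegrE// ltW.
  have ale : arg x <= t by rewrite /arg; lra.
  apply: (@le_trans _ _ (t * t)); first by rewrite expr2 ler_pM// ltW.
  by rewrite ler_piMl// ltW.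
have pos x : Omega x -> 0 < arg x -> 0 < divergence W x.
  move=> Ox ax; rewrite dW// mulr_gt0 ?flat_gt0//.
  have [bx at2] := small x Ox ax; have [H1 H2 H3] := rb x bx Ox.
  have H4 : d * mu <= q x * h x by rewrite ler_pM// ltW.
  have H5 : - (t * M) <= arg x ^+ 2 * divergence V x.
    have : `|arg x ^+ 2 * divergence V x| <= t * M.
      by rewrite normrM ger0_norm ?sqr_ge0// ler_pM ?sqr_ge0.
    by rewrite ler_norml => /andP[].
  by move: H4 H5 tM; move: (q x * h x) (_ * divergence V x) (t * M) (d * mu) => *; lra.
have [x0 [Ox0 ax0]] : exists x0, Omega x0 /\ 0 < arg x0.
  have argp : 0 < arg p.
    rewrite /arg (bdry_rho drho bp) addr0 /sqr_dist big1 ?subr0// => i _.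
    by rewrite subrr expr0n.
  have n0 : nbhs p [set x | 0 < arg x].
    have /cvgrPdist_lt/(_ _ argp) := Ck_continuous openT (carg setT 0%N openT) (x := p) I.
    by apply: filterS => x /=; rewrite ltr_norml => /andP[_]; lra.
  by have [x0 [Ox0 ax0]] := cp _ n0; exists x0.
suff : 0 < integral_rV Omega (divergence W) by rewrite L0 ltxx.
apply: (integral_rV_gt0 oO adW _ Ox0 (pos _ Ox0 ax0)) => x Ox.
have [ax|ax] := ltP 0 (arg x); first exact/ltW/pos.
by rewrite dW// flat_le0// mul0r.
Qed.

End necessity.
End boundary_condition.

(** * The W^1 product and weak gradients *)

Section W1_dot_bilinear.
Variables (R : realType) (n : nat) (Omega : set 'rV[R]_n).
Hypothesis oO : open Omega.
Implicit Types (f g : 'rV[R]_n -> R).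

Lemma W1_dotC f g : W1_dot Omega f g = W1_dot Omega g f.
Proof.
rewrite /W1_dot; apply: (f_equal2 +%R).
  by apply: integral_rV_eq => x _; rewrite mulrC.
by apply: eq_bigr => j _; apply: integral_rV_eq => x _; rewrite mulrC.
Qed.

Lemma W1_dot_eq f f' g : (forall x, Omega x -> f x = f' x) ->
  W1_dot Omega f g = W1_dot Omega f' g.
Proof.
move=> ff'; rewrite /W1_dot; apply: (f_equal2 +%R).
  by apply: integral_rV_eq => x Ox; rewrite ff'.
apply: eq_bigr => j _; apply: integral_rV_eq => x Ox.
by rewrite (partial_eq oO j ff' Ox).
Qed.

Lemma W1_dot_ge0 f : 0 <= W1_dot Omega f f.
Proof.
rewrite addr_ge0//; first by apply: integral_rV_ge0 => x _; exact: sqr_ge0.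
by apply: sumr_ge0 => k _; apply: integral_rV_ge0 => x _; exact: sqr_ge0.
Qed.

Let Ckc_prod f g : Ckc Omega 0 f -> Ckc Omega 0 g ->
  integrable_rV Omega (fun x => f x * g x).
Proof.
by move=> af ag; exact: (Ckc_integrable oO (CkcMr oO af (Ckc_Ck ag))).
Qed.

Lemma W1_dotZl (a : R) f g : Ckc Omega 1 f -> Ckc Omega 1 g ->
  W1_dot Omega (fun x => a * f x) g = a * W1_dot Omega f g.
Proof.
move=> af ag; have p j : Ckc Omega 0 (partial j f) by exact: Ckc_partial.
have pg j : Ckc Omega 0 (partial j g) by exact: Ckc_partial.
rewrite /W1_dot mulrDr -(integral_rVZ oO _ (Ckc_prod (CkcS af) (CkcS ag))) mulr_sumr.
congr (_ + _); first by apply: integral_rV_eq => x _; rewrite mulrA.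
apply: eq_bigr => j _; rewrite -(integral_rVZ oO _ (Ckc_prod (p j) (pg j))).
by apply: integral_rV_eq => x Ox; rewrite (partialZ oO _ _ (Ckc_Ck af) Ox) mulrA.
Qed.

Lemma W1_dot_suml (I : Type) (r : seq I) (F : I -> 'rV[R]_n -> R) g :
  (forall i, Ckc Omega 1 (F i)) -> Ckc Omega 1 g ->
  W1_dot Omega (fun x => \sum_(i <- r) F i x) g = \sum_(i <- r) W1_dot Omega (F i) g.
Proof.
move=> aF ag; have p i j : Ckc Omega 0 (partial j (F i)) by exact: Ckc_partial.
have pg j : Ckc Omega 0 (partial j g) by exact: Ckc_partial.
rewrite /W1_dot big_split/=; congr (_ + _).
  rewrite -(integral_rV_sum oO _ (fun i => Ckc_prod (CkcS (aF i)) (CkcS ag))).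
  by apply: integral_rV_eq => x _; rewrite mulr_suml.
rewrite exchange_big/=; apply: eq_bigr => j _.
rewrite -(integral_rV_sum oO _ (fun i => Ckc_prod (p i j) (pg j))).
apply: integral_rV_eq => x Ox.
by rewrite (partial_sum oO r j (fun i _ => Ckc_Ck (aF i)) Ox) mulr_suml.
Qed.

Lemma W1_pairing_eq f f' b : (forall x, Omega x -> f x = f' x) ->
  W1_pairing Omega f b = W1_pairing Omega f' b.
Proof.
move=> ff'; apply: eq_bigr => k _; apply: W1_dot_eq => x Ox.
exact: (partial_eq oO k ff' Ox).
Qed.

Lemma W1_dot0l g : W1_dot Omega (fun=> 0) g = 0.
Proof.
have d0 (j : 'I_n) x : partial j (fun=> 0 : R) x = 0 by exact: derive_cst.
rewrite /W1_dot (integral_rV_eq (g := fun=> 0)) => [|x _]; last by rewrite mul0r.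
rewrite (integral_rV0 oO) add0r big1// => j _.
rewrite (integral_rV_eq (g := fun=> 0)) => [|x _]; last by rewrite d0 mul0r.
exact: (integral_rV0 oO).
Qed.

Lemma W1_pairing0 b : W1_pairing Omega (fun=> 0) b = 0.
Proof.
apply: big1 => k _; rewrite -[RHS](W1_dot0l (b k)).
by apply: W1_dot_eq => x _; exact: derive_cst.
Qed.

End W1_dot_bilinear.

Section weak_gradient.
Variables (R : realType) (n : nat) (Omega : set 'rV[R]_n) (rho : 'rV[R]_n -> R).
Hypothesis drho : defining_function Omega rho.
Implicit Types (f g u : 'rV[R]_n -> R).

Let oO := defining_open drho.

Lemma test_function_Ckc eta k : test_function Omega eta -> Ckc Omega k eta.
Proof.
move=> [seta [K [cK KO K0]]]; split; first exact/Ck_subset/smooth_Ck.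
by exists K => // x _; exact: K0.
Qed.

Lemma Ck_weak_partial f j : Ck Omega 1 f -> weak_partial Omega j f (partial j f).
Proof.
move=> cf eta teta; have ae k := test_function_Ckc k teta.
have [seta [K [cK KO K0]]] := teta.
apply/eqP; rewrite -addr_eq0.
have a1 : Ckc Omega 0 (fun x => f x * partial j eta x).
  by apply: (CkcMl oO); [exact: CkS|exact: (Ckc_partial oO)].
have a2 : Ckc Omega 0 (fun x => partial j f x * eta x).
  by apply: (CkcMl oO); [exact: Ck_partial|exact: ae].
rewrite -(integral_rVD oO (Ckc_integrable oO a1) (Ckc_integrable oO a2)).
rewrite (integral_rV_eq (g := partial j (fun x => f x * eta x))) => [|x Ox]; last first.
  by rewrite (partialM j cf (Ckc_Ck (ae 1%N)) Ox) [_ * eta x]mulrC.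
have sup : supported Omega K (fun x => f x * eta x).
  by move=> x Ox nK; rewrite K0// mulr0.
have cfe : Ck Omega 1 (fun x => f x * eta x).
  exact: (CkM oO cf (Ckc_Ck (ae 1%N))).
by apply/eqP; exact: (integral_partial_eq0 j oO cK KO sup cfe).
Qed.

Lemma Ckc_L2 f : Ckc Omega 0 f -> L2 Omega f.
Proof.
move=> af; split; first exact: (Ck_measurable oO (Ckc_Ck af)).
have := integrable_lty (measurable_open oO) (Ckc_integrable oO (CkcMr oO af (Ckc_Ck af))).
by [].
Qed.

Lemma integrable_L2M f g : L2 Omega f -> L2 Omega g ->
  integrable_rV Omega (fun x => f x * g x).
Proof.
move=> [mf If] [mg Ig].
have L2i h : measurable_rV Omega h ->
    (\int[lebesgue_tuple R n]_(t in @row_of_tuple R n @^-1` Omega)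
     ((h (row_of_tuple t)) ^+ 2)%:E < +oo)%E ->
    integrable_rV Omega (fun x => h x ^+ 2).
  move=> mh Ih; apply/integrableP; split.
    apply/measurable_EFinP; exact: (measurable_funX 2 mh).
  apply: le_lt_trans Ih; apply: ge0_le_integral => //.
  - exact: measurable_open.
  - by apply: measurableT_comp => //; apply/measurable_EFinP; exact: (measurable_funX 2 mh).
  - by apply/measurable_EFinP; exact: (measurable_funX 2 mh).
  - by move=> t _ /=; rewrite lee_fin ger0_norm ?sqr_ge0.
apply: (le_integrable_rV oO (g := fun x => f x ^+ 2 + g x ^+ 2)).
- exact: measurable_funM.
- by apply: (integrable_rVD oO); exact: L2i.
- move=> x _; rewrite normrM.
  have := sqr_ge0 (`|f x| - `|g x|); rewrite sqrrB !real_normK ?num_real//.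
  have := sqr_ge0 (f x); have := sqr_ge0 (g x).
  by move: (`|f x| * `|g x|) => y; rewrite -mulr_natl; nra.
Qed.

(** A function that is smooth up to the boundary is not a test function, but
   its product with [cutoff m], extended by zero, is one; let [m] tend to
   infinity. *)
Lemma weak_partial_unique f g u j : Ck Omega 1 f -> weak_partial Omega j f g ->
  L2 Omega g -> (forall k, Ckc Omega k u) ->
  integral_rV Omega (fun x => u x * g x) =
  integral_rV Omega (fun x => u x * partial j f x).
Proof.
move=> cf wg Lg au; have [cu [K cK Ku]] := au 0%N.
pose eta m x : R := if pselect (Omega x) then cutoff rho m x * u x else 0.
have etaE m x : Omega x -> cutoff rho m x * u x = eta m x.
  by move=> Ox; rewrite /eta; case: pselect.
have teta m : test_function Omega (eta m).
  have [C [cC CO C0]] := cutoff_support drho m cK Ku.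
  have clC : closed C by apply: compact_closed cC; exact: norm_hausdorff.
  have eta0 x : ~ C x -> eta m x = 0.
    by move=> nC; rewrite /eta; case: pselect => // Ox; exact: C0.
  split; last by exists C.
  apply: Ck_smooth => k; apply: (Ck_zero_ext oO clC CO eta0).
  apply: (Ck_eq oO (etaE m)); apply: (CkM oO); last exact: Ckc_Ck.
  exact: Ck_cutoff.
have mg := Lg.1.
have ug := integrable_L2M (Ckc_L2 (au 0%N)) Lg.
have E m : integral_rV Omega (fun x => cutoff rho m x * (u x * g x)) =
           integral_rV Omega (fun x => cutoff rho m x * (u x * partial j f x)).
  have := wg _ (teta m); rewrite (Ck_weak_partial j cf (teta m)) => /oppr_inj H.
  have H' h : integral_rV Omega (fun x => cutoff rho m x * (u x * h x)) =
      integral_rV Omega (fun x => h x * eta m x).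
    by apply: integral_rV_eq => x Ox; rewrite -etaE//; ring.
  by rewrite !H' H.
have L h : measurable_rV Omega h -> integrable_rV Omega h ->
    integral_rV Omega (fun x => cutoff rho m x * h x) @[m --> \oo] --> integral_rV Omega h.
  move=> mh Ih; apply: (dominated_cvg_rV oO (g := fun x => `|h x|)) => //.
  - move=> m; apply: measurable_funM => //.
    exact: (Ck_measurable oO (Ck_cutoff drho 0 m)).
  - exact: integrable_abse Ih.
  - move=> m x Ox; rewrite normrM ler_piMl// ger0_norm ?cutoff_ge0//.
    exact: cutoff_le1.
  - move=> x Ox; rewrite -[X in _ --> X]mul1r; apply: cvgM; last exact: cvg_cst.
    exact: (cutoff_cvg drho).
have L1 := L _ (measurable_funM (Ck_measurable oO (Ckc_Ck (au 0%N))) mg) ug.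
have au' : Ckc Omega 0 (fun x => u x * partial j f x).
  by apply: (CkcMr oO) => //; exact: Ck_partial.
have L3 := L _ (Ck_measurable oO (Ckc_Ck au')) (Ckc_integrable oO au').
(* Both sides are limits of the same sequence, by E. *)
rewrite (_ : (fun m => _) = (fun m => integral_rV Omega
   (fun x => cutoff rho m x * (u x * g x)))) in L3; last first.
  by apply/funext => m; rewrite E.
exact: (cvg_unique _ L1 L3).
Qed.

End weak_gradient.

(** * Forms with complex coefficients *)

Section complex_parts.
Variable R : realType.
Implicit Types z w : R[i].

Lemma Re_mul_conj z w :
  complex.Re (z * w^*%C) = complex.Re z * complex.Re w + complex.Im z * complex.Im w.
Proof. by case: z w => [a b] [c d] /=; rewrite mulrN opprK. Qed.

Lemma Im_mul_conj z w :
  complex.Im (z * w^*%C) = complex.Im z * complex.Re w - complex.Re z * complex.Im w.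
Proof. by case: z w => [a b] [c d] /=; ring. Qed.

Lemma Re_sum (I : Type) (r : seq I) (P : pred I) (F : I -> R[i]) :
  complex.Re (\sum_(i <- r | P i) F i) = \sum_(i <- r | P i) complex.Re (F i).
Proof. by apply: (big_morph (@complex.Re R)) => // -[a b] [c d]. Qed.

Lemma Im_sum (I : Type) (r : seq I) (P : pred I) (F : I -> R[i]) :
  complex.Im (\sum_(i <- r | P i) F i) = \sum_(i <- r | P i) complex.Im (F i).
Proof. by apply: (big_morph (@complex.Im R)) => // -[a b] [c d]. Qed.

Lemma Re_mul_real (a : R) z : complex.Re (a%:C%C * z) = a * complex.Re z.
Proof. by case: z => x y /=; rewrite mul0r subr0. Qed.

Lemma Im_mul_real (a : R) z : complex.Im (a%:C%C * z) = a * complex.Im z.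
Proof. by case: z => x y /=; rewrite mul0r addr0. Qed.

Lemma norm_complex_le z (B : R) : `|complex.Re z| + `|complex.Im z| <= B ->
  `|z| <= B%:C%C.
Proof.
case: z => a b /= abB; rewrite normc_def lecE/= eqxx/=.
apply: le_trans abB; rewrite -[leRHS]ger0_norm ?addr_ge0// -sqrtr_sqr ler_wsqrtr//.
rewrite sqrrD !real_normK ?num_real// lerD2r lerDl.
by rewrite mulrn_wge0// mulr_ge0.
Qed.

Lemma norm_complex_ge z (B : R) : `|z| <= B%:C%C ->
  `|complex.Re z| <= B /\ `|complex.Im z| <= B.
Proof.
case: z => a b /=; rewrite normc_def lecE/= eqxx/= => H; split; apply: le_trans H;
  by rewrite -sqrtr_sqr ler_wsqrtr// ?lerDl ?lerDr sqr_ge0.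
Qed.

Lemma complex_eq0 z : complex.Re z = 0 -> complex.Im z = 0 -> z = 0.
Proof. by case: z => a b /= -> ->. Qed.

End complex_parts.

Section forms.
Variables (R : realType) (n : nat) (Omega : set 'rV[R]_n) (rho : 'rV[R]_n -> R).
Hypothesis drho : defining_function Omega rho.
Let oO := defining_open drho.

Local Notation re f := (@complex.Re R \o f).
Local Notation im f := (@complex.Im R \o f).

Definition Ckc_form q (phi : diff_form R n q) : Prop :=
  forall I k, Ckc Omega k (re (phi I)) /\ Ckc Omega k (im (phi I)).

Lemma smooth_forms_Ckc q (phi : diff_form R n q) :
  smooth_forms Omega q phi -> Ckc_form phi.
Proof.
move=> [sphi [K cK K0]] I k; have [sr si] := sphi I.
split; (split; first exact: smooth_closure_Ck); exists K => // x Ox nK /=;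
  by rewrite K0//; exact: subset_closure.
Qed.

Definition real_epsilon q (j : 'I_n) (I : multi_index n q) (J : multi_index n q.+1) : R :=
  if (j \notin val I) && (val J == j |: val I)%SET
  then (-1) ^+ #|[set i in val I | (i < j)%N]| else 0.

Lemma epsilonE q j (I : multi_index n q) J : epsilon R j I J = (real_epsilon j I J)%:C%C.
Proof.
rewrite /epsilon /real_epsilon; case: ifP => // _.
by rewrite rmorphXn/= rmorphN1.
Qed.

Lemma Re_ext_d q (phi : diff_form R n q) J : re (ext_d phi J) =
  fun x => \sum_I \sum_k real_epsilon k I J * partial k (re (phi I)) x.
Proof.
apply/funext => x; rewrite /= /ext_d Re_sum; apply: eq_bigr => I _.
by rewrite Re_sum; apply: eq_bigr => k _; rewrite epsilonE Re_mul_real.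
Qed.

Lemma Im_ext_d q (phi : diff_form R n q) J : im (ext_d phi J) =
  fun x => \sum_I \sum_k real_epsilon k I J * partial k (im (phi I)) x.
Proof.
apply/funext => x; rewrite /= /ext_d Im_sum; apply: eq_bigr => I _.
by rewrite Im_sum; apply: eq_bigr => k _; rewrite epsilonE Im_mul_real.
Qed.

Lemma Ckc_ext_d q (phi : diff_form R n q) : Ckc_form phi -> Ckc_form (ext_d phi).
Proof.
move=> aphi J k; rewrite Re_ext_d Im_ext_d.
by split; apply: (Ckc_sum oO) => I; apply: (Ckc_sum oO) => j; apply: (CkcZ oO);
  apply: (Ckc_partial oO); have [] := aphi I k.+1.
Qed.

Lemma W1_gradient_smooth q (psi : diff_form R n q) : Ckc_form psi ->
  W1_gradient Omega psi (form_grad psi).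
Proof.
move=> apsi I; have [a0 b0] := apsi I 0%N; have [a1 b1] := apsi I 1%N.
split; first by split; apply: (Ckc_L2 drho).
move=> j; split; first by split; apply: (Ckc_L2 drho); exact: (Ckc_partial oO).
by split; apply: (Ck_weak_partial drho); exact: Ckc_Ck.
Qed.

(** Whatever the weak gradient of [psi] is, the product with a form that is
   smooth up to the boundary is computed by the classical one. *)
Lemma W1_inner_parts q (alpha psi : diff_form R n q) Psi : Ckc_form alpha ->
  Ckc_form psi -> W1_gradient Omega psi Psi ->
  complex.Re (W1_inner Omega alpha (form_grad alpha) psi Psi) =
  \sum_I (W1_dot Omega (re (alpha I)) (re (psi I)) +
          W1_dot Omega (im (alpha I)) (im (psi I))) /\
  complex.Im (W1_inner Omega alpha (form_grad alpha) psi Psi) =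
  \sum_I (W1_dot Omega (im (alpha I)) (re (psi I)) -
          W1_dot Omega (re (alpha I)) (im (psi I))).
Proof.
move=> aa ap gp.
have L2r I : L2 Omega (re (psi I)) /\ L2 Omega (im (psi I)) by have [[]] := gp I.
have I0 u g : Ckc Omega 0 u -> L2 Omega g -> integrable_rV Omega (fun x => u x * g x).
  by move=> au; apply: (integrable_L2M drho); exact: (Ckc_L2 drho).
have ar I : Ckc Omega 0 (re (alpha I)) by have [] := aa I 0%N.
have ai I : Ckc Omega 0 (im (alpha I)) by have [] := aa I 0%N.
have dar I j k : Ckc Omega k (partial j (re (alpha I))).
  by apply: (Ckc_partial oO); have [] := aa I k.+1.
have dai I j k : Ckc Omega k (partial j (im (alpha I))).
  by apply: (Ckc_partial oO); have [] := aa I k.+1.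
have cr I : Ck Omega 1 (re (psi I)) by have [/Ckc_Ck] := ap I 1%N.
have ci I : Ck Omega 1 (im (psi I)) by have [_ /Ckc_Ck] := ap I 1%N.
split.
- rewrite /W1_inner Re_sum; apply: eq_bigr => I _.
  have [rI iI] := L2r I; have [_ gI] := gp I.
  rewrite raddfD/= /W1_dot addrACA; congr (_ + _).
    rewrite -(integral_rVD oO (I0 _ _ (ar I) rI) (I0 _ _ (ai I) iI)).
    by apply: integral_rV_eq => x _; rewrite /= Re_mul_conj.
  rewrite Re_sum -big_split/=; apply: eq_bigr => j _.
  have [[rj ij] [wr wi]] := gI j.
  rewrite -(weak_partial_unique drho (cr I) wr rj (dar I j)).
  rewrite -(weak_partial_unique drho (ci I) wi ij (dai I j)).
  rewrite -(integral_rVD oO (I0 _ _ (dar I j 0%N) rj) (I0 _ _ (dai I j 0%N) ij)).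
  by apply: integral_rV_eq => x _; rewrite /= Re_mul_conj.
- rewrite /W1_inner Im_sum; apply: eq_bigr => I _.
  have [rI iI] := L2r I; have [_ gI] := gp I.
  rewrite raddfD/= /W1_dot opprD addrACA; congr (_ + _).
    rewrite -(integral_rVB oO (I0 _ _ (ai I) rI) (I0 _ _ (ar I) iI)).
    by apply: integral_rV_eq => x _; rewrite /= Im_mul_conj.
  rewrite Im_sum -sumrB/=; apply: eq_bigr => j _.
  have [[rj ij] [wr wi]] := gI j.
  rewrite -(weak_partial_unique drho (cr I) wr rj (dai I j)).
  rewrite -(weak_partial_unique drho (ci I) wi ij (dar I j)).
  rewrite -(integral_rVB oO (I0 _ _ (dai I j 0%N) rj) (I0 _ _ (dar I j 0%N) ij)).
  by apply: integral_rV_eq => x _; rewrite /= Im_mul_conj.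
Qed.

(** The transpose of the symbol of [d], one vector field for each [I]: its
   product with a vector [v] is the [I]-th coefficient of the contraction of
   [a] with [v]. *)
Definition symbol_adjoint q (a : multi_index n q.+1 -> 'rV[R]_n -> R)
    (I : multi_index n q) (k : 'I_n) x : R := \sum_J real_epsilon k I J * a J x.

Lemma Ckc_symbol_adjoint q (a : multi_index n q.+1 -> 'rV[R]_n -> R) m I k :
  (forall J, Ckc Omega m (a J)) -> Ckc Omega m (symbol_adjoint a I k).
Proof. by move=> aa; apply: (Ckc_sum oO) => J; exact: (CkcZ oO). Qed.

(** The derivative [d] has constant coefficients, so they can be moved from
   one factor to the other. *)
Lemma W1_dot_ext_d q (u : multi_index n q -> 'rV[R]_n -> R)
    (a : multi_index n q.+1 -> 'rV[R]_n -> R) :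
  (forall I, Ckc Omega 2 (u I)) -> (forall J, Ckc Omega 1 (a J)) ->
  \sum_J W1_dot Omega (fun x => \sum_I \sum_k real_epsilon k I J * partial k (u I) x) (a J) =
  \sum_I W1_pairing Omega (u I) (symbol_adjoint a I).
Proof.
move=> au aa; have du I k : Ckc Omega 1 (partial k (u I)) by exact: (Ckc_partial oO).
have sdu J I k : Ckc Omega 1 (fun x => real_epsilon k I J * partial k (u I) x) by exact: (CkcZ oO).
have sa J I k : Ckc Omega 1 (fun x => real_epsilon k I J * a J x) by exact: (CkcZ oO).
transitivity (\sum_J \sum_I \sum_k real_epsilon k I J * W1_dot Omega (partial k (u I)) (a J)).
  apply: eq_bigr => J _; rewrite (W1_dot_suml oO) => // [|I]; last exact: (Ckc_sum oO).
  apply: eq_bigr => I _; rewrite (W1_dot_suml oO) => //.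
  by apply: eq_bigr => k _; rewrite (W1_dotZl oO).
rewrite exchange_big/=; apply: eq_bigr => I _.
rewrite exchange_big/=; apply: eq_bigr => k _.
rewrite W1_dotC /symbol_adjoint (W1_dot_suml oO) => //.
by apply: eq_bigr => J _; rewrite (W1_dotZl oO _ (aa J) (du I k)) W1_dotC.
Qed.

Lemma trace_normal_component q (a : multi_index n q.+1 -> 'rV[R]_n -> R) I p :
  closure Omega p -> (forall J, Ckc Omega 1 (a J)) ->
  trace Omega (normal_component rho (symbol_adjoint a I)) p =
  \sum_J \sum_k real_epsilon k I J * partial k rho p *
    \sum_l partial l rho p * trace Omega (partial l (a J)) p.
Proof.
move=> cp aa; apply: (trace_lim cp).
have E x : Omega x ->
  \sum_J \sum_k real_epsilon k I J * partial k rho x * \sum_l partial l rho x * partial l (a J) x =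
  normal_component rho (symbol_adjoint a I) x.
  move=> Ox; rewrite exchange_big/=; apply: eq_bigr => k _; symmetry.
  have sa J : Ckc Omega 1 (fun x => real_epsilon k I J * a J x) by exact: (CkcZ oO).
  transitivity (partial k rho x * \sum_l \sum_J real_epsilon k I J * (partial l rho x * partial l (a J) x)).
    apply: (f_equal2 *%R) => //; apply: eq_bigr => l _.
    rewrite /symbol_adjoint (partial_sum oO _ l (fun J _ => Ckc_Ck (sa J)) Ox) mulr_sumr.
    apply: eq_bigr => J _; rewrite (partialZ oO _ l (Ckc_Ck (aa J)) Ox).
    by rewrite mulrCA.
  rewrite exchange_big/= mulr_sumr; apply: eq_bigr => J _.
  by rewrite -mulr_sumr mulrA [partial k rho x * _]mulrC.
rewrite -(within_near_eq p E).
have cN k : partial k rho x @[x --> within Omega (nbhs p)] --> partial k rho p.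
  by apply: cvg_within_filter; exact: (N_continuous drho).
apply: cvg_sumr => J; apply: cvg_sumr => k; apply: cvgM.
  by apply: cvgM; [exact: cvg_cst|exact: cN].
apply: cvg_sumr => l; apply: cvgM; first exact: cN.
apply: has_trace_within cp; apply: (Ck_trace (k := 0)).
exact: Ck_partial (Ckc_Ck (aa J)).
Qed.

Lemma contract_nabla_parts q nu (phi : diff_form R n q.+1) I p (c : R) :
  Ckc_form phi -> closure Omega p -> nu p = c *: grad rho p ->
  complex.Re (contract_form (nabla Omega nu phi p) (nu p) I) =
    c ^+ 2 * trace Omega (normal_component rho (symbol_adjoint (fun J => re (phi J)) I)) p /\
  complex.Im (contract_form (nabla Omega nu phi p) (nu p) I) =
    c ^+ 2 * trace Omega (normal_component rho (symbol_adjoint (fun J => im (phi J)) I)) p.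
Proof.
move=> aphi cp nuE.
have nuj j : nu p 0 j = c * partial j rho p by rewrite nuE !mxE.
rewrite !trace_normal_component//; last 2 first.
- by move=> J; have [] := aphi J 1%N.
- by move=> J; have [] := aphi J 1%N.
split.
- rewrite /contract_form Re_sum mulr_sumr; apply: eq_bigr => J _.
  rewrite Re_sum mulr_sumr; apply: eq_bigr => k _.
  rewrite epsilonE -mulrA !Re_mul_real nuj /nabla Re_sum.
  rewrite (eq_bigr (fun l => c * (partial l rho p * trace Omega (partial l (re (phi J))) p))).
    by rewrite -mulr_sumr; ring.
  by move=> l _; rewrite Re_mul_real nuj mulrA.
- rewrite /contract_form Im_sum mulr_sumr; apply: eq_bigr => J _.
  rewrite Im_sum mulr_sumr; apply: eq_bigr => k _.
  rewrite epsilonE -mulrA !Im_mul_real nuj /nabla Im_sum.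
  rewrite (eq_bigr (fun l => c * (partial l rho p * trace Omega (partial l (im (phi J))) p))).
    by rewrite -mulr_sumr; ring.
  by move=> l _; rewrite Im_mul_real nuj mulrA.
Qed.

Lemma W1_inner_ext_d q (phi : diff_form R n q) (psi : diff_form R n q.+1) Psi :
  Ckc_form phi -> Ckc_form psi -> W1_gradient Omega psi Psi ->
  let inner := W1_inner Omega (ext_d phi) (form_grad (ext_d phi)) psi Psi in
  let b I := symbol_adjoint (fun J => re (psi J)) I in
  let b' I := symbol_adjoint (fun J => im (psi J)) I in
  complex.Re inner = \sum_I (W1_pairing Omega (re (phi I)) (b I) +
                             W1_pairing Omega (im (phi I)) (b' I)) /\
  complex.Im inner = \sum_I (W1_pairing Omega (im (phi I)) (b I) -
                             W1_pairing Omega (re (phi I)) (b' I)).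
Proof.
move=> aphi apsi gpsi inner b b'.
have [-> ->] := W1_inner_parts (Ckc_ext_d aphi) apsi gpsi.
have pr I : Ckc Omega 2 (re (phi I)) by have [] := aphi I 2%N.
have pi I : Ckc Omega 2 (im (phi I)) by have [] := aphi I 2%N.
have sr J : Ckc Omega 1 (re (psi J)) by have [] := apsi J 1%N.
have si J : Ckc Omega 1 (im (psi J)) by have [] := apsi J 1%N.
have rE J := Re_ext_d phi J; have iE J := Im_ext_d phi J.
have rr : \sum_J W1_dot Omega (re (ext_d phi J)) (re (psi J)) =
    \sum_I W1_pairing Omega (re (phi I)) (b I).
  by rewrite -(W1_dot_ext_d pr sr); apply: eq_bigr => J _; rewrite rE.
have ii : \sum_J W1_dot Omega (im (ext_d phi J)) (im (psi J)) =
    \sum_I W1_pairing Omega (im (phi I)) (b' I).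
  by rewrite -(W1_dot_ext_d pi si); apply: eq_bigr => J _; rewrite iE.
have ir : \sum_J W1_dot Omega (im (ext_d phi J)) (re (psi J)) =
    \sum_I W1_pairing Omega (im (phi I)) (b I).
  by rewrite -(W1_dot_ext_d pi sr); apply: eq_bigr => J _; rewrite iE.
have ri : \sum_J W1_dot Omega (re (ext_d phi J)) (im (psi J)) =
    \sum_I W1_pairing Omega (re (phi I)) (b' I).
  by rewrite -(W1_dot_ext_d pr si); apply: eq_bigr => J _; rewrite rE.
split.
  rewrite [LHS]big_split.
  rewrite [RHS]big_split.
  rewrite [X in X + _ = _]rr.
  rewrite [X in _ + X = _]ii.
  by [].
rewrite [LHS]sumrB [RHS]sumrB.
rewrite [X in X - _ = _]ir.
rewrite [X in _ - X = _]ri.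
by [].
Qed.

Lemma W1_normE q (phi : diff_form R n q) : Ckc_form phi ->
  W1_norm Omega phi (form_grad phi) =
  Num.sqrt (\sum_I (W1_dot Omega (re (phi I)) (re (phi I)) +
                    W1_dot Omega (im (phi I)) (im (phi I)))).
Proof.
move=> aphi; rewrite /W1_norm.
by have [-> _] := W1_inner_parts aphi aphi (W1_gradient_smooth aphi).
Qed.

Section single_coefficient.
Variables (q : nat) (I0 : multi_index n q) (u : 'rV[R]_n -> R).
Hypothesis au : forall k, Ckc Omega k u.

(** The values on the boundary are the limits of [u], as required by
   smoothness on the closure. *)
Definition single_form : diff_form R n q :=
  fun I x => if I == I0 then (trace Omega u x)%:C%C else 0.

Lemma re_single_form I :
  re (single_form I) = if I == I0 then trace Omega u else fun=> 0.
Proof. by apply/funext => x; rewrite /single_form /=; case: ifP. Qed.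

Lemma im_single_form I : im (single_form I) = fun=> 0.
Proof. by apply/funext => x; rewrite /single_form /=; case: ifP. Qed.

Lemma smooth_single_form : smooth_forms Omega q single_form.
Proof.
have s0 : smooth_closure Omega (fun=> 0 : R).
  have c0 k := Ck_cst oO k (0 : R).
  split.
  - by move=> s x j Ox; have := Ck_iter_partial s c0 1%N => /Ck_derivable; exact.
  - by move=> s; exact: Ck_trace (Ck_iter_partial s c0 0%N).
  - by move=> p _; exact: cvg_cst.
split.
  move=> I; rewrite /csmooth_closure re_single_form im_single_form; split => //.
  by case: ifP => // _; apply: (trace_smooth_closure oO) => k; exact: Ckc_Ck.
have [_ [K cK Ku]] := au 0%N; exists K => // I x cx nKx.
rewrite /single_form; case: ifP => // _; congr (_%:C%C).
apply: (trace_lim cx); apply: (@cvg_trans _ ((fun=> (0 : R)) @ within Omega (nbhs x))).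
  have nK := compact_near_notin cK nKx.
  apply: near_eq_cvg; rewrite near_withinE; apply: filterS nK => y nKy Oy.
  by rewrite Ku.
exact: cvg_cst.
Qed.

End single_coefficient.

(** Forms with the single coefficient [u] isolate the pairing with one field:
   its real part sees the real part of [psi], its imaginary part the imaginary
   part. *)
Lemma dom_dstar_trace q (psi : diff_form R n q.+1) I0 p : bdry Omega p ->
  dom_dstar Omega q psi -> Ckc_form psi ->
  trace Omega (normal_component rho (symbol_adjoint (fun J => re (psi J)) I0)) p = 0 /\
  trace Omega (normal_component rho (symbol_adjoint (fun J => im (psi J)) I0)) p = 0.
Proof.
move=> bp [Psi gPsi [C HC]] apsi.
have H u : (forall k, Ckc Omega k u) ->
   `|W1_pairing Omega u (symbol_adjoint (fun J => re (psi J)) I0)| <= C * Num.sqrt (W1_dot Omega u u) /\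
   `|W1_pairing Omega u (symbol_adjoint (fun J => im (psi J)) I0)| <= C * Num.sqrt (W1_dot Omega u u).
  move=> au; pose alpha := single_form I0 u.
  have salpha : smooth_forms Omega q alpha by exact: smooth_single_form.
  have aalpha := smooth_forms_Ckc salpha.
  have uE x : Omega x -> trace Omega u x = u x.
    by move=> Ox; apply: (trace_in oO) => //; exact: Ck_trace (Ckc_Ck (au 0%N)).
  have ralpha I b : W1_pairing Omega (re (alpha I)) b = if I == I0 then W1_pairing Omega u b else 0.
    rewrite re_single_form; case: ifP => _; last exact: (W1_pairing0 oO).
    exact: (W1_pairing_eq oO _ uE).
  have ialpha I b : W1_pairing Omega (im (alpha I)) b = 0.
    by rewrite im_single_form; exact: (W1_pairing0 oO).
  have single (F : multi_index n q -> R) : (forall I, I != I0 -> F I = 0) ->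
    \sum_I F I = F I0 by move=> F0; rewrite (bigD1 I0)//= big1 ?addr0.
  have r0 (r s : R) : s = 0 -> r + s = r by move=> ->; rewrite addr0.
  have N : W1_norm Omega alpha (form_grad alpha) = Num.sqrt (W1_dot Omega u u).
    rewrite (W1_normE aalpha); apply: (f_equal Num.sqrt).
    have im0 I : W1_dot Omega (im (alpha I)) (im (alpha I)) = 0.
      by rewrite im_single_form; exact: (W1_dot0l oO).
    rewrite single => [|I /negbTE II0]; rewrite (r0 _ _ (im0 _)) re_single_form.
      by rewrite eqxx (W1_dot_eq oO _ uE) W1_dotC (W1_dot_eq oO _ uE).
    by rewrite II0; exact: (W1_dot0l oO).
  clearbody alpha; have [ReE ImE] := W1_inner_ext_d aalpha apsi gPsi.
  have [HRe HIm] := norm_complex_ge (HC _ salpha); rewrite N in HRe HIm.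
  split.
    apply: le_trans HRe; rewrite le_eqVlt; apply/orP; left; apply/eqP/esym.
    apply: f_equal; apply: (etrans ReE); apply: (etrans (single _ _)) => [I II0|].
      apply: (etrans (r0 _ _ (ialpha I _))); apply: (etrans (ralpha I _)).
      by rewrite (negbTE II0).
    apply: (etrans (r0 _ _ (ialpha I0 _))); apply: (etrans (ralpha I0 _)).
    by rewrite eqxx.
  apply: le_trans HIm; rewrite le_eqVlt; apply/orP; left; apply/eqP/esym.
  rewrite -[RHS]normrN; apply: f_equal; apply: (etrans ImE).
  apply: (etrans (single _ _)) => [I II0|].
    apply: (etrans (f_equal2 (fun s t : R => s - t) (ialpha I _) (ralpha I _))).
    by rewrite (negbTE II0) subr0.
  apply: (etrans (f_equal2 (fun s t : R => s - t) (ialpha I0 _) (ralpha I0 _))).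
  by rewrite eqxx sub0r.
have ar m k : Ckc Omega m (symbol_adjoint (fun J => re (psi J)) I0 k).
  by apply: Ckc_symbol_adjoint => J; have [] := apsi J m.
have ai m k : Ckc Omega m (symbol_adjoint (fun J => im (psi J)) I0 k).
  by apply: Ckc_symbol_adjoint => J; have [] := apsi J m.
split.
  exact: (normal_component_eq0 drho ar (fun u au => (H u au).1) bp).
exact: (normal_component_eq0 drho ai (fun u au => (H u au).2) bp).
Qed.

Lemma trace_dom_dstar q (psi : diff_form R n q.+1) : Ckc_form psi ->
  (forall p I, bdry Omega p ->
    trace Omega (normal_component rho (symbol_adjoint (fun J => re (psi J)) I)) p = 0 /\
    trace Omega (normal_component rho (symbol_adjoint (fun J => im (psi J)) I)) p = 0) ->
  dom_dstar Omega q psi.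
Proof.
move=> apsi H; exists (form_grad psi); first exact: W1_gradient_smooth.
pose b I := symbol_adjoint (fun J => re (psi J)) I.
pose b' I := symbol_adjoint (fun J => im (psi J)) I.
have ab m I k : Ckc Omega m (b I k) by apply: Ckc_symbol_adjoint => J; have [] := apsi J m.
have ab' m I k : Ckc Omega m (b' I k) by apply: Ckc_symbol_adjoint => J; have [] := apsi J m.
pose B I := pairing_bound Omega rho (b I); pose B' I := pairing_bound Omega rho (b' I).
have bd I f : Ckc Omega 2 f -> `|W1_pairing Omega f (b I)| <= B I * Num.sqrt (W1_dot Omega f f).
  apply: (W1_pairing_bounded drho (ab 2%N I)) => p bp; have [cp _] := bp.
  have [<- _] := H p I bp; apply: has_trace_within cp.
  exact: Ck_trace (Ckc_Ck (Ckc_normal_component drho (ab 2%N I))).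
have bd' I f : Ckc Omega 2 f -> `|W1_pairing Omega f (b' I)| <= B' I * Num.sqrt (W1_dot Omega f f).
  apply: (W1_pairing_bounded drho (ab' 2%N I)) => p bp; have [cp _] := bp.
  have [_ <-] := H p I bp; apply: has_trace_within cp.
  exact: Ck_trace (Ckc_Ck (Ckc_normal_component drho (ab' 2%N I))).
exists (\sum_I ((B I + B' I) + (B I + B' I))) => phi sphi.
have aphi := smooth_forms_Ckc sphi.
have [ReE ImE] := W1_inner_ext_d aphi apsi (W1_gradient_smooth apsi).
apply: norm_complex_le; rewrite ReE ImE.
pose nrm := W1_norm Omega phi (form_grad phi).
have B0 I : 0 <= B I by apply: sumr_ge0 => k _; exact: sqrtr_ge0.
have B'0 I : 0 <= B' I by apply: sumr_ge0 => k _; exact: sqrtr_ge0.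
have le_nrm I : Num.sqrt (W1_dot Omega (re (phi I)) (re (phi I))) <= nrm /\
                Num.sqrt (W1_dot Omega (im (phi I)) (im (phi I))) <= nrm.
  rewrite /nrm (W1_normE aphi) (bigD1 I)//=.
  set S := \sum_(_ | _) _.
  have S0 : 0 <= S by apply: sumr_ge0 => J _; rewrite addr_ge0// W1_dot_ge0.
  have r0 := W1_dot_ge0 Omega (re (phi I)); have i0 := W1_dot_ge0 Omega (im (phi I)).
  by split; apply: ler_wsqrtr; move: r0 i0 S0; move: (W1_dot _ _ _) (W1_dot _ _ _) S => *; lra.
have p2 I : Ckc Omega 2 (re (phi I)) /\ Ckc Omega 2 (im (phi I)) by have := aphi I 2%N.
rewrite [X in _ <= X * _](_ : _ = \sum_I (B I + B' I) + \sum_I (B I + B' I)); last by rewrite big_split.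
rewrite mulrDl; apply: lerD; apply: le_trans (ler_norm_sum _ _ _) _;
  rewrite mulr_suml; apply: ler_sum => I _; have [n1 n2] := le_nrm I; have [r2 i2] := p2 I.
- apply: le_trans (ler_normD _ _) _; rewrite mulrDl.
  exact: lerD (le_trans (bd I _ r2) (ler_wpM2l (B0 I) n1))
              (le_trans (bd' I _ i2) (ler_wpM2l (B'0 I) n2)).
- apply: le_trans (ler_normB _ _) _; rewrite mulrDl.
  exact: lerD (le_trans (bd I _ i2) (ler_wpM2l (B0 I) n2))
              (le_trans (bd' I _ r2) (ler_wpM2l (B'0 I) n1)).
Qed.

End forms.

Theorem proposition2p1 (R : realType) (N q : nat) (hq : (q <= N)%N)
    (Omega : set 'rV[R]_N.+1)
    (hOmega : smoothly_bounded_domain Omega \/ Omega = half_space R N)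
    (nu : 'rV[R]_N.+1 -> 'rV[R]_N.+1) (hnu : unit_normal_field Omega nu) :
  dom_dstar Omega q `&` smooth_forms Omega q.+1 =
  [set phi : diff_form R N.+1 q.+1 |
    smooth_forms Omega q.+1 phi /\
    forall p, bdry Omega p ->
      forall I, contract_form (nabla Omega nu phi p) (nu p) I = 0].
Proof.
have [rho drho nuE] := hnu.
apply/seteqP; split=> [phi [dphi sphi]|phi [sphi H]].
  split => // p bp I; have [cp _] := bp; have aphi := smooth_forms_Ckc sphi.
  have [re0 im0] := dom_dstar_trace drho I bp dphi aphi.
  have [ReE ImE] := contract_nabla_parts drho I aphi cp (nuE p bp).
  by apply: complex_eq0; rewrite ?ReE ?ImE ?re0 ?im0 mulr0.
split => //; have aphi := smooth_forms_Ckc sphi.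
apply: (trace_dom_dstar drho aphi) => p I bp; have [cp _] := bp.
have [+ +] := contract_nabla_parts drho I aphi cp (nuE p bp).
rewrite (H p bp I).
have e0 : 0 < (enorm (grad rho p))^-1 ^+ 2.
  rewrite exprn_gt0// invr_gt0 sqrtr_gt0.
  rewrite (eq_bigr (fun j => partial j rho p ^+ 2)); last by move=> j _; rewrite mxE.
  exact: (normN2_gt0 drho).
by move=> h1 h2; split; [move: h1|move: h2] => /esym/eqP;
  rewrite mulf_eq0 (gt_eqF e0) => /eqP.
Qed.
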